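(* Let $(V,\boldsymbol1,T,Y,\hat{\mathcal S})$ be an $\hat{\mathcal S}$-logarithmic vertex algebra. Then the linear operator $\mathcal S$ on $V\otimes V$ defined by $$\mathcal S(a\otimes b)=\hat{\mathcal S}\bigl(Y(a,z_1)\otimes Y(b,z_2)\bigr)(\boldsymbol1\otimes\boldsymbol1)\big|_{z_1=z_2=0}$$ has the following properties: (i) $\mathcal S$ is a braiding map on $V$; (ii) $\mathcal S$ is locally nilpotent on $V\otimes V$; (iii) $(V,\boldsymbol1,T,\mu_{(n)},\mathcal S)$ is compatible (i.e. is a unital differential algebra with a compatible braiding map) for every $n\in\mathbb Z$; (iv) $\mathcal S(Y(z)\otimes I)=(Y(z)\otimes I)(\mathcal S_{13}+\mathcal S_{23})$ on $V^{\otimes 3}$; (v) $\mathcal S\in\mathrm{Der}(V)\otimes\mathrm{Der}(V)$; (vi) $\hat{\mathcal S}=(\mathrm{ad}\otimes\mathrm{ad})(\mathcal S)$ on $Y_z(V)\otimes Y_z(V)$.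
   Context: Conventions. All superspaces, tensor products and Hom's are over $\mathbb C$; $p(v)$ is the parity; formulas with $p$ are for homogeneous elements, extended linearly. $(\phi\otimes\psi)(a\otimes b)=(-1)^{p(\psi)p(a)}\phi(a)\otimes\psi(b)$; $[\cdot,\cdot]$ is the supercommutator, $\mathrm{ad}(a)b=[a,b]$; $P(a\otimes b)=(-1)^{p(a)p(b)}b\otimes a$; $I$ is the identity operator. $z,z_i,\zeta,\zeta_i$ are commuting even formal variables ($\zeta_i$ plays the role of $\log z_i$; setting $z_1=z$ also sets $\zeta_1=\zeta$). $D_z=\partial_z+z^{-1}\partial_\zeta$, $z_{12}=z_1-z_2$, $x^{(k)}=x^k/k!$ for $k\ge0$ and $x^{(k)}=0$ for $k<0$. $\vartheta_{12}=\zeta_1-\sum_{n\ge1}\frac1n z_1^{-n}z_2^n$, $\vartheta_{21}=\zeta_2-\sum_{n\ge1}\frac1n z_1^{n}z_2^{-n}$. $\mathrm{LF}(V)=\mathrm{Hom}(V,V(\!(z)\!)[\zeta])$ with its natural superspace structure; elements $a(z)=a(z,\zeta)$. Braiding map. A braiding map on a superspace $U$ is an even element $\mathcal S=\sum_i\phi_i\otimes\psi_i\in\mathrm{End}(U)\otimes\mathrm{End}(U)$ (finite sum) with $\mathcal SP=P\mathcal S$ and $[\mathcal S_{12},\mathcal S_{23}]=[\mathcal S_{13},\mathcal S_{23}]=[\mathcal S_{12},\mathcal S_{13}]=0$ on $U^{\otimes3}$, where $\mathcal S_{12}=\mathcal S\otimes I$, $\mathcal S_{23}=I\otimes\mathcal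 S$, $\mathcal S_{13}=(I\otimes P)\mathcal S_{12}(I\otimes P)$. $(\mathrm{ad}\otimes\mathrm{ad})(\mathcal S)=\sum_i\mathrm{ad}(\phi_i)\otimes\mathrm{ad}(\psi_i)$ acts by $(\mathrm{ad}(a)\otimes\mathrm{ad}(b))(c\otimes d)=(-1)^{p(b)p(c)}[a,c]\otimes[b,d]$, coefficientwise on fields. Throughout, $\hat{\mathcal S}=\sum_i\Phi_i\otimes\Psi_i$ is a braiding map on $\mathrm{LF}(V)$ (finite sum, $\Phi_i$ linearly independent, $\Psi_i$ linearly independent, $p(\Phi_i)=p(\Psi_i)$), acting on $a(z_1)\otimes b(z_2)$ by $\sum_i(-1)^{p(\Psi_i)p(a)}(\Phi_ia)(z_1)\otimes(\Psi_ib)(z_2)$. Compatibility. Let $U$ be a unital differential algebra, with a (not necessarily associative) product $\mu:U\otimes U\to U$, a unit element $1\in U$, and a derivation $D\in\mathrm{Der}(U)$. A braiding map $\mathcal S$ on $U$ is compatible with the algebra structure if $\mathcal S(a\otimes1)=0$ for all $a\in U$, $[D\otimes I,\mathcal S]=0$, and $\mathcal S(\mu\otimes I)=(\mu\otimes I)(\mathcal S_{13}+\mathcal S_{23})$. A unital differential algebra with a compatible braiding map is denoted as a quintuple $(U,1,D,\mu,\mathcal S)$, and such a quintuple is called compatible. Locality. Let $\mu(a(z_1)\otimes b(z_2))=a(z_1)b(z_2)$. $\mathcal V\subset\mathrm{LF}(V)$ is $\hat{\mathcal S}$-local if: (1) $\Phi_i\mathcal V,\Psi_i\mathcal V\subset\mathcal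 V$ for all $i$; (2) for all $a,b\in\mathcal V$ there is $r\ge1$ with $\hat{\mathcal S}^r(a\otimes b)=0$; (3) for all $a,b\in\mathcal V$ there is $N\ge0$ with $\mu(z_{12}^Ne^{\vartheta_{12}\hat{\mathcal S}}a(z_1)\otimes b(z_2))=(-1)^{p(a)p(b)}\mu(z_{12}^Ne^{\vartheta_{21}\hat{\mathcal S}}b(z_2)\otimes a(z_1))$. For such $a,b$, $\hat\mu_{(n)}(a\otimes b)\in\mathrm{LF}(V)$ is given by $\hat\mu_{(n)}(a\otimes b)(z)v=D_{z_1}^{(N-1-n)}\mu(z_{12}^Ne^{\vartheta_{12}\hat{\mathcal S}}a(z_1)\otimes b(z_2))v|_{z_1=z_2=z,\zeta_1=\zeta_2=\zeta}$ (independent of $N$). $\hat{\mathcal S}$-logarithmic vertex algebra $(V,\boldsymbol1,T,Y,\hat{\mathcal S})$: a superspace $V$, an even vector $\boldsymbol1$, an even $T\in\mathrm{End}(V)$, an even linear map $Y_z:V\to\mathrm{LF}(V)$, $a\mapsto Y(a,z)$, and a braiding map $\hat{\mathcal S}$ on $Y_z(V)$ such that: (vacuum) $Y(\boldsymbol1,z)=I$, $Y(a,z)\boldsymbol1\in V[\![z]\!]$, $Y(a,z)\boldsymbol1|_{z=0}=a$, $T\boldsymbol1=0$; (covariance) $[\mathrm{ad}(T)\otimes I,\hat{\mathcal S}]=[D_z\otimes I,\hat{\mathcal S}]=0$, $[T,Y(a,z)]=D_zY(a,z)$; (locality) $Y_z(V)$ is $\hat{\mathcal S}$-local; (hexagon)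 for all $n\in\mathbb Z$, $\hat{\mathcal S}(\hat\mu_{(n)}\otimes I)=(\hat\mu_{(n)}\otimes I)(\hat{\mathcal S}_{13}+\hat{\mathcal S}_{23})$ on $Y_z(V)^{\otimes3}$. Notation. $Y(z)(a\otimes b)=Y(a,z)b$; $Y(a,z)|_{\zeta=0}=\sum_na_{(n+\mathcal S)}z^{-n-1}$; $\mu_{(n)}(a\otimes b)=a_{(n+\mathcal S)}b$. For the $\hat{\mathcal S}$-logarithmic vertex algebra $V$, $D\in\mathrm{Der}(V)$ means $D\in\mathrm{End}(V)$ with $D(Y(a,z)b)=Y(Da,z)b+(-1)^{p(a)p(D)}Y(a,z)Db$ for all $a,b\in V$.
   Formalization: In (iii), the claim that 1 is a unit of μ_(n) is made only for n = −1: since Y(1,z)=I gives 1_(n+S)b = 0 for n ≠ −1, it fails for every other n when V ≠ 0. That T is a derivation of μ_(n) and S is compatible with it is stated for every n. *)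

(* Defs.v *)
From HB Require Import structures.
From mathcomp Require Import all_boot all_order all_algebra.
From mathcomp Require Import generic_quotient.
From mathcomp Require Import boolp classical_sets functions cardinality fsbigop.
From mathcomp Require Import reals.
From mathcomp Require Import complex.

Set Implicit Arguments.
Unset Strict Implicit.
Unset Printing Implicit Defensive.

Import Order.TTheory GRing.Theory Num.Theory.

Local Open Scope quotient_scope.
Local Open Scope classical_set_scope.
Local Open Scope ring_scope.

(* A superspace is a vector space V = V_0 (+) V_1, given by the two projections
   [spr false] (even part) and [spr true] (odd part).  A formula that is stated
   for homogeneous a, b with a sign (-1)^(p(a)p(b)) and extended linearly is
   written below as the sum over p, q of (-1)^(p && q) times the formula for
   [spr p a], [spr q b]. *)
HB.mixin Record isSuper (K : fieldType) (V : Type) of GRing.Lmodule K V := {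
  spr : bool -> V -> V;
  spr_linear : forall p, linear (spr p);
  spr_sum : forall v, spr false v + spr true v = v;
  spr_proj : forall p q v, spr p (spr q v) = if p == q then spr q v else 0
}.

#[short(type="superType")]
HB.structure Definition Super (K : fieldType) :=
  {V of isSuper K V & GRing.Lmodule K V}.

HB.instance Definition _ (K : fieldType) (V : superType K) (p : bool) :=
  GRing.isLinear.Build K V V *:%R (spr p) (spr_linear p).

Definition has_parity (K : fieldType) (V : superType K) (p : bool) (v : V) :=
  spr p v = v.

Section Hom.
Variable K : fieldType.

Section HomDef.
Variables U W : lmodType K.

Definition islin : {pred U -> W} := fun f => `[< linear f >].

Record lhom := LHom { lhom_fun :> U -> W; lhom_isl : lhom_fun \in islin }.

HB.instance Definition _ := [isSub for lhom_fun].
HB.instance Definition _ := [Choice of lhom by <:].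

Lemma islin_submod : submod_closed islin.
Proof.
split=> [|c f g /asboolP lf /asboolP lg]; apply/asboolP.
  by move=> a u v /=; rewrite !scaler0 addr0.
move=> a u v /=.
rewrite -[LHS]/(c *: f (a *: u + v) + g (a *: u + v)) lf lg.
rewrite -[(c *: f + g) u]/(c *: f u + g u) -[(c *: f + g) v]/(c *: f v + g v).
by rewrite !scalerDr !scalerA mulrC !addrA; congr (_ + _); rewrite addrAC.
Qed.

HB.instance Definition _ := GRing.isSubmodClosed.Build K (U -> W) islin
  islin_submod.
HB.instance Definition _ := [SubChoice_isSubLmodule of lhom by <:].

Lemma lhomP (f : lhom) : linear f.
Proof. exact: asboolW (lhom_isl f). Qed.

HB.instance Definition _ (f : lhom) :=
  GRing.isLinear.Build K U W *:%R (lhom_fun f) (lhomP f).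

Definition mkhom (f : U -> W) (lf : linear f) : lhom := LHom (introT (asboolP _) lf).

Lemma lhom_ext (f g : lhom) : f =1 g -> f = g.
Proof. by move=> fg; apply/val_inj/funext. Qed.

Lemma lhomD (f g : lhom) u : (f + g) u = f u + g u. Proof. by []. Qed.
Lemma lhomZ c (f : lhom) u : (c *: f) u = c *: f u. Proof. by []. Qed.
Lemma lhom0 u : (0 : lhom) u = 0. Proof. by []. Qed.

End HomDef.

Lemma idhom_subproof (U : lmodType K) : linear (@id U). Proof. by []. Qed.
Definition idhom (U : lmodType K) : lhom U U := mkhom (@idhom_subproof U).

Lemma comphom_subproof (U W X : lmodType K) (g : lhom W X) (f : lhom U W) :
  linear (g \o f).
Proof. by move=> a u v /=; rewrite !linearP. Qed.
Definition comphom (U W X : lmodType K) (g : lhom W X) (f : lhom U W) :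
  lhom U X := mkhom (comphom_subproof g f).

Section HomSuper.
Variables U W : superType K.

Lemma sprhom_subproof p (f : lhom U W) :
  linear (fun u => \sum_(q : bool) spr (p (+) q) (f (spr q u))).
Proof.
move=> a u v; rewrite scaler_sumr -big_split /=.
by apply: eq_bigr => q _; rewrite !linearP.
Qed.

Definition sprhom p (f : lhom U W) : lhom U W := mkhom (sprhom_subproof p f).

Lemma sprhom_linear p : linear (sprhom p).
Proof.
move=> a f g; apply: lhom_ext => u; rewrite lhomD lhomZ.
rewrite [in RHS]/sprhom [in RHS]/= scaler_sumr -big_split.
by apply: eq_bigr => q _; rewrite lhomD lhomZ linearP.
Qed.

Lemma sprhom_sum f : sprhom false f + sprhom true f = f.
Proof.
apply: lhom_ext => u; rewrite lhomD /= !big_bool /= addrACA.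
rewrite [X in X + _]addrC !spr_sum -linearD.
by rewrite [spr true u + _]addrC spr_sum.
Qed.

Lemma sprhom_proj p q f :
  sprhom p (sprhom q f) = if p == q then sprhom q f else 0.
Proof.
apply: lhom_ext => u; case: p; case: q; rewrite /= !big_bool /=;
  by rewrite !(linearD, spr_proj) /= !linear0 ?addr0 ?add0r !spr_proj /= ?addr0.
Qed.

HB.instance Definition _ := isSuper.Build K (lhom U W)
  sprhom_linear sprhom_sum sprhom_proj.

End HomSuper.
End Hom.

(* The tensor product: finite formal sums of pairs modulo the congruence that
   makes [:: (u, w)] bilinear.  [tlift_tpure] and [tlift_linear] give the
   universal property. *)
Section Tensor.
Variable K : fieldType.

Section TensorDef.
Variables U W : lmodType K.

Inductive tens_eq : seq (U * W) -> seq (U * W) -> Prop :=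
| tens_refl s : tens_eq s s
| tens_sym s t : tens_eq s t -> tens_eq t s
| tens_trans s t r : tens_eq s t -> tens_eq t r -> tens_eq s r
| tens_cat s1 s2 t1 t2 :
    tens_eq s1 s2 -> tens_eq t1 t2 -> tens_eq (s1 ++ t1) (s2 ++ t2)
| tens_catC s t : tens_eq (s ++ t) (t ++ s)
| tens_0l w : tens_eq [:: (0, w)] [::]
| tens_Dl u u' w : tens_eq [:: (u + u', w)] [:: (u, w); (u', w)]
| tens_Dr u w w' : tens_eq [:: (u, w + w')] [:: (u, w); (u, w')]
| tens_Z c u w : tens_eq [:: (c *: u, w)] [:: (u, c *: w)].

Definition tens_rel (s t : seq (U * W)) : bool := `[< tens_eq s t >].

Lemma tens_rel_equiv : equiv_class_of tens_rel.
Proof.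
split=> [s|s t|s t r].
- exact/asboolP/tens_refl.
- by apply/asboolP/asboolP; apply: tens_sym.
- by move=> /asboolP st /asboolP tr; apply/asboolP; apply: tens_trans tr.
Qed.

Canonical tens_equiv_rel := EquivRelPack tens_rel_equiv.

Definition tens := {eq_quot tens_rel}.
HB.instance Definition _ := Choice.on tens.
HB.instance Definition _ := EqQuotient.on tens.

Definition tmk (s : seq (U * W)) : tens := \pi_tens s.

Lemma tmkP s t : tens_eq s t <-> tmk s = tmk t.
Proof. by split=> [st|/eqmodP/asboolP]; [apply/eqmodP/asboolP|]. Qed.

Lemma tmk_repr (x : tens) : tmk (repr x) = x.
Proof. exact: reprK. Qed.

Lemma repr_tmk s : tens_eq (repr (tmk s)) s.
Proof. by apply/tmkP; rewrite tmk_repr. Qed.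

Definition sscale c (s : seq (U * W)) := [seq (c *: x.1, x.2) | x <- s].

Lemma sscale_eq c s t : tens_eq s t -> tens_eq (sscale c s) (sscale c t).
Proof.
elim=> {s t} [s|s t _|s t r _ IH1 _ IH2|s1 s2 t1 t2 _ IH1 _ IH2|s t|w|u u' w|u w w'|a u w] /=.
- exact: tens_refl.
- exact: tens_sym.
- exact: tens_trans IH2.
- by rewrite /sscale !map_cat; apply: tens_cat.
- by rewrite /sscale !map_cat; apply: tens_catC.
- by rewrite scaler0; apply: tens_0l.
- by rewrite scalerDr; apply: tens_Dl.
- exact: tens_Dr.
- by rewrite scalerA mulrC -scalerA; apply: tens_Z.
Qed.

Definition tadd (x y : tens) : tens := tmk (repr x ++ repr y).
Definition tscale c (x : tens) : tens := tmk (sscale c (repr x)).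
Definition topp (x : tens) : tens := tscale (-1) x.

Lemma taddE s t : tadd (tmk s) (tmk t) = tmk (s ++ t).
Proof. by apply/tmkP/tens_cat; apply: repr_tmk. Qed.

Lemma tscaleE c s : tscale c (tmk s) = tmk (sscale c s).
Proof. by apply/tmkP/sscale_eq/repr_tmk. Qed.

Lemma taddA : associative tadd.
Proof.
by move=> x y z; rewrite -(tmk_repr x) -(tmk_repr y) -(tmk_repr z) !taddE catA.
Qed.

Lemma taddC : commutative tadd.
Proof. by move=> x y; apply/tmkP/tens_catC. Qed.

Lemma tadd0 : left_id (tmk [::]) tadd.
Proof. by move=> x; rewrite -(tmk_repr x) taddE. Qed.

Lemma tscale0D a b s :
  tens_eq (sscale (a + b) s) (sscale a s ++ sscale b s).
Proof.
elim: s => [|[u w] s IH] /=; first exact: tens_refl.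
apply: (@tens_trans _ ([:: (a *: u, w); (b *: u, w)] ++ (sscale a s ++ sscale b s))).
  rewrite -[X in tens_eq X]cat1s scalerDl; apply: tens_cat => //.
  exact: tens_Dl.
rewrite /= -[X in tens_eq X]cat1s -[X in tens_eq _ X]cat1s.
apply: tens_cat; first exact: tens_refl.
rewrite -cat1s -[X in tens_eq _ (_ ++ X)]cat1s !catA.
apply: tens_cat; first exact: tens_catC.
exact: tens_refl.
Qed.

Lemma tscale0 s : tens_eq (sscale 0 s) [::].
Proof.
elim: s => [|[u w] s IH] /=; first exact: tens_refl.
by rewrite scale0r -cat1s -[X in tens_eq _ X]cat0s; apply: tens_cat => //; apply: tens_0l.
Qed.

Lemma sscale1 s : sscale 1 s = s.
Proof. by elim: s => [|[u w] s IH] //=; rewrite scale1r IH. Qed.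

Lemma taddN : left_inverse (tmk [::]) topp tadd.
Proof.
move=> x; rewrite -(tmk_repr x) /topp tscaleE taddE; apply/tmkP.
rewrite -[X in _ ++ X]sscale1.
apply: tens_trans (tens_sym (tscale0D _ _ _)) _.
by rewrite addNr; apply: tscale0.
Qed.

HB.instance Definition _ := GRing.isZmodule.Build tens taddA taddC tadd0 taddN.

Lemma tscaleA a b x : tscale a (tscale b x) = tscale (a * b) x.
Proof.
rewrite -(tmk_repr x) !tscaleE; congr tmk.
by rewrite /sscale -map_comp; apply: eq_map => y /=; rewrite scalerA.
Qed.

Lemma tscale1 : left_id 1 tscale.
Proof. by move=> x; rewrite -(tmk_repr x) tscaleE sscale1. Qed.

Lemma tscaleDr : right_distributive tscale +%R.
Proof.
move=> c x y; rewrite -(tmk_repr x) -(tmk_repr y).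
by rewrite [in LHS]/GRing.add /= taddE !tscaleE [RHS]taddE /sscale map_cat.
Qed.

Lemma tscaleDl x : {morph tscale^~ x : a b / a + b}.
Proof.
move=> a b; rewrite -(tmk_repr x) !tscaleE [RHS]taddE.
exact/tmkP/tscale0D.
Qed.

HB.instance Definition _ := GRing.Zmodule_isLmodule.Build K tens
  tscaleA tscale1 tscaleDr tscaleDl.

Lemma tmkD s t : tmk s + tmk t = tmk (s ++ t).
Proof. exact: taddE. Qed.

Lemma tmkZ c s : c *: tmk s = tmk (sscale c s).
Proof. exact: tscaleE. Qed.

Definition tpure (u : U) (w : W) : tens := tmk [:: (u, w)].

Lemma tpure_linl w : linear (tpure^~ w).
Proof.
by move=> c u v; rewrite tmkZ tmkD; apply/tmkP/tens_Dl.
Qed.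

Lemma tpure_linr u : linear (tpure u).
Proof.
move=> c w v; rewrite tmkZ tmkD; apply/tmkP.
apply: tens_trans (tens_Dr _ _ _) _; rewrite -cat1s -[X in tens_eq _ X]cat1s.
by apply: tens_cat; [apply/tens_sym/tens_Z|apply: tens_refl].
Qed.

Lemma tmkE s : tmk s = \sum_(x <- s) tpure x.1 x.2.
Proof.
elim: s => [|[u w] s IH]; first by rewrite big_nil.
by rewrite big_cons -IH tmkD.
Qed.

(* The linear extension of (u, w) |-> b u w.  Only meaningful for bilinear b:
   otherwise the value depends on a choice of representatives. *)
Definition tlift (X : lmodType K) (b : U -> W -> X) (x : tens) : X :=
  \sum_(y <- repr x) b y.1 y.2.

Definition bilin (X : lmodType K) (b : U -> W -> X) :=
  (forall w, linear (b^~ w)) /\ (forall u, linear (b u)).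

Lemma tlift_tmk (X : lmodType K) (b : U -> W -> X) s :
  bilin b -> tlift b (tmk s) = \sum_(y <- s) b y.1 y.2.
Proof.
move=> [bl br].
have bD u u' w : b (u + u') w = b u w + b u' w.
  by have := bl w 1 u u'; rewrite !scale1r.
have b0 w : b 0 w = 0.
  by apply: (addIr (b 0 w)); rewrite -bD !add0r.
have bD' u w w' : b u (w + w') = b u w + b u w'.
  by have := br u 1 w w'; rewrite !scale1r.
have b0' u : b u 0 = 0.
  by apply: (addIr (b u 0)); rewrite -bD' !add0r.
rewrite /tlift; have := repr_tmk s; move: (repr _) => t.
elim=> {s t} [//|//|s t r _ -> _ ->//|s1 s2 t1 t2 _ E1 _ E2|s t|w|u u' w|u w w'|c u w].
- by rewrite !big_cat /= E1 E2.
- by rewrite !big_cat /= addrC.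
- by rewrite big_seq1 big_nil b0.
- by rewrite !big_cons !big_nil !addr0 bD.
- by rewrite !big_cons !big_nil !addr0 bD'.
- rewrite !big_seq1 /=; have := bl w c u 0; have := br u c w 0.
  by rewrite /= !addr0 b0 b0' !addr0 => -> ->.
Qed.

Lemma tlift_tpure (X : lmodType K) (b : U -> W -> X) u w :
  bilin b -> tlift b (tpure u w) = b u w.
Proof. by move=> hb; rewrite tlift_tmk // big_seq1. Qed.

Lemma tlift_linear (X : lmodType K) (b : U -> W -> X) :
  bilin b -> linear (tlift b).
Proof.
move=> hb c x y; rewrite -(tmk_repr x) -(tmk_repr y).
rewrite tmkZ tmkD !tlift_tmk // big_cat /=; congr (_ + _).
rewrite big_map scaler_sumr; apply: eq_bigr => -[u w] _ /=.
have b0 : b 0 w = 0.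
  by have := hb.1 w (-1) 0 0; rewrite scaler0 addr0 scaleN1r addNr.
by have := hb.1 w c u 0; rewrite /= !addr0 b0 addr0.
Qed.

End TensorDef.

(* f (x) g without any sign; as a map of superspaces this is the tensor product
   of f and g whenever g is even. *)
Definition tmap (U U' W W' : lmodType K) (f : U -> U') (g : W -> W') :
  tens U W -> tens U' W' := tlift (fun u w => tpure (f u) (g w)).

Definition tassoc (U W X : lmodType K) : tens (tens U W) X -> tens U (tens W X) :=
  tlift (fun t x => tlift (fun u w => tpure u (tpure w x)) t).

Definition tassocV (U W X : lmodType K) : tens U (tens W X) -> tens (tens U W) X :=
  tlift (fun u t => tlift (fun w x => tpure (tpure u w) x) t).

(* (phi (x) psi)(a (x) b) = (-1)^(p(psi) p(a)) phi(a) (x) psi(b) *)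
Definition stens (U U' W W' : superType K) (phi : lhom U U') (psi : lhom W W') :
  tens U W -> tens U' W' :=
  tlift (fun a b => \sum_(p : bool) \sum_(q : bool)
    (-1) ^+ (p && q) *: tpure (phi (spr p a)) ((spr q psi : lhom W W') b)).

(* P(a (x) b) = (-1)^(p(a) p(b)) b (x) a *)
Definition sswap (U : superType K) : tens U U -> tens U U :=
  tlift (fun a b => \sum_(p : bool) \sum_(q : bool)
    (-1) ^+ (p && q) *: tpure (spr q b) (spr p a)).

End Tensor.

Section Braiding.
Variable K : fieldType.
Variable U : superType K.

(* Legs of an even operator S on U (x) U, acting on (U (x) U) (x) U. *)
Definition leg12 (S : tens U U -> tens U U) :
  tens (tens U U) U -> tens (tens U U) U := tmap S id.

Definition leg23 (S : tens U U -> tens U U) :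
  tens (tens U U) U -> tens (tens U U) U :=
  fun x => tassocV (tmap id S (tassoc x)).

Definition leg13 (S : tens U U -> tens U U) :
  tens (tens U U) U -> tens (tens U U) U :=
  fun x => leg23 (@sswap K U) (leg12 S (leg23 (@sswap K U) x)).

Definition opsum (s : seq (lhom U U * lhom U U)) (x : tens U U) : tens U U :=
  \sum_(f <- s) stens f.1 f.2 x.

(* S is an even element of End(U) (x) End(U), regarded as an operator on
   U (x) U. *)
Definition even_endo2 (S : tens U U -> tens U U) :=
  exists2 s : seq (lhom U U * lhom U U),
    (forall f, f \in s -> exists p, has_parity p f.1 /\ has_parity p f.2)
    & (forall x, S x = opsum s x).

(* S is a braiding map on the subspace E of U.  This is used for E = U, and for
   an E preserved by the factors of S. *)
Record braiding_map_on (E : set U) (S : tens U U -> tens U U) : Prop := {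
  braid_endo : even_endo2 S;
  braid_swap : forall a b, E a -> E b ->
    S (sswap (tpure a b)) = sswap (S (tpure a b));
  braid_12_23 : forall a b c, E a -> E b -> E c ->
    let x := tpure (tpure a b) c in
    leg12 S (leg23 S x) = leg23 S (leg12 S x);
  braid_13_23 : forall a b c, E a -> E b -> E c ->
    let x := tpure (tpure a b) c in
    leg13 S (leg23 S x) = leg23 S (leg13 S x);
  braid_12_13 : forall a b c, E a -> E b -> E c ->
    let x := tpure (tpure a b) c in
    leg12 S (leg13 S x) = leg13 S (leg12 S x)
}.

Definition braiding_map := braiding_map_on [set: U].

(* D(mu(a (x) b)) = mu(D a (x) b) + (-1)^(p(a) p(D)) mu(a (x) D b) *)
Definition derivation (mu : tens U U -> U) (D : lhom U U) :=
  forall x, D (mu x) = mu (stens D (idhom U) x) + mu (stens (idhom U) D x).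

Definition two_sided_unit (one : U) (mu : tens U U -> U) :=
  forall a, mu (tpure one a) = a /\ mu (tpure a one) = a.

(* The unit axiom and the derivation axiom are kept apart: [one] enters here only
   through S(a (x) one) = 0.  (For the n-th product of a logarithmic vertex
   algebra the vacuum is a unit only if n = -1.) *)
Record compatible_braiding (one : U) (D : lhom U U) (mu : tens U U -> U)
    (S : tens U U -> tens U U) : Prop := {
  compat_braid : braiding_map S;
  compat_unit : forall a, S (tpure a one) = 0;
  compat_der : forall x,
    stens D (idhom U) (S x) = S (stens D (idhom U) x);
  compat_mul : forall x : tens (tens U U) U,
    S (tmap mu id x) = tmap mu id (leg13 S x + leg23 S x)
}.

End Braiding.

Section Series.
Variable K : fieldType.

(* V((z))[zeta]: [c n k] is the coefficient of z^n zeta^k. *)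
Section SeriesDef.
Variable V : lmodType K.

Definition logseries : {pred int -> nat -> V} := fun c => `[<
  (exists k0, forall n k, (k0 <= k)%N -> c n k = 0) /\
  (forall k, exists n0 : int, forall n, n < n0 -> c n k = 0) >].

Record lser := LSer { coef :> int -> nat -> V; _ : coef \in logseries }.

HB.instance Definition _ := [isSub for coef].
HB.instance Definition _ := [Choice of lser by <:].

Lemma logseries_submod : submod_closed logseries.
Proof.
split=> [|a f g /asboolP[[kf fk] fn] /asboolP[[kg gk] gn]]; apply/asboolP.
  by split=> [|k]; exists 0.
split=> [|k].
  exists (maxn kf kg) => n k; rewrite geq_max => /andP[h1 h2].
  rewrite -[LHS]/(a *: f n k + g n k).
  by rewrite fk // gk // scaler0 addr0.
have [nf hf] := fn k; have [ng hg] := gn k.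
exists (Num.min nf ng) => n; rewrite lt_min => /andP[h1 h2].
rewrite -[LHS]/(a *: f n k + g n k).
by rewrite hf // hg // scaler0 addr0.
Qed.

HB.instance Definition _ := GRing.isSubmodClosed.Build K (int -> nat -> V)
  logseries logseries_submod.
HB.instance Definition _ := [SubChoice_isSubLmodule of lser by <:].

Lemma lser_ext (c d : lser) : (forall n k, c n k = d n k) -> c = d.
Proof. by move=> h; apply: val_inj; apply/funext => n; apply/funext => k; apply: h. Qed.

Lemma lserP (c : lser) :
  (exists k0, forall n k, (k0 <= k)%N -> c n k = 0) /\
  (forall k, exists n0 : int, forall n, n < n0 -> c n k = 0).
Proof. exact: asboolW (valP c). Qed.

Lemma lserD (c d : lser) n k : (c + d) n k = c n k + d n k. Proof. by []. Qed.
Lemma lserZ a (c : lser) n k : (a *: c) n k = a *: c n k. Proof. by []. Qed.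
Lemma lser0 n k : (0 : lser) n k = 0. Proof. by []. Qed.

Lemma lconst_subproof (v : V) :
  (fun (n : int) (k : nat) => if (n == 0) && (k == 0%N) then v else 0)
    \in logseries.
Proof.
apply/asboolP; split=> [|k].
  by exists 1%N => n [|k] //; rewrite andbF.
by exists 0 => n; case: eqP => [->|].
Qed.
Definition lconst_fun (v : V) : lser := LSer (lconst_subproof v).
Lemma lconst_linear : linear lconst_fun.
Proof.
by move=> a u v; apply: lser_ext => n k; rewrite lserD lserZ /=;
  case: ifP; rewrite ?scaler0 ?addr0.
Qed.
Definition lconst : lhom V lser := mkhom lconst_linear.

(* D_z = d/dz + z^-1 d/dzeta *)
Lemma Dz_subproof (c : lser) :
  (fun (n : int) (k : nat) =>
    (n + 1)%:~R *: c (n + 1) k + k.+1%:R *: c (n + 1) k.+1) \in logseries.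
Proof.
have [[k0 hk] hn] := lserP c; apply/asboolP; split=> [|k].
  by exists k0 => n k h; rewrite !hk ?scaler0 ?addr0 // (leq_trans h).
have [n1 h1] := hn k; have [n2 h2] := hn k.+1.
exists (Num.min (n1 - 1) (n2 - 1)) => n; rewrite lt_min !ltrBrDr => /andP[l1 l2].
by rewrite h1 // h2 // !scaler0 addr0.
Qed.
Definition Dz_fun (c : lser) : lser := LSer (Dz_subproof c).
Lemma Dz_linear : linear Dz_fun.
Proof.
move=> a c d; apply: lser_ext => n k; rewrite lserD lserZ.
rewrite -[LHS]/((n + 1)%:~R *: (a *: c (n + 1) k + d (n + 1) k)
  + k.+1%:R *: (a *: c (n + 1) k.+1 + d (n + 1) k.+1)) /=.
rewrite !scalerDr !scalerA [LHS]addrACA.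
by rewrite (mulrC a (n + 1)%:~R) (mulrC a k.+1%:R).
Qed.
Definition Dz_ser : lhom lser lser := mkhom Dz_linear.

End SeriesDef.

Section SeriesMap.
Variables V W : lmodType K.

Lemma smap_subproof (f : lhom V W) (c : lser V) :
  (fun n k => f (c n k)) \in @logseries W.
Proof.
have [[k0 hk] hn] := lserP c; apply/asboolP; split=> [|k].
  by exists k0 => n k h; rewrite hk ?linear0.
by have [n0 h] := hn k; exists n0 => n l; rewrite h ?linear0.
Qed.
Definition smap_fun (f : lhom V W) (c : lser V) : lser W :=
  LSer (smap_subproof f c).
Lemma smap_linear f : linear (smap_fun f).
Proof. by move=> a c d; apply: lser_ext => n k; rewrite lserD lserZ /= linearP. Qed.
Definition smap f : lhom (lser V) (lser W) := mkhom (smap_linear f).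

End SeriesMap.

Section SeriesSuper.
Variable V : superType K.

Definition sprser p (c : lser V) : lser V := smap (mkhom (@spr_linear K V p)) c.

Lemma sprser_linear p : linear (sprser p).
Proof. exact: linearP. Qed.
Lemma sprser_sum c : sprser false c + sprser true c = c.
Proof. by apply: lser_ext => n k; rewrite lserD /= spr_sum. Qed.
Lemma sprser_proj p q c :
  sprser p (sprser q c) = if p == q then sprser q c else 0.
Proof. by apply: lser_ext => n k; rewrite /= spr_proj; case: ifP. Qed.

HB.instance Definition _ := isSuper.Build K (lser V)
  sprser_linear sprser_sum sprser_proj.

End SeriesSuper.
End Series.

Notation LF V := (lhom V (lser V)).

Section Fields.
Variable K : fieldType.
Variable V : superType K.

Definition Dz_field (A : LF V) : LF V := comphom (Dz_ser V) A.
Lemma Dz_field_linear : linear Dz_field.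
Proof. by move=> a A B; apply: lhom_ext => v; exact: (lhomP (Dz_ser V)). Qed.
Definition Dz : lhom (LF V) (LF V) := mkhom Dz_field_linear.

(* The supercommutator [phi, A] with phi in End(V) acting coefficientwise. *)
Definition ad_field (phi : lhom V V) (A : LF V) : LF V :=
  \sum_(p : bool) \sum_(q : bool)
    (comphom (smap (spr p phi : lhom V V)) (spr q A : LF V)
     - (-1) ^+ (p && q) *: comphom (spr q A : LF V) (spr p phi : lhom V V)).
Lemma ad_field_linear phi : linear (ad_field phi).
Proof.
move=> a A B; rewrite /ad_field scaler_sumr -big_split /=.
apply: eq_bigr => p _; rewrite scaler_sumr -big_split /=.
apply: eq_bigr => q _; apply: lhom_ext => v.
set A1 : LF V := spr q A; set B1 : LF V := spr q B; set phi1 : lhom V V := spr p phi.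
rewrite linearP.
rewrite -[LHS]/(smap phi1 (a *: A1 v + B1 v)
   - (-1) ^+ (p && q) *: (a *: A1 (phi1 v) + B1 (phi1 v))).
rewrite -[RHS]/(a *: (smap phi1 (A1 v) - (-1) ^+ (p && q) *: A1 (phi1 v))
   + (smap phi1 (B1 v) - (-1) ^+ (p && q) *: B1 (phi1 v))).
rewrite linearP scalerDr opprD addrACA scalerBr; congr (_ + _ + _).
by rewrite !scalerA mulrC.
Qed.
Definition ad (phi : lhom V V) : lhom (LF V) (LF V) := mkhom (ad_field_linear phi).

(* Formal series in z_1, z_2, zeta_1, zeta_2 with coefficients in V:
   [F n1 n2 k1 k2] is the coefficient of
   z_1^n1 z_2^n2 zeta_1^k1 zeta_2^k2.  Infinite sums of coefficients are
   written as finitely supported sums; all of them have finite support in the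
   situations where they are used. *)
Definition ser2 : Type := int -> int -> nat -> nat -> V.

(* a(z_1) b(z_2) v, for t = a(z_1) (x) b(z_2) *)
Definition prod2 (t : tens (LF V) (LF V)) (v : V) : ser2 :=
  tlift (fun a b : LF V => (fun n1 n2 k1 k2 => a (b v n2 k2) n1 k1)
    : int -> int -> nat -> nat -> V) t.

Definition mul_z12 (F : ser2) : ser2 := fun n1 n2 k1 k2 =>
  F (n1 - 1) n2 k1 k2 - F n1 (n2 - 1) k1 k2.

(* multiplication by zeta_1 - \sum_(n >= 1) n^-1 z_1^-n z_2^n *)
Definition mul_theta12 (F : ser2) : ser2 := fun n1 n2 k1 k2 =>
  (if k1 is k.+1 then F n1 n2 k k2 else 0)
  - \sum_(n \in [set n : nat | (0 < n)%N])
      n%:R^-1 *: F (n1 + n%:Z) (n2 - n%:Z) k1 k2.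

(* the exchange of the indices 1 and 2 of the variables *)
Definition swap12 (F : ser2) : ser2 := fun n1 n2 k1 k2 => F n2 n1 k2 k1.

Definition D_z1 (F : ser2) : ser2 := fun n1 n2 k1 k2 =>
  (n1 + 1)%:~R *: F (n1 + 1) n2 k1 k2 + k1.+1%:R *: F (n1 + 1) n2 k1.+1 k2.

(* D_(z_1)^(j), the divided power *)
Definition D_z1_div (j : int) (F : ser2) : ser2 := fun n1 n2 k1 k2 =>
  if j is Posz i then (i`!%:R)^-1 *: iter i D_z1 F n1 n2 k1 k2 else 0.

(* z_1 = z_2 = z and zeta_1 = zeta_2 = zeta *)
Definition diag (F : ser2) (n : int) (k : nat) : V :=
  \sum_(n1 \in [set: int]) \sum_(k1 < k.+1) F n1 (n - n1) k1 (k - k1)%N.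

Section Locality.
Variable Shat : tens (LF V) (LF V) -> tens (LF V) (LF V).

(* mu(e^(theta_12 Shat) t) v *)
Definition exp_theta12 (t : tens (LF V) (LF V)) (v : V) : ser2 :=
  fun n1 n2 k1 k2 => \sum_(k \in [set: nat])
    (k`!%:R)^-1 *: iter k mul_theta12 (prod2 (iter k Shat t) v) n1 n2 k1 k2.

(* For t = a (x) b this is
     mu(z_12^N e^(theta_12 Shat) a(z_1) (x) b(z_2))
     = (-1)^(p(a) p(b)) mu(z_12^N e^(theta_21 Shat) b(z_2) (x) a(z_1)),
   theta_21 being theta_12 with the indices 1 and 2 exchanged. *)
Definition local_order (N : nat) (t : tens (LF V) (LF V)) :=
  forall v, iter N mul_z12 (exp_theta12 t v)
          = iter N mul_z12 (swap12 (exp_theta12 (sswap t) v)).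

Definition nprod_coef (N : nat) (n : int) (t : tens (LF V) (LF V)) (v : V) :
  int -> nat -> V :=
  diag (D_z1_div (N%:Z - 1 - n) (iter N mul_z12 (exp_theta12 t v))).

(* The n-th product of a local pair; it does not depend on N. *)
Definition nprod (n : int) (a b : LF V) : LF V :=
  xget 0 [set A : LF V | exists N, local_order N (tpure a b) /\
    forall v m k, A v m k = nprod_coef N n (tpure a b) v m k].

End Locality.

Section LogVA.
Variables (m : nat) (Phi Psi : 'I_m -> lhom (LF V) (LF V)).

Definition Shat (t : tens (LF V) (LF V)) : tens (LF V) (LF V) :=
  \sum_(i < m) stens (Phi i) (Psi i) t.

Definition lin_indep (W : lmodType K) (f : 'I_m -> W) :=
  forall c : 'I_m -> K, \sum_(i < m) c i *: f i = 0 -> forall i, c i = 0.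

Record is_local (E : set (LF V)) : Prop := {
  local_inv : forall i A, E A -> E (Phi i A) /\ E (Psi i A);
  local_nil : forall A B, E A -> E B ->
    exists2 r, (0 < r)%N & iter r Shat (tpure A B) = 0;
  local_comm : forall A B, E A -> E B ->
    exists N, local_order Shat N (tpure A B)
}.

Variables (vac : V) (T : lhom V V) (Y : lhom V (LF V)).

(* The linear map a (x) b |-> nprod n Y(a,z) Y(b,z). *)
Definition nprodY (n : int) : tens V V -> LF V :=
  tlift (fun a b => nprod Shat n (Y a) (Y b)).

(* Shat is given on LF(V) by sum_i Phi_i (x) Psi_i; since Phi_i and Psi_i
   preserve Y_z(V) (by locality), it restricts to Y_z(V), where it is required
   to be a braiding map.  Identities on tensor powers of Y_z(V) are stated
   through the surjections Y (x) Y and Y (x) Y (x) Y. *)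
Record log_vertex_algebra : Prop := {
  lva_parity : forall i, exists p, has_parity p (Phi i) /\ has_parity p (Psi i);
  lva_indep : lin_indep Phi /\ lin_indep Psi;
  lva_braid : braiding_map_on (range Y) Shat;
  lva_vac_even : has_parity false vac;
  lva_T_even : has_parity false T;
  lva_Y_even : has_parity false Y;
  lva_vac_id : Y vac = lconst V;
  lva_creation_reg : forall a n k, (n < 0) || (0 < k)%N -> Y a vac n k = 0;
  lva_creation : forall a, Y a vac 0 0%N = a;
  lva_T_vac : T vac = 0;
  lva_adT : forall t : tens V V, let x := tmap Y Y t in
    tmap (ad T) id (Shat x) = Shat (tmap (ad T) id x);
  lva_Dz : forall t : tens V V, let x := tmap Y Y t in
    tmap Dz id (Shat x) = Shat (tmap Dz id x);
  lva_cov : forall a, ad T (Y a) = Dz (Y a);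
  lva_local : is_local (range Y);
  (* y is the element of V^(x)3 which represents (Shat_13 + Shat_23) x *)
  lva_hexagon : forall (n : int) (x y : tens (tens V V) V),
    let Y3 := tmap (tmap Y Y) Y in
    Y3 y = leg13 Shat (Y3 x) + leg23 Shat (Y3 x) ->
    Shat (tmap (nprodY n) Y x) = tmap (nprodY n) Y y
}.

(* A |-> A(z) vac at z = zeta = 0 *)
Definition eval0 (A : LF V) : V := A vac 0 0%N.

(* S(a (x) b) = Shat(Y(a,z_1) (x) Y(b,z_2))(vac (x) vac) at z_1 = z_2 = 0;
   there is no sign because vac is even. *)
Definition Sop (t : tens V V) : tens V V :=
  tmap eval0 eval0 (Shat (tmap Y Y t)).

(* Y(z) : V (x) V -> V((z))[zeta] *)
Definition Yz : tens V V -> lser V := tlift (fun a b => Y a b).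

Definition Yz_coef (n : int) (k : nat) (t : tens V V) : V := Yz t n k.

(* a_(n+S) b, the coefficient of z^(-n-1) zeta^0 in Y(a,z)b *)
Definition mu_n (n : int) : tens V V -> V := Yz_coef (- n - 1) 0.

(* D Y(a,z)b = Y(D a,z)b + (-1)^(p(a) p(D)) Y(a,z)D b *)
Definition Yder (D : lhom V V) := forall t,
  smap D (Yz t) = Yz (stens D (idhom V) t) + Yz (stens (idhom V) D t).

End LogVA.
End Fields.

(* Main.v *)
(* All statements are first transported to V: S = (ev (x) ev) Shat (Y (x) Y) with
   ev A = A(z) vac at z = zeta = 0 satisfies (Y (x) Y) S = Shat (Y (x) Y), and ev inverts Y,
   so S inherits the braiding identities and local nilpotency.  The matrix elements
   Y(a,z_1) Y(b,z_2) c are treated as linear maps on V (x) V (x) V, on which the legs of S act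
   by commuting locally nilpotent operators; (1 - z_2/z_1)^S is then a power series in S.
   Locality with c = vac gives Y(z) = Y(z)|_(zeta=0) o e^(-zeta S); the constant term of
   locality in zeta_2 shows that S passes through I (x) Y as S_12 + S_13; skew-symmetry
   and Y(Ta,z) = D_z Y(a,z) follow.  Moving all the translations to the left turns the
   products Y(a,z_1) Y(b,z_2) c into translates of products Y(b',z) Y(c',w) a', and locality
   of that pair yields Y(a,z)_(n) Y(b,z) = Y(a_(n) b, z).  The hexagon axiom becomes the
   compatibility of S with the n-th products, which for a shortest homogeneous
   representation of S, whose factors are linearly independent, says that the factors
   are derivations. *)

From HB Require Import structures.
Require Import Defs.
From mathcomp Require Import all_boot all_order all_algebra.
From mathcomp Require Import boolp classical_sets functions cardinality fsbigop.
From mathcomp Require Import reals complex.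
From mathcomp Require Import ring zify.

Set Implicit Arguments.
Unset Strict Implicit.
Unset Printing Implicit Defensive.

Import Order.TTheory GRing.Theory Num.Theory.
Local Open Scope classical_set_scope.
Local Open Scope ring_scope.

(** The hexagon axiom speaks of n-th products of fields, which say nothing about V before they are
    known to be the fields of the states a_(n) b. Up to that point everything has to come from the
    other axioms, and locality only compares products of two fields; so the rules by which S passes
    through Y are first obtained under a further Y(z), and S(a (x) vac) = 0 is at first replaced by
    a weaker statement about products with vac.

    The exponents are operators. To compute with them as with numbers, a coefficient is regarded as
    a K-linear function of a polynomial q in three variables, namely the polynomial in S12, S13, S23
    applied to the argument beforehand. The heuristic behind the constants is that z^m e^(- zeta u)
    is the power z^(m - u): hence binomials of m - u from D_z, and powers of 1 - z_2/z_1 from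
    translating a logarithm.

    Truncation bounds and orders of locality depend on the vector, whereas cancelling z_1 - z_2 or
    (1 - z_2/z_1)^S needs one bound for all q. Local nilpotency provides it, because the polynomials
    in the three operators applied to one vector span a finite-dimensional space. *)

Section Sums.
Variable V : zmodType.

(** Collects a product of two series by total degree [l = k + i]; by the vanishing hypothesis the
    square and the triangle carry the same terms. *)
Lemma sum_triangle (n : nat) (g : nat -> nat -> V) :
  (forall k i, (n <= k + i)%N -> g k i = 0) ->
  \sum_(k < n) \sum_(i < n) g k i
  = \sum_(l < n) \sum_(i < l.+1) g (l - i)%N i.
Proof.
move=> g0.
have -> : \sum_(k < n) \sum_(i < n) g k i
    = \sum_(i < n) \sum_(k < n) \sum_(l < n | (l : nat) == (k + i)%N) g k i.
  rewrite exchange_big; apply: eq_bigr => i _; apply: eq_bigr => k _.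
  have [ltn|le] := ltnP (k + i) n; last first.
    by rewrite g0 // big1.
  by rewrite (big_pred1 (Ordinal ltn)).
have -> : \sum_(l < n) \sum_(i < l.+1) g (l - i)%N i
    = \sum_(l < n) \sum_(i < n | (i <= l)%N) g (l - i)%N i.
  apply: eq_bigr => l _; rewrite (big_ord_widen n (fun i => g (l - i)%N i)) //.
rewrite [RHS](exchange_big_dep xpredT) //=; apply: eq_bigr => i _.
rewrite (exchange_big_dep (fun l : 'I_n => (i <= l)%N)) /=; last first.
  by move=> k l _ /eqP ->; exact: leq_addl.
apply: eq_bigr => l le_il; rewrite (big_pred1 (Ordinal (leq_ltn_trans (leq_subr i l) (ltn_ord l)))) //= => k.
by apply/eqP/eqP => [h|-> /=]; [apply: val_inj; rewrite /= h addnK|rewrite subnK].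
Qed.

Lemma sum_ord_widen (m n : nat) (f : nat -> V) :
  (m <= n)%N -> (forall i, (m <= i)%N -> f i = 0) ->
  \sum_(i < n) f i = \sum_(i < m) f i.
Proof.
move=> le f0; rewrite (big_ord_widen n f le) [in RHS]big_mkcond.
by apply: eq_bigr => i _; case: ltnP => // /f0.
Qed.

Lemma fsum_nat (n : nat) (f : nat -> V) :
  (forall i, (n <= i)%N -> f i = 0) ->
  \sum_(i \in [set: nat]) f i = \sum_(i < n) f i.
Proof.
move=> f0; rewrite (fsbig_ord _ n f); apply/esym/fsbig_widen => // i [_ /= /negP].
by rewrite -leqNgt => /f0.
Qed.

Lemma fsum_nat_pos (n : nat) (f : nat -> V) :
  (forall i, (n <= i)%N -> f i = 0) -> f 0%N = 0 ->
  \sum_(i \in [set i : nat | (0 < i)%N]) f i = \sum_(i < n) f i.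
Proof.
move=> f0 f00; rewrite -(fsum_nat f0); apply: fsbig_widen => // i [_ /= /negP].
by rewrite lt0n negbK => /eqP->.
Qed.

Lemma fsum_int (d n : nat) (f : int -> V) :
  (forall m, m < - d%:Z -> f m = 0) ->
  (forall m, n%:Z - d%:Z <= m -> f m = 0) ->
  \sum_(m \in [set: int]) f m = \sum_(i < n) f (i%:Z - d%:Z).
Proof.
move=> f1 f2.
rewrite (reindex_fsbig (fun i : int => i - d%:Z) [set: int]) /=; last first.
  split=> // [a b _ _ /addIr //|m _]; exists (m + d%:Z) => //; exact: addrK.
rewrite (fsbig_ord _ n (fun i => f (i%:Z - d%:Z))).
rewrite -(reindex_fsbig Posz `I_n (Posz @` `I_n) (fun i : int => f (i - d%:Z))); last first.
  by split=> [a an|a b _ _ [//]|m [a an <-]]; [exists a|exists a].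
apply/esym/fsbig_widen => // m [_ /= h].
have [m0|m0] := ltP m 0; first by apply: f1; lia.
have [mn|mn] := ltP m n%:Z; last by apply: f2; lia.
by case: h; exists `|m|%N; lia.
Qed.

End Sums.

Lemma fact_bin (K : numFieldType) (k l : nat) : (l <= k)%N ->
  (l`!%:R)^-1 * ((k - l)`!%:R)^-1 = 'C(k, l)%:R / k`!%:R :> K.
Proof.
move=> le; rewrite -(bin_fact le) !natrM invfM invfM mulVKf //.
by rewrite pnatr_eq0 -lt0n bin_gt0.
Qed.

(** * Binomial coefficients with operator arguments *)

Section Binomials.
Variables (K : numFieldType) (A : comNzRingType) (iota : {rmorphism K -> A}).
Implicit Types s t : A.

(** Cancellation works in any [A] because [j.+1] is the image under [iota] of a unit of [K]. *)
Lemma natA_inj (j : nat) (x y : A) : j.+1%:R * x = j.+1%:R * y -> x = y.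
Proof.
move=> h; have u : iota j.+1%:R^-1 * j.+1%:R = 1.
  by rewrite -(rmorph_nat iota) -rmorphM mulVf ?pnatr_eq0 // rmorph1.
by rewrite -[x]mul1r -u -mulrA h mulrA u mul1r.
Qed.

(* The binomial coefficient of [t] over [j]; the divisions take place in [K]. *)
Fixpoint rbin t (j : nat) : A :=
  if j is i.+1 then iota i.+1%:R^-1 * ((t - i%:R) * rbin t i) else 1.

Lemma rbinS t j : j.+1%:R * rbin t j.+1 = (t - j%:R) * rbin t j.
Proof.
rewrite /= mulrA -{1}(rmorph_nat iota) -rmorphM divff ?pnatr_eq0 //.
by rewrite rmorph1 mul1r.
Qed.

Lemma rbin_pascal t j : rbin (t + 1) j.+1 = rbin t j.+1 + rbin t j.
Proof.
elim: j => [|j IH]; first by rewrite /= invr1 rmorph1; ring.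
apply: (@natA_inj j.+1); rewrite rbinS IH [RHS]mulrDr rbinS; have := rbinS t j.
move: (rbin t j.+1) (rbin t j) => b1 b0; rewrite -!natr1 => h.
by apply: subr0_eq; rewrite -(subrr ((t - j%:R) * b0)) -{2}h; ring.
Qed.

Lemma rbin_absorb t j : j.+1%:R * rbin (t + 1) j.+1 = (t + 1) * rbin t j.
Proof.
rewrite rbin_pascal mulrDr rbinS -natr1; ring.
Qed.

Lemma rbin_vandermonde s t k :
  rbin (s + t) k = \sum_(i < k.+1) rbin s (k - i) * rbin t i.
Proof.
elim: k => [|k IH]; first by rewrite big_ord1 /= mulr1.
apply: (@natA_inj k); rewrite rbinS IH !mulr_sumr.
(* The factor splits as (s - (k - i)) + (t - i), and each half raises one of the two lower
   indices. *)
have -> : \sum_(i < k.+1) (s + t - k%:R) * (rbin s (k - i) * rbin t i)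
   = \sum_(i < k.+1) ((k.+1 - i)%:R * rbin s (k.+1 - i)) * rbin t i
   + \sum_(i < k.+1) rbin s (k.+1 - i.+1) * (i.+1%:R * rbin t i.+1).
  rewrite -big_split; apply: eq_bigr => i _ /=.
  have le : (i <= k)%N by rewrite -ltnS.
  rewrite subSn // !rbinS subSS.
  have -> : k%:R = (k - i)%:R + i%:R :> A by rewrite -natrD subnK.
  ring.
have -> : \sum_(i < k.+1) ((k.+1 - i)%:R * rbin s (k.+1 - i)) * rbin t i
   = \sum_(i < k.+2) ((k.+1 - i)%:R * rbin s (k.+1 - i)) * rbin t i.
  by rewrite [RHS]big_ord_recr /= subnn mul0r mul0r addr0.
have -> : \sum_(i < k.+1) rbin s (k.+1 - i.+1) * (i.+1%:R * rbin t i.+1)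
   = \sum_(i < k.+2) rbin s (k.+1 - i) * (i%:R * rbin t i).
  by rewrite [RHS]big_ord_recl /= mul0r mulr0 add0r.
rewrite -big_split; apply: eq_bigr => i _ /=.
have le : (i <= k.+1)%N by rewrite -ltnS.
have -> : k.+1%:R = (k.+1 - i)%:R + i%:R :> A by rewrite -natrD subnK.
ring.
Qed.

(* The coefficient of q^i in (1 - q)^t. *)
Definition cc t (i : nat) : A := (-1) ^+ i * rbin t i.

Lemma cc0 t : cc t 0 = 1. Proof. by rewrite /cc mul1r. Qed.

Lemma ccS t i : i.+1%:R * cc t i.+1 = (i%:R - t) * cc t i.
Proof. by rewrite /cc mulrCA rbinS exprS; ring. Qed.

(** The recursion is the differential equation (1 - q) f' = - t f read on coefficients; its solution
    is fixed by the constant term. *)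
Lemma cc_uniq t (f : nat -> A) :
  f 0%N = 1 -> (forall i, i.+1%:R * f i.+1 = (i%:R - t) * f i) ->
  f =1 cc t.
Proof.
move=> f0 fS; elim=> [|i IH]; first by rewrite f0 cc0.
by apply: (@natA_inj i); rewrite fS ccS IH.
Qed.

(** Negation of the upper index; it converts powers of 1 - q into the binomials that [Psi]
    produces. *)
Lemma cc_bin t k : cc t k = rbin (k%:R - 1 - t) k.
Proof.
apply/esym; move: k; apply: cc_uniq => // i.
have -> : i.+1%:R - 1 - t = (i%:R - 1 - t) + 1 :> A by rewrite -natr1; ring.
by rewrite rbin_absorb; ring.
Qed.

Lemma cc_pascal t i : cc t i.+1 - cc t i = cc (t + 1) i.+1.
Proof. by rewrite /cc rbin_pascal exprS; ring. Qed.

Lemma cc_vandermonde s t k :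
  cc (s + t) k = \sum_(i < k.+1) cc s (k - i) * cc t i.
Proof.
rewrite /cc rbin_vandermonde mulr_sumr; apply: eq_bigr => i _.
have le : (i <= k)%N by rewrite -ltnS.
rewrite -{1}(subnK le) exprD; ring.
Qed.

Lemma cc_0 i : cc 0 i = (i == 0%N)%:R.
Proof.
case: i => [|i]; first by rewrite cc0.
elim: i => [|i IH].
  by apply: (@natA_inj 0%N); rewrite ccS mulr0n subrr mul0r mulr0.
by apply: (@natA_inj i.+1); rewrite ccS IH !mulr0.
Qed.

Lemma cc_opp t k : \sum_(i < k.+1) cc t (k - i) * cc (- t) i = (k == 0%N)%:R.
Proof. by rewrite -cc_vandermonde subrr cc_0. Qed.

Lemma rbin_nat (n k : nat) : rbin n%:R k = 'C(n, k)%:R.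
Proof.
elim: n k => [|n IH] [|k]; rewrite ?bin0 //.
  elim: k => [|k IHk] /=; first by rewrite subr0 mul0r mulr0.
  by rewrite -[iota _ * _ in X in _ * (_ * X)]/(rbin 0%:R k.+1) IHk !mulr0.
have -> : rbin n.+1%:R k.+1 = rbin (n%:R + 1) k.+1 by rewrite natr1.
by rewrite rbin_pascal !IH binS natrD.
Qed.

(** The n-th finite difference of a binomial polynomial lowers its degree by n. The vanishing for
    [j < n] is what turns a sum over all powers into a residue in [residue_Psi]. *)
Lemma rbin_difference (n : nat) t j :
  \sum_(m < n.+1) (-1) ^+ m * 'C(n, m)%:R * rbin (m%:R + t) j
  = (-1) ^+ n * (if (n <= j)%N then rbin t (j - n) else 0).
Proof.
elim: n j => [|n IH] j.
  by rewrite big_ord1 /= bin0 subn0 add0r !mul1r.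
have -> : \sum_(m < n.+2) (-1) ^+ m * 'C(n.+1, m)%:R * rbin (m%:R + t) j
  = \sum_(m < n.+1) (-1) ^+ m * 'C(n, m)%:R
      * (rbin (m%:R + t) j - rbin (m.+1%:R + t) j).
  rewrite big_ord_recl /= bin0 expr0.
  under eq_bigr => m _ do rewrite /bump /= add1n binS natrD !mulrDr mulrDl.
  rewrite big_split /= addrA.
  have -> : 1 * 1 * rbin (0%:R + t) j +
     \sum_(i < n.+1) (-1) ^+ i.+1 * 'C(n, i.+1)%:R * rbin (i.+1%:R + t) j
     = \sum_(i < n.+1) (-1) ^+ i * 'C(n, i)%:R * rbin (i%:R + t) j.
    rewrite big_ord_recr /= bin_small // mulr0 mul0r addr0.
    by rewrite [RHS]big_ord_recl /= bin0 expr0.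
  rewrite -big_split; apply: eq_bigr => m _ /=; rewrite exprS; ring.
case: j => [|j].
  by rewrite /= mulr0 big1 // => m _; rewrite subrr mulr0.
transitivity (- \sum_(m < n.+1) (-1) ^+ m * 'C(n, m)%:R * rbin (m%:R + t) j).
  rewrite -sumrN; apply: eq_bigr => m _.
  have -> : m.+1%:R + t = m%:R + t + 1 :> A by rewrite -natr1; ring.
  by rewrite rbin_pascal; ring.
by rewrite IH ltnS subSS exprS; ring.
Qed.

Lemma iota_sign n c : iota ((-1) ^+ n * c) = (-1) ^+ n * iota c.
Proof. by rewrite rmorphM rmorphXn rmorphN1. Qed.

(** The coefficient of zeta^k in e^(- zeta t). *)
Definition dpow t k : A := iota ((-1) ^+ k / k`!%:R) * t ^+ k.

Lemma dpowE t k : dpow t k = iota ((-1) ^+ k / k`!%:R) * t ^+ k.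
Proof. by []. Qed.

Lemma dpow0 t : dpow t 0 = 1.
Proof. by rewrite /dpow fact0 divr1 rmorph1 mul1r. Qed.

Lemma dpowS t k : k.+1%:R * dpow t k.+1 = - t * dpow t k.
Proof.
have h : iota (k.+1`!%:R)^-1 * k.+1%:R = iota (k`!%:R)^-1.
  rewrite -(rmorph_nat iota) -rmorphM factS natrM invfM mulrC mulrA divff ?mul1r //.
  by rewrite pnatr_eq0.
by rewrite /dpow !iota_sign -h !exprS; ring.
Qed.

Lemma iota_dpow1 t : iota (-1) * dpow t 1 = t.
Proof. by rewrite /dpow divr1 !expr1 mulrA -rmorphM mulrNN mulr1 rmorph1 mul1r. Qed.

Lemma dpowD s t k :
  dpow (s + t) k = \sum_(l < k.+1) dpow s (k - l) * dpow t l.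
Proof.
have e r n : dpow r n = iota (n`!%:R)^-1 * (- r) ^+ n.
  by rewrite /dpow iota_sign [(- r) ^+ n]exprNn; ring.
rewrite e opprD exprDn mulr_sumr; apply: eq_bigr => l _.
have le : (l <= k)%N by rewrite -ltnS.
have := congr1 iota (fact_bin K le); rewrite !rmorphM rmorph_nat => h.
rewrite -[_ *+ 'C(k, l)]mulr_natl.
transitivity ('C(k, l)%:R * iota (k`!%:R)^-1 * ((- s) ^+ (k - l) * (- t) ^+ l)); first by ring.
by rewrite -h !e; ring.
Qed.

Lemma dpow_mulN r s n l :
  dpow r n * dpow (- s) l = iota (l`!%:R^-1 * ((-1) ^+ n / n`!%:R)) * (r ^+ n * s ^+ l).
Proof.
rewrite [_^-1 * (_ * _)]mulrCA /dpow !iota_sign rmorphM [(- s) ^+ l]exprNn.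
have h : (-1) ^+ l * (-1) ^+ l = 1 :> A by rewrite -exprMn mulrNN mulr1 expr1n.
transitivity ((-1) ^+ l * (-1) ^+ l
  * ((-1) ^+ n * (iota l`!%:R^-1 * iota n`!%:R^-1) * (r ^+ n * s ^+ l))); first by ring.
by rewrite h mul1r.
Qed.

End Binomials.
Arguments rbin : simpl never.

(** * Series in two variables *)

(* [F m n q] stands for the coefficient of z_1^m z_2^n after the argument has been acted
   on by [q]; [A] will be the ring of polynomials in commuting operators. *)
Section TwoVar.
Variables (K : numFieldType) (A : comNzRingType) (iota : {rmorphism K -> A}).
Variable V : lmodType K.
Implicit Types (F G : int -> int -> A -> V) (s t u q : A).

Local Notation rbin := (rbin iota).
Local Notation cc := (cc iota).

(** [K]-linearity in the polynomial argument, phrased through [iota] because [A] is given only as a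
    ring. *)
Definition klin (f : A -> V) :=
  (forall p q, f (p + q) = f p + f q) /\ (forall c q, f (iota c * q) = c *: f q).

Section Klin.
Variables (f : A -> V) (lf : klin f).

Lemma klin0 : f 0 = 0.
Proof. by apply: (addIr (f 0)); rewrite -lf.1 !add0r. Qed.

Lemma klin_sum (I : Type) (r : seq I) (P : pred I) (g : I -> A) :
  f (\sum_(i <- r | P i) g i) = \sum_(i <- r | P i) f (g i).
Proof. exact: (big_morph f lf.1 klin0). Qed.

Lemma klin_sign (n : nat) q : f ((-1) ^+ n * q) = (-1) ^+ n *: f q.
Proof. by rewrite -lf.2 rmorphXn rmorphN1. Qed.

Lemma klin_nat (n : nat) q : f (n%:R * q) = n%:R *: f q.
Proof. by rewrite -lf.2 rmorph_nat. Qed.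

Lemma klin_int (m : int) q : f (m%:~R * q) = m%:~R *: f q.
Proof. by rewrite -lf.2 rmorph_int. Qed.

Lemma klinN q : f (- q) = - f q.
Proof. by have := klin_sign 1 q; rewrite !expr1 mulN1r scaleN1r. Qed.

Lemma klinB p q : f (p - q) = f p - f q.
Proof. by rewrite lf.1 klinN. Qed.

End Klin.

Definition sg (n : int) : K := (-1) ^+ `|n|%N.

Lemma sgD m n : sg (m + n) = sg m * sg n.
Proof.
rewrite /sg -exprD -signr_odd -[RHS]signr_odd; congr (_ ^+ _).
by congr nat_of_bool; lia.
Qed.

Lemma sg_nat (n : nat) : sg n%:Z = (-1) ^+ n. Proof. by []. Qed.

Lemma sgB m n : sg (m - n) = sg m * sg n.
Proof. by rewrite sgD /sg abszN. Qed.

(* Multiplication by z_1 - z_2. *)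
Definition mz F : int -> int -> A -> V :=
  fun m n q => F (m - 1) n q - F m (n - 1) q.

(** The bound on the powers of z_2 is uniform in the argument [q], so every expansion in z_2/z_1 is
    a finite sum. *)
Definition trunc (d : nat) F := forall m n q, n < - d%:Z -> F m n q = 0.

(* Multiplication by (1 - z_2/z_1)^t. *)
Definition Eser t F : int -> int -> A -> V := fun m n q =>
  \sum_(i \in [set: nat]) F (m + i%:Z) (n - i%:Z) (cc t i * q).

Lemma EserE d B t F m n q : trunc d F -> n + d%:Z < B%:Z ->
  Eser t F m n q = \sum_(i < B) F (m + i%:Z) (n - i%:Z) (cc t i * q).
Proof. by move=> tF lt; apply: fsum_nat => i le; apply: tF; lia. Qed.

Lemma Eser_trunc d t F : trunc d F -> trunc d (Eser t F).
Proof. by move=> tF m n q lt; rewrite (@EserE d 0) ?big_ord0 //; lia. Qed.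

Lemma klin_comp_mul (f : A -> V) t : klin f -> klin (fun q => f (t * q)).
Proof.
by move=> lf; split=> [p q|c q]; rewrite ?mulrDr ?lf.1 // mulrCA lf.2.
Qed.

Lemma klin_bigsum (n : nat) (f : nat -> A -> V) :
  (forall i, klin (f i)) -> klin (fun q => \sum_(i < n) f i q).
Proof.
move=> lf; split=> [p q|c q].
  by rewrite -big_split; apply: eq_bigr => i _; apply: (lf i).1.
by rewrite scaler_sumr; apply: eq_bigr => i _; apply: (lf i).2.
Qed.

Lemma Eser_klin d t F m n : trunc d F -> (forall m n, klin (F m n)) ->
  klin (Eser t F m n).
Proof.
move=> tF lF; have lt : n + d%:Z < (`|n + d%:Z|.+1)%:Z by lia.
have -> : Eser t F m n = fun q => \sum_(i < `|n + d%:Z|.+1)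
    F (m + i%:Z) (n - i%:Z) (cc t i * q).
  by apply: funext => q; exact: EserE lt.
apply: (@klin_bigsum _ (fun (i : nat) q => F (m + i%:Z) (n - i%:Z) (cc t i * q))) => i.
exact: klin_comp_mul.
Qed.

Lemma mz_trunc d F : trunc d F -> trunc d (mz F).
Proof. by move=> tF m n q lt; rewrite /mz !tF ?subrr //; lia. Qed.

Lemma iter_mz_trunc d N F : trunc d F -> trunc d (iter N mz F).
Proof. by move=> tF; elim: N => //= N; apply: mz_trunc. Qed.

Lemma mz_klin F : (forall m n, klin (F m n)) -> forall m n, klin (mz F m n).
Proof.
move=> lF m n; split=> [p q|c q]; rewrite /mz.
  by rewrite !(lF _ _).1 opprD addrACA.
by rewrite !(lF _ _).2 scalerBr.
Qed.

Lemma iter_mz_klin N F :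
  (forall m n, klin (F m n)) -> forall m n, klin (iter N mz F m n).
Proof. by move=> lF; elim: N => //= N; apply: mz_klin. Qed.

(** A series killed by z_1 - z_2 is constant along antidiagonals, and following one towards lower
    powers of z_2 leaves the support. *)
Lemma mz_torsion d F q : trunc d F ->
  (forall m n, mz F m n q = 0) -> forall m n, F m n q = 0.
Proof.
move=> tF h m n; have [k] := ubnP `|n + d%:Z|; elim: k m n => // k IH m n lt.
have [lt0|ge0] := ltP n (- d%:Z); first exact: tF.
have := h (m + 1) n; rewrite /mz addrK => /subr0_eq ->.
have [lt0|ge1] := ltP (n - 1) (- d%:Z); first exact: tF.
by apply: IH; lia.
Qed.

Lemma iter_mz_torsion d N F q : trunc d F ->
  (forall m n, iter N mz F m n q = 0) -> forall m n, F m n q = 0.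
Proof.
move=> tF; elim: N => // N IH h; apply: IH; apply: (@mz_torsion d) => //.
exact: iter_mz_trunc.
Qed.

(** The operator is unitriangular with respect to the power of z_2. *)
Lemma Eser_inj d t F : trunc d F -> (forall m n, klin (F m n)) ->
  (forall m n q, Eser t F m n q = 0) -> forall m n q, F m n q = 0.
Proof.
move=> tF lF h m n q; have [k] := ubnP `|n + d%:Z|.
elim: k m n q => // k IH m n q lt.
have [lt0|ge0] := ltP n (- d%:Z); first exact: tF.
have := h m n q; rewrite (@EserE d `|n + d%:Z|.+1) //; last by lia.
rewrite big_ord_recl big1 ?addr0 => [|i _].
  by rewrite /= cc0 mul1r.
rewrite !lift0; have [lt0|ge1] := ltP (n - i.+1%:Z) (- d%:Z); first exact: tF.
by apply: IH; lia.
Qed.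

(** Since z_1 - z_2 = z_1 (1 - z_2/z_1), the iterated product is z_1^M (1 - z_2/z_1)^(M + u) F: the
    power z_1^M accounts for the shift by [M], and the exponent [- M - u] undoes the rest. *)
Lemma Eser_inverse d B M u F m n q :
  trunc d F -> (forall m n, klin (F m n)) -> n + d%:Z < B%:Z ->
  \sum_(i < B) iter M mz (Eser u F) (m + M%:Z + i%:Z) (n - i%:Z)
     (cc (- M%:R - u) i * q) = F m n q.
Proof.
move=> tF lF lt; elim: M => [|M IH].
  under eq_bigr => i _.
    rewrite /= (@EserE d B) //; last by lia.
    over.
  rewrite (sum_triangle (g := fun i j : nat => F (m + 0 + i%:Z + j%:Z) (n - i%:Z - j%:Z)
     (cc u j * (cc (- 0%:R - u) i * q)))); last first.
    by move=> i j le; apply: tF; lia.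
  case: B lt => [|B] lt; first by rewrite big_ord0 tF //; lia.
  have E (l : nat) : \sum_(i < l.+1) F (m + 0 + (l - i)%N%:Z + i%:Z) (n - (l - i)%N%:Z - i%:Z)
     (cc u i * (cc (- 0%:R - u) (l - i) * q)) = F (m + l%:Z) (n - l%:Z) ((l == 0%N)%:R * q).
    rewrite -(cc_opp iota (- u)) mulr_suml klin_sum //; apply: eq_bigr => i _.
    have le : (i <= l)%N by rewrite -ltnS.
    congr (F _ _ _); [lia|lia|rewrite opprK mulrA [cc u i * _]mulrC].
    by rewrite oppr0 add0r.
  under eq_bigr => l _ do rewrite E.
  rewrite big_ord_recl big1 ?addr0 => [|i _]; last by rewrite mul0r klin0.
  by rewrite /= mul1r.
have tE := Eser_trunc u tF; have lE k l : klin (Eser u F k l) by exact: Eser_klin tF lF.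
rewrite -{}IH; set g := iter M mz (Eser u F).
have tg : trunc d g by exact: iter_mz_trunc.
have lg k l : klin (g k l) by exact: iter_mz_klin.
set t := - M%:R - u; have -> : - M.+1%:R - u = t - 1 by rewrite /t -natr1; ring.
rewrite [iter M.+1 _ _]/(mz g) /mz sumrB.
case: B lt => [|B] lt; first by rewrite !big_ord0 subrr.
rewrite big_ord_recl [X in _ - X = _]big_ord_recr [in RHS]big_ord_recl /= !cc0.
rewrite [X in _ - (_ + X)]tg ?addr0; last by lia.
rewrite -addrA; congr (_ + _); first by congr (g _ _ _); lia.
rewrite -sumrB; apply: eq_bigr => i _; rewrite /bump leq0n add1n.
have -> : m + M.+1%:Z + i.+1%:Z - 1 = m + M%:Z + i.+1%:Z by lia.
have -> : m + M.+1%:Z + i%:Z = m + M%:Z + i.+1%:Z by lia.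
have -> : n - i%:Z - 1 = n - i.+1%:Z by lia.
rewrite -klinB //; congr (g _ _ _); rewrite -mulrBl cc_pascal.
by congr (cc _ _ * _); ring.
Qed.

(* [Psi F] stands for F(z_1 - z_2, - z_2), expanded in powers of z_2 / z_1. *)
Definition Psi F : int -> int -> A -> V := fun m n q =>
  sg n *: \sum_(i \in [set: nat])
    F (m + i%:Z) (n - i%:Z) (rbin (m + i%:Z)%:~R i * q).

Lemma PsiE d B F m n q : trunc d F -> n + d%:Z < B%:Z ->
  Psi F m n q = sg n *: \sum_(i < B)
    F (m + i%:Z) (n - i%:Z) (rbin (m + i%:Z)%:~R i * q).
Proof. by move=> tF lt; congr (_ *: _); apply: fsum_nat => i le; apply: tF; lia. Qed.

Lemma Psi_trunc d F : trunc d F -> trunc d (Psi F).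
Proof. by move=> tF m n q lt; rewrite (@PsiE d 0) ?big_ord0 ?scaler0 //; lia. Qed.

Definition shift1 (a : int) F : int -> int -> A -> V := fun m n => F (m - a) n.

(** The substitution takes z_1 to z_1 - z_2, so a factor z_1 - z_2 outside is a factor z_1
    inside. *)
Lemma Psi_mz d F : trunc d F -> (forall m n, klin (F m n)) ->
  forall m n q, mz (Psi F) m n q = Psi (shift1 1 F) m n q.
Proof.
move=> tF lF m n q; set B := `|(n + d%:Z)%R|%N.
have lt : n + d%:Z < B.+1%:Z by lia.
have tF' : trunc d (shift1 1 F) by move=> ? ? ? ?; apply: tF.
rewrite /mz !(@PsiE d B.+1) //; last by lia.
rewrite sgB [sg 1]expr1 mulrN1 scaleNr opprK -scalerDr; congr (_ *: _).
rewrite [X in _ + X]big_ord_recr /= [X in _ + (_ + X)]tF ?addr0; last by lia.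
rewrite big_ord_recl [in RHS]big_ord_recl -addrA -big_split /=; congr (_ + _).
  by rewrite /shift1; congr (F _ _ _); lia.
apply: eq_bigr => i _; rewrite /bump leq0n add1n /shift1.
have -> : m + i.+1%:Z - 1 = m + i%:Z by lia.
have -> : m - 1 + i.+1%:Z = m + i%:Z by lia.
have -> : n - 1 - i%:Z = n - i.+1%:Z by lia.
have -> : (m + i.+1%:Z)%:~R = (m + i%:Z)%:~R + 1 :> A.
  by rewrite -(intrD A _ 1); congr (_%:~R); lia.
by rewrite rbin_pascal mulrDl (lF _ _).1.
Qed.

(** The substitution takes z_1 - z_2 to (z_1 - z_2) + z_2 = z_1. *)
Lemma Psi_mz_z1 d F : trunc d F -> (forall m n, klin (F m n)) ->
  forall m n q, Psi (mz F) m n q = Psi F (m - 1) n q.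
Proof.
move=> tF lF m n q; set B := `|(n + d%:Z)%R|%N.
have lt : n + d%:Z < B.+1%:Z by lia.
have tF' := mz_trunc tF.
rewrite !(@PsiE d B.+1) //; congr (_ *: _).
rewrite /mz sumrB big_ord_recl [X in _ - X]big_ord_recr.
rewrite [X in _ - (_ + X)]tF ?addr0; last by rewrite /=; lia.
rewrite [in RHS]big_ord_recl -addrA -sumrB /=; congr (_ + _).
  by congr (F _ _ _); lia.
apply: eq_bigr => i _; rewrite /bump leq0n add1n.
have -> : m + i.+1%:Z - 1 = m + i%:Z by lia.
have -> : m - 1 + i.+1%:Z = m + i%:Z by lia.
have -> : n - i%:Z - 1 = n - i.+1%:Z by lia.
have -> : (m + i.+1%:Z)%:~R = (m + i%:Z)%:~R + 1 :> A.
  by rewrite -(intrD A _ 1); congr (_%:~R); lia.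
by rewrite rbin_pascal mulrDl (lF _ _).1 addrK.
Qed.

Lemma shift1_klin a F :
  (forall m n, klin (F m n)) -> forall m n, klin (shift1 a F m n).
Proof. by move=> lF m n; apply: lF. Qed.

Lemma shift1_trunc d a F : trunc d F -> trunc d (shift1 a F).
Proof. by move=> tF m n q; apply: tF. Qed.

Lemma mz_shift1 a F : mz (shift1 a F) = shift1 a (mz F).
Proof.
apply: funext => m; apply: funext => n; apply: funext => q.
by rewrite /mz /shift1; congr (F _ _ _ - _); lia.
Qed.

Lemma iter_mz_shift1 N a F : iter N mz (shift1 a F) = shift1 a (iter N mz F).
Proof. by elim: N => //= N ->; rewrite mz_shift1. Qed.

Lemma iter_mz_Psi d N F : trunc d F -> (forall m n, klin (F m n)) ->
  iter N mz (Psi F) = Psi (shift1 N%:Z F).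
Proof.
move=> tF lF; elim: N => [|N IH].
  congr Psi; apply: funext => m; apply: funext => n; apply: funext => q.
  by rewrite /shift1 subr0.
rewrite iterS {}IH; apply: funext => m; apply: funext => n; apply: funext => q.
rewrite (@Psi_mz d); first 1 last.
- exact: shift1_trunc.
- exact: shift1_klin.
congr (Psi _ m n q); apply: funext => k; apply: funext => l; apply: funext => p.
by rewrite /shift1; congr (F _ _ _); lia.
Qed.

Lemma Psi_iter_mz d M F : trunc d F -> (forall m n, klin (F m n)) ->
  forall m n q, Psi (iter M mz F) m n q = Psi F (m - M%:Z) n q.
Proof.
move=> tF lF; elim: M => [|M IH] m n q; first by rewrite subr0.
rewrite iterS (@Psi_mz_z1 d) ?IH.
- by congr (Psi _ _ _ _); lia.
- exact: iter_mz_trunc.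
- exact: iter_mz_klin.
Qed.

End TwoVar.

(** * Associativity as an identity between two-variable series *)

Section Assoc.
Variables (K : numFieldType) (A : comNzRingType) (iota : {rmorphism K -> A}).
Variable V : lmodType K.
Implicit Types (m n p : int) (q : A).

Local Notation rbin := (rbin iota).
Local Notation cc := (cc iota).
Local Notation Psi := (Psi iota).
Local Notation Eser := (Eser iota).
Local Notation klin := (klin iota).
Local Notation sg := (@sg K).

Variables (d : nat) (s u : A) (AA : int -> int -> A -> V).
Hypothesis AA_trunc : trunc d AA.
Hypothesis AA_lin : forall m n, klin (AA m n).

(** The substitution takes 1 - z_2/z_1 to (1 - z_2/z_1)^(-1), so the factor with exponent u merely
    lowers by u the exponent of (1 - z_2/z_1)^(m + k), which comes from (z_1 - z_2)^(m + k). *)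
Lemma Psi_Eser B m n q : n + d%:Z < B%:Z ->
  Psi (Eser u AA) m n q = sg n *:
    \sum_(k < B) AA (m + k%:Z) (n - k%:Z) (rbin ((m + k%:Z)%:~R - u) k * q).
Proof.
move=> lt; rewrite (PsiE iota _ _ (Eser_trunc iota _ AA_trunc) lt); congr (_ *: _).
under eq_bigr => k _.
  rewrite (@EserE _ _ _ _ d B) //; last by lia.
  over.
rewrite (sum_triangle (g := fun k i : nat => AA (m + k%:Z + i%:Z) (n - k%:Z - i%:Z)
   (cc u i * (rbin (m + k%:Z)%:~R k * q)))); last by move=> k i le; apply: AA_trunc; lia.
apply: eq_bigr => k _.
have -> : rbin ((m + k%:Z)%:~R - u) k = cc (- m%:~R - 1 + u) k.
  by rewrite cc_bin; congr (rbin _ _); rewrite intrD -pmulrn; ring.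
rewrite cc_vandermonde mulr_suml (klin_sum (AA_lin _ _)); apply: eq_bigr => i _.
have le : (i <= k)%N by rewrite -ltnS.
congr (AA _ _ _); [lia|lia|rewrite mulrA [cc u i * _]mulrC; congr (_ * _ * _)].
by rewrite cc_bin; congr (rbin _ _); rewrite intrD -pmulrn; ring.
Qed.

Variables (XX : int -> int -> A -> V) (Td : nat -> {linear V -> V}).
Hypothesis XX_trunc : trunc d XX.
(** With [Td r] in the role of T^r / r!, this reads XX(z_1, z_2) = e^(z_2 T) (1 - z_2/z_1)^(- s - u)
    AA(z_1 - z_2, - z_2). *)
Hypothesis XX_AA : forall B m n q, n + d%:Z < B%:Z ->
  XX m n q = \sum_(r < B) Td r (sg (n - r%:Z) *: \sum_(l < B)
     AA (m + l%:Z) (n - r%:Z - l%:Z) (rbin ((m + l%:Z)%:~R - s - u) l * q)).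

(** The factor (1 - z_2/z_1)^s cancels the [- s] in the exponent of [XX_AA], by Vandermonde; what is
    left is [Psi_Eser]. *)
Lemma Eser_Psi B m n q : n + d%:Z < B%:Z ->
  Eser s XX m n q = \sum_(r < B) Td r (Psi (Eser u AA) m (n - r%:Z) q).
Proof.
move=> lt; rewrite (@EserE _ _ _ _ d B) //.
under eq_bigr => i _.
  rewrite (@XX_AA B); last by lia.
  over.
rewrite exchange_big; apply: eq_bigr => r _ /=; rewrite -linear_sum; congr (Td _ _).
rewrite (@Psi_Eser B); last by lia.
set n' := n - r%:Z; have lt' : n' + d%:Z < B%:Z by rewrite /n'; lia.
rewrite scaler_sumr.
transitivity (\sum_(i < B) \sum_(l < B) sg (n' - i%:Z) *:
   AA (m + i%:Z + l%:Z) (n' - i%:Z - l%:Z)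
     (rbin ((m + i%:Z + l%:Z)%:~R - s - u) l * (cc s i * q))).
  apply: eq_bigr => i _; rewrite -scaler_sumr.
  have -> : n - i%:Z - r%:Z = n' - i%:Z by rewrite /n'; lia.
  by [].
rewrite (sum_triangle (g := fun i l : nat => sg (n' - i%:Z) *:
   AA (m + i%:Z + l%:Z) (n' - i%:Z - l%:Z)
     (rbin ((m + i%:Z + l%:Z)%:~R - s - u) l * (cc s i * q)))); last first.
  by move=> i l le; rewrite AA_trunc ?scaler0 //; lia.
apply: eq_bigr => k _.
have -> : (m + k%:Z)%:~R - u = s + ((m + k%:Z)%:~R - s - u) :> A by ring.
rewrite rbin_vandermonde mulr_suml (klin_sum (AA_lin _ _)) scaler_sumr; apply: eq_bigr => l _.
have le : (l <= k)%N by rewrite -ltnS.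
rewrite sgB -scalerA sg_nat; congr (_ *: _); rewrite -(klin_sign (AA_lin _ _)).
have -> : m + (k - l)%N%:Z + l%:Z = m + k%:Z by lia.
have -> : n' - (k - l)%N%:Z - l%:Z = n' - k%:Z by lia.
congr (AA _ _ _); rewrite /cc.
move: (rbin _ _) (rbin _ _) => b1 b2.
have h : (-1) ^+ (k - l) * (-1) ^+ (k - l) = 1 :> A by rewrite -exprMn mulrNN mulr1 expr1n.
by move: (_ ^+ _) h => e h; rewrite -[RHS]mul1r -h; ring.
Qed.

Variables (M N : nat) (BB : int -> int -> A -> V).
Hypothesis BB_trunc : trunc d BB.
Hypothesis BB_lin : forall m n, klin (BB m n).
Hypothesis AB_local : forall m n q,
  iter M (@mz _ _ _) (Eser u AA) m n q
  = (-1) ^+ M *: iter M (@mz _ _ _) (Eser u BB) n m q.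
Hypothesis le_dN : (d <= N)%N.

Let sign_sq (l : nat) : (-1) ^+ l * (-1) ^+ l = 1 :> K.
Proof. by rewrite -exprMn mulrNN mulr1 expr1n. Qed.

(** The factor z_1^N with [d <= N] clears the poles in z_1, which by locality are those of [BB] in
    its second variable. *)
Let L := shift1 N%:Z (iter M (@mz _ _ _) (Eser u AA)).

Let L_trunc : trunc d L.
Proof. by apply: shift1_trunc; apply: iter_mz_trunc; apply: Eser_trunc. Qed.

Let L_lin m n : klin (L m n).
Proof.
apply: shift1_klin => {}m {}n; apply: iter_mz_klin => {}m {}n.
exact: Eser_klin AA_trunc AA_lin.
Qed.

Let L_pos m n q : m < 0 -> L m n q = 0.
Proof.
move=> lt; rewrite /L /shift1 AB_local (@iter_mz_trunc _ _ _ d) ?scaler0 //.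
  exact: Eser_trunc.
by lia.
Qed.

(** Only (z_1 - z_2)^k with k nonnegative occurs in [Psi L], and this is a polynomial in z_1. *)
Let Psi_L_pos m n q : m < 0 -> Psi L m n q = 0.
Proof.
move=> lt; rewrite (@PsiE _ _ _ _ d `|(n + d%:Z)%R|.+1) //; last by lia.
rewrite big1 ?scaler0 // => i _.
have [neg|] := ltP (m + i%:Z) 0; first exact: L_pos.
case E : (m + i%:Z) => [k|//] _.
rewrite -pmulrn rbin_nat bin_small ?mul0r ?(klin0 (L_lin _ _)) //; lia.
Qed.

Let iter_mz_Psi_L m n q :
  iter N (@mz _ _ _) (Psi (Eser u AA)) m n q = Psi L (m + M%:Z) n q.
Proof.
have tE := Eser_trunc iota u AA_trunc.
have lE a b : klin (Eser u AA a b) by exact: Eser_klin AA_trunc AA_lin.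
rewrite (iter_mz_Psi N tE lE) /L -iter_mz_shift1 (@Psi_iter_mz _ _ _ _ d).
- by rewrite addrK.
- exact: shift1_trunc.
- exact: shift1_klin.
Qed.

(** The weight [rbin (m - u) j] is the effect of the j-th divided power of D_(z_1) on z_1^m e^(-
    zeta_1 u), and the sum over [m] sets z_1 = z_2. By [rbin_difference] only the powers (z_1 -
    z_2)^k with [k <= j] survive; locality and [Eser_inverse] turn them into one coefficient of
    [BB]. *)
Lemma residue_Psi p (j : nat) q :
  \sum_(m \in [set: int]) iter N (@mz _ _ _) (Psi (Eser u AA)) m (p + j%:Z - m)
     (rbin (m%:~R - u) j * q)
  = sg p *: BB p (j%:Z - N%:Z) q.
Proof.
(* The total degree of the terms of [Psi L]: [j] is lost again by differentiation, and [M]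
   compensates the factor z_1^(- M) of [iter_mz_Psi_L]. *)
set P := p + j%:Z + M%:Z.
pose B := (`|(P + d%:Z)%R| + j).+1.
have ltB : P + d%:Z < B%:Z by rewrite /B; lia.
rewrite (@fsum_int _ M B); first 1 last.
- by move=> m lt; rewrite iter_mz_Psi_L Psi_L_pos //; lia.
- move=> m le; rewrite iter_mz_Psi_L (@Psi_trunc _ _ _ _ d) //; lia.
transitivity (\sum_(m < B) \sum_(i < B) sg (P - m%:Z) *:
    L (m%:Z + i%:Z) (P - m%:Z - i%:Z)
       (rbin (m%:Z + i%:Z)%:~R i * (rbin ((m%:Z - M%:Z)%:~R - u) j * q))).
  apply: eq_bigr => m _; rewrite iter_mz_Psi_L subrK -scaler_sumr.
  have -> : p + j%:Z - (m%:Z - M%:Z) = P - m%:Z by rewrite /P; lia.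
  by rewrite (@PsiE _ _ _ _ d B) //; lia.
rewrite exchange_big (sum_triangle (g := fun i m : nat => sg (P - m%:Z) *:
    L (m%:Z + i%:Z) (P - m%:Z - i%:Z)
       (rbin (m%:Z + i%:Z)%:~R i * (rbin ((m%:Z - M%:Z)%:~R - u) j * q)))); last first.
  by move=> i m le; rewrite L_trunc ?scaler0 //; lia.
transitivity (\sum_(k < B) sg (P - k%:Z) *: L k%:Z (P - k%:Z)
    ((if (k <= j)%N then rbin (- M%:R - u) (j - k) else 0) * q)).
  apply: eq_bigr => k _.
  have -> : (if (k <= j)%N then rbin (- M%:R - u) (j - k) else 0)
     = (-1) ^+ k * \sum_(m < k.+1) (-1) ^+ m * 'C(k, m)%:R * rbin (m%:R + (- M%:R - u)) j.
    by rewrite rbin_difference mulrA -exprMn mulrNN mulr1 expr1n mul1r.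
  rewrite mulr_sumr mulr_suml (klin_sum (L_lin _ _)) scaler_sumr; apply: eq_bigr => m _.
  have le : (m <= k)%N by rewrite -ltnS.
  have -> : m%:Z + (k - m)%N%:Z = k%:Z by lia.
  have -> : P - m%:Z - (k - m)%N%:Z = P - k%:Z by lia.
  rewrite -pmulrn rbin_nat bin_sub // intrD mulrNz -!pmulrn -!mulrA.
  rewrite !(klin_sign (L_lin _ _)) !scalerA !sgB !sg_nat.
  by rewrite !mulrA -[sg P * _ * (-1) ^+ k]mulrA sign_sq mulr1 addrA.
rewrite (@sum_ord_widen _ j.+1 B (fun k : nat => sg (P - k%:Z) *: L k%:Z (P - k%:Z)
    ((if (k <= j)%N then rbin (- M%:R - u) (j - k) else 0) * q))) //; first last.
- by move=> i lt; rewrite leqNgt lt mul0r (klin0 (L_lin _ _)) ?scaler0.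
- by rewrite /B; lia.
rewrite -(@Eser_inverse _ _ iota _ d j.+1 M u) //; last by lia.
rewrite (reindex_inj rev_ord_inj) scaler_sumr; apply: eq_bigr => i _ /=.
have le : (i <= j)%N by rewrite -ltnS.
rewrite subSS leq_subr subKn //.
have := AB_local (j%:Z - N%:Z - i%:Z) (p + M%:Z + i%:Z) (cc (- M%:R - u) i * q).
move=> /(congr1 (fun v => (-1) ^+ M *: v)); rewrite scalerA sign_sq scale1r => <-.
have lG a b : klin (iter M (@mz _ _ _) (Eser u AA) a b).
  by apply: iter_mz_klin => {}a {}b; exact: Eser_klin AA_trunc AA_lin.
rewrite /cc -mulrA (klin_sign (lG _ _)) /L /shift1 !scalerA.
have -> : (j - i)%N%:Z - N%:Z = j%:Z - N%:Z - i%:Z by lia.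
have -> : P - (j - i)%N%:Z = p + M%:Z + i%:Z by rewrite /P; lia.
by rewrite !sgD !sg_nat mulrA.
Qed.

Let iter_mz_Eser B m n q : n + d%:Z < B%:Z ->
  iter N (@mz _ _ _) (Eser s XX) m n q
  = \sum_(r < B) Td r (iter N (@mz _ _ _) (Psi (Eser u AA)) m (n - r%:Z) q).
Proof.
elim: N m n => [|k IH] m n lt; first exact: Eser_Psi.
rewrite !iterS {1}/mz !IH; [|by lia|by lia].
rewrite -sumrB; apply: eq_bigr => r _; rewrite -linearB /mz.
by congr (Td _ (_ - iter _ _ _ _ _ _)); lia.
Qed.

(* [Eser_Psi] rewrites (1 - z_2/z_1)^s XX as translates of Psi((1 - z_2/z_1)^u AA), and the
   locality of AA and BB makes the residue in z_1 - z_2 a single coefficient of BB. *)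
Theorem residue_assoc p (j B : nat) q : p + j%:Z + M%:Z + d%:Z < B%:Z ->
  \sum_(m \in [set: int]) iter N (@mz _ _ _) (Eser s XX) m (p + j%:Z - m)
     (rbin (m%:~R - u) j * q)
  = \sum_(r < B) Td r (sg (p - r%:Z) *: BB (p - r%:Z) (j%:Z - N%:Z) q).
Proof.
move=> lt.
have pos m n q' : m < - M%:Z ->
    iter N (@mz _ _ _) (Psi (Eser u AA)) m n q' = 0.
  by move=> lt'; rewrite iter_mz_Psi_L Psi_L_pos //; lia.
rewrite (@fsum_int _ M B); first 1 last.
- move=> m lt'; rewrite (@iter_mz_Eser `|(p + j%:Z - m + d%:Z)%R|.+1); last by lia.
  by rewrite big1 // => r _; rewrite pos ?linear0.
- move=> m le; rewrite (@iter_mz_trunc _ _ _ d) //; last by lia.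
  exact: Eser_trunc.
under eq_bigr => i _.
  rewrite (@iter_mz_Eser B); last by lia.
  over.
rewrite exchange_big; apply: eq_bigr => r _ /=; rewrite -linear_sum -residue_Psi.
congr (Td r _); rewrite (@fsum_int _ M B); first 1 last.
- by move=> m lt'; rewrite pos.
- move=> m le; rewrite (@iter_mz_trunc _ _ _ d) //; last by lia.
  exact/Psi_trunc/Eser_trunc.
apply: eq_bigr => i _; congr (iter _ _ _ _ _ _); lia.
Qed.

End Assoc.

(** * Powers of log(1 - q), and (1 - q)^t as an exponential *)

Section LogPowers.
Variable K : numFieldType.

(* [lam k i] is the coefficient of q^i in log(1 - q)^k; the summand n = 0 vanishes
   because 0^-1 = 0. *)
Fixpoint lam (k i : nat) : K :=
  if k is k'.+1 then - \sum_(n < i.+1) n%:R^-1 * lam k' (i - n) else (i == 0%N)%:R.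

(** log(1 - q) truncated after degree [m]; the constant term is 0 because 0^-1 = 0. *)
Definition logp (m : nat) : {poly K} := \poly_(n < m.+1) - n%:R^-1.

Lemma lam_logp m k i : (i <= m)%N -> lam k i = (logp m ^+ k)`_i.
Proof.
elim: k i => [|k IH] i le; first by rewrite coef1.
rewrite exprS coefM /= -sumrN; apply: eq_bigr => n _.
have len : (n <= i)%N by rewrite -ltnS.
rewrite coef_poly ltnS (leq_trans len le) mulNr IH //.
exact: leq_trans (leq_subr _ _) le.
Qed.

Lemma lam_small k i : (i < k)%N -> lam k i = 0.
Proof.
elim: k i => // k IH i lt; rewrite /= big1 ?oppr0 // => n _.
case: n => [[|n] ltn] /=; first by rewrite invr0 mul0r.
by rewrite IH ?mulr0 //; lia.
Qed.

(** Coefficient form of (1 - q) d/dq log(1 - q)^(k + 1) = - (k + 1) log(1 - q)^k. *)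
Lemma lam_rec k i :
  i.+1%:R * lam k.+1 i.+1 = i%:R * lam k.+1 i - k.+1%:R * lam k i.
Proof.
rewrite !(@lam_logp i.+1) //; set p := logp i.+1.
have dp : p^`() = - \poly_(n < i.+1) 1.
  apply/polyP => n; rewrite coef_deriv coefN !coef_poly ltnS.
  by case: ltnP => _; rewrite ?mul0rn ?oppr0 // mulNrn -[_^-1 *+ _]mulr_natr mulVf ?pnatr_eq0.
have /(congr1 (fun r : {poly K} => ((1 - 'X) * r)`_i)) := deriv_exp p k.+1.
rewrite -scaler_nat mulrBl mul1r coefB coefXM !coef_deriv /=.
(* The truncation of the logarithm leaves an error in degree i + 1 and above, invisible at the
   coefficient of degree i. *)
have -> : ((1 - 'X) * (k.+1%:R *: (p^`() * p ^+ k)))`_i = - k.+1%:R * (p ^+ k)`_i.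
  have -> : (1 - 'X) * (k.+1%:R *: (p^`() * p ^+ k))
     = (- k.+1%:R) *: (p ^+ k) + k.+1%:R *: (p ^+ k * 'X^(i.+1)).
    have e : (1 - 'X) * \poly_(n < i.+1) 1 = 1 - 'X^(i.+1) :> {poly K}.
      rewrite poly_def -opprB -[RHS]opprB subrX1 mulNr; congr (- (_ * _)).
      by apply: eq_bigr => n _; rewrite scale1r.
    rewrite dp -scalerAr mulrA mulrN mulNr e mulrBl mul1r scaleNr opprB scalerBr.
    by rewrite [_ * p ^+ k]mulrC addrC.
  by rewrite coefD !coefZ coefMXn ltnSn mulr0 addr0.
move=> h; rewrite -[RHS]addr0.
have -> : i.+1%:R * (p ^+ k.+1)`_i.+1 = (p ^+ k.+1)`_i.+1 *+ i.+1 by rewrite mulr_natl.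
case: i p {dp} h => [|i] p h.
  by rewrite mul0r add0r addr0 -mulNr -h subr0.
rewrite addr0 -mulNr -h mulr_natl.
by rewrite /= addrC subrK.
Qed.

(** (1 - q)^t = exp(t log(1 - q)): the right-hand side satisfies the recursion of [cc_uniq] by
    [lam_rec]. This identifies multiplication by [cc] with the operator [opc]. *)
Lemma cc_lam (A : comNzRingType) (iota : {rmorphism K -> A}) (t : A) i :
  cc iota t i = \sum_(k < i.+1) iota (lam k i / k`!%:R) * t ^+ k.
Proof.
have widen j n : (j < n)%N ->
    \sum_(k < j.+1) iota (lam k j / k`!%:R) * t ^+ k
    = \sum_(k < n) iota (lam k j / k`!%:R) * t ^+ k.
  move=> lt; apply/esym/(sum_ord_widen (f := fun k : nat => iota (lam k j / k`!%:R) * t ^+ k)) => // k lek.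
  by rewrite lam_small // mul0r rmorph0 mul0r.
apply/esym; move: i.
apply: (@cc_uniq _ _ iota t (fun i => \sum_(k < i.+1) iota (lam k i / k`!%:R) * t ^+ k)) => [|i].
  by rewrite big_ord1 /= fact0 invr1 ?mulr1 ?rmorph1.
rewrite mulrBl [X in _ * X - _](widen i i.+2) // !mulr_sumr.
rewrite [X in _ = X - _]big_ord_recl [X in X = _]big_ord_recl.
have z n : n%:R * (iota (lam 0 n / 0`!%:R) * t ^+ 0) = 0.
  case: n => [|n]; first exact: mul0r.
  have -> : lam 0 n.+1 = 0 by [].
  by rewrite mul0r rmorph0 mul0r mulr0.
rewrite !z !add0r -sumrB; apply: eq_bigr => k _.
rewrite !lift0.
have e : iota (lam k.+1 i.+1 / k.+1`!%:R) * i.+1%:R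
   = i%:R * iota (lam k.+1 i / k.+1`!%:R) - iota (lam k i / k`!%:R).
  rewrite -!(rmorph_nat iota) -!rmorphM -rmorphB; congr (iota _).
  transitivity ((i.+1%:R * lam k.+1 i.+1) / k.+1`!%:R).
    by rewrite mulrAC [i.+1%:R * _]mulrC.
  rewrite lam_rec mulrBl mulrA; congr (_ - _).
  by rewrite factS natrM invfM mulrACA mulfV ?pnatr_eq0 // mul1r.
by rewrite mulrA [i.+1%:R * _]mulrC e mulrBl exprS; ring.
Qed.

End LogPowers.

Section PolyEval.
Variables (R : comNzRingType) (M : zmodType) (f : R -> M) (T : M -> M).
Hypothesis fD : {morph f : x y / x + y}.
Hypothesis TD : {morph T : x y / x + y}.

Let f0 : f 0 = 0. Proof. by apply: (addIr (f 0)); rewrite -fD !add0r. Qed.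
Let T0 : T 0 = 0. Proof. by apply: (addIr (T 0)); rewrite -TD !add0r. Qed.

Lemma iter_morphD k : {morph iter k T : x y / x + y}.
Proof. by elim: k => // k IH x y; rewrite !iterS IH TD. Qed.

Let iterT0 k : iter k T 0 = 0.
Proof. by elim: k => // k IH; rewrite iterS IH. Qed.

(** Coefficients go to the additive group [M] through [f] and the variable acts as [T]. As [f] may
    itself be such an evaluation, several variables are treated by nesting. *)
Definition peval (p : {poly R}) : M := \sum_(i < size p) iter i T (f p`_i).

Lemma pevalE n (p : {poly R}) : (size p <= n)%N -> peval p = \sum_(i < n) iter i T (f p`_i).
Proof.
move=> le; rewrite /peval.
rewrite (sum_ord_widen (f := fun i : nat => iter i T (f p`_i)) le) // => i lei.
by rewrite nth_default // f0 iterT0.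
Qed.

Lemma pevalD : {morph peval : p q / p + q}.
Proof.
move=> p q; set n := maxn (size p) (size q).
rewrite !(@pevalE n) ?leq_maxl ?leq_maxr ?size_polyD //.
by rewrite -big_split; apply: eq_bigr => i _; rewrite coefD fD iter_morphD.
Qed.

Lemma pevalX p : peval ('X * p) = T (peval p).
Proof.
rewrite mulrC (@pevalE (size p).+1) ?(leq_trans (size_polyMleq _ _)) ?size_polyX ?addn2 //.
rewrite big_ord_recl /= coefMX /= f0 add0r (big_morph T TD T0).
by apply: eq_bigr => i _; rewrite /bump leq0n add1n coefMX.
Qed.

Lemma peval_polyC (g : M -> M) r p :
  {morph g : x y / x + y} -> (forall a, f (r * a) = g (f a)) ->
  (forall x, g (T x) = T (g x)) -> peval (r%:P * p) = g (peval p).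
Proof.
move=> gD fg gT; have g0 : g 0 = 0 by apply: (addIr (g 0)); rewrite -gD !add0r.
rewrite mul_polyC (@pevalE (size p)) ?size_scale_leq // /peval (big_morph g gD g0).
apply: eq_bigr => i _; rewrite coefZ fg.
by elim: {i}(i : nat) (f _) => // k IH x; rewrite !iterS IH gT.
Qed.

Lemma peval1 : peval 1 = f 1.
Proof. by rewrite /peval size_poly1 big_ord1 coef1. Qed.

End PolyEval.

(** * Polynomials in locally nilpotent operators *)

Section LhomLinear.
Variables (K : fieldType) (U W : lmodType K) (f : lhom U W).

Lemma lhom_add x y : f (x + y) = f x + f y. Proof. exact: linearD. Qed.
Lemma lhom_scale c x : f (c *: x) = c *: f x. Proof. exact: linearZ. Qed.
Lemma lhom_zero : f 0 = 0. Proof. exact: linear0. Qed.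
Lemma lhom_sum I (r : seq I) (Q : pred I) (g : I -> U) :
  f (\sum_(i <- r | Q i) g i) = \sum_(i <- r | Q i) f (g i).
Proof. exact: linear_sum. Qed.

End LhomLinear.

Section IterLinear.
Variables (K : numFieldType) (W : lmodType K) (f : lhom W W).

Lemma iter_linear k : linear (iter k f).
Proof. by elim: k => [//|k IH] c x y; rewrite !iterS IH linearP. Qed.

HB.instance Definition _ k :=
  GRing.isLinear.Build K W W *:%R (iter k f) (iter_linear k).

Lemma iter_scale k c x : iter k f (c *: x) = c *: iter k f x.
Proof. exact: linearZ. Qed.

Lemma iter_sub k x y : iter k f (x - y) = iter k f x - iter k f y.
Proof. exact: linearB. Qed.

(* The coefficient of q^i in (1 - q)^f, for locally nilpotent [f]. *)
Definition opc i (x : W) : W := \sum_(k < i.+1) (lam K k i / k`!%:R) *: iter k f x.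

Lemma opc_linear i : linear (opc i).
Proof.
move=> c x y; rewrite /opc scaler_sumr -big_split; apply: eq_bigr => k _ /=.
by rewrite linearP scalerDr !scalerA [c * _]mulrC.
Qed.

HB.instance Definition _ i := GRing.isLinear.Build K W W *:%R (opc i) (opc_linear i).

Lemma opc0 x : opc 0 x = x.
Proof. by rewrite /opc big_ord1 /= fact0 divr1 scale1r. Qed.

End IterLinear.

Lemma iter_intertwine (K : numFieldType) (W W' : lmodType K) (h : W -> W')
    (f : W -> W) (g : W' -> W') k x :
  (forall x, h (f x) = g (h x)) -> h (iter k f x) = iter k g (h x).
Proof. by move=> hf; elim: k => //= k IH; rewrite hf IH. Qed.

Lemma opc_intertwine (K : numFieldType) (W W' : lmodType K) (h : lhom W W')
    (f : lhom W W) (g : lhom W' W') i x :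
  (forall x, h (f x) = g (h x)) -> h (opc f i x) = opc g i (h x).
Proof.
move=> hf; rewrite /opc linear_sum; apply: eq_bigr => k _.
by rewrite linearZ /=; congr (_ *: _); exact: (iter_intertwine (h := h)).
Qed.

Section OperatorPolynomials.
Variables (K : numFieldType) (W : lmodType K) (S12 S13 S23 : lhom W W).
Hypothesis S12_S13 : forall x, S12 (S13 x) = S13 (S12 x).
Hypothesis S12_S23 : forall x, S12 (S23 x) = S23 (S12 x).
Hypothesis S13_S23 : forall x, S13 (S23 x) = S23 (S13 x).

(** One variable for each of the three commuting operators, nested in the order in which [pi3]
    evaluates them. *)
Definition poly3 : comNzRingType := {poly {poly {poly K}}}.
Definition iota3 : {rmorphism K -> poly3} := (polyC \o (polyC \o polyC)).
Definition v12 : poly3 := 'X%:P%:P.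
Definition v13 : poly3 := 'X%:P.
Definition v23 : poly3 := 'X.

(* [p |-> p(S12, S13, S23) x] *)
Definition pi3 (x : W) : poly3 -> W :=
  peval (peval (peval (fun c : K => c *: x) S12) S13) S23.

Let D0 (x : W) : {morph (fun c : K => c *: x) : a b / a + b}.
Proof. by move=> a b; apply: scalerDl. Qed.
Let D1 (x : W) : {morph peval (fun c : K => c *: x) S12 : p q / p + q}.
Proof. exact: (pevalD (D0 x) (linearD S12)). Qed.
Let D2 (x : W) : {morph peval (peval (fun c : K => c *: x) S12) S13 : p q / p + q}.
Proof. exact: (pevalD (D1 x) (linearD S13)). Qed.

Lemma pi3_add x : {morph pi3 x : p q / p + q}.
Proof. exact: (pevalD (D2 x) (linearD S23)). Qed.

Let Z1 c (x : W) p : peval (fun c : K => c *: x) S12 (c%:P * p)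
  = c *: peval (fun c : K => c *: x) S12 p.
Proof.
apply: (peval_polyC (D0 x) (linearD S12) (g := fun y => c *: y)).
- by move=> y z; rewrite scalerDr.
- by move=> a; rewrite scalerA.
- by move=> y; rewrite linearZ.
Qed.

Let Z2 c (x : W) p : peval (peval (fun c : K => c *: x) S12) S13 (c%:P%:P * p)
  = c *: peval (peval (fun c : K => c *: x) S12) S13 p.
Proof.
apply: (peval_polyC (D1 x) (linearD S13) (g := fun y => c *: y)).
- by move=> y z; rewrite scalerDr.
- exact: Z1.
- by move=> y; rewrite linearZ.
Qed.

Lemma pi3_scale x c p : pi3 x (iota3 c * p) = c *: pi3 x p.
Proof.
apply: (peval_polyC (D2 x) (linearD S23) (g := fun y => c *: y)).
- by move=> y z; rewrite scalerDr.
- exact: Z2.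
- by move=> y; rewrite linearZ.
Qed.

Lemma pi3_klin x : klin iota3 (pi3 x).
Proof. by split; [exact: pi3_add|move=> c p; exact: pi3_scale]. Qed.

Lemma pi3_1 x : pi3 x 1 = x.
Proof. by rewrite /pi3 !peval1 scale1r. Qed.

Lemma pi3_v12 x p : pi3 x (v12 * p) = S12 (pi3 x p).
Proof.
rewrite /pi3 /v12.
rewrite (@peval_polyC _ _ _ _ (D2 x) (linearD S23) S12) //; first exact: linearD.
move=> q; rewrite (@peval_polyC _ _ _ _ (D1 x) (linearD S13) S12) //; first exact: linearD.
by move=> {}q; exact: (pevalX (D0 x) (linearD S12)).
Qed.

Lemma pi3_v13 x p : pi3 x (v13 * p) = S13 (pi3 x p).
Proof.
rewrite /pi3 /v13.
rewrite (@peval_polyC _ _ _ _ (D2 x) (linearD S23) S13) //; first exact: linearD.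
by move=> q; exact: (pevalX (D1 x) (linearD S13)).
Qed.

Lemma pi3_v23 x p : pi3 x (v23 * p) = S23 (pi3 x p).
Proof. exact: (pevalX (D2 x) (linearD S23)). Qed.

Lemma pi3_exp (v : poly3) (S : W -> W) x k p :
  (forall q, pi3 x (v * q) = S (pi3 x q)) -> pi3 x (v ^+ k * p) = iter k S (pi3 x p).
Proof.
move=> h; elim: k => [|k IH]; first by rewrite expr0 mul1r.
by rewrite exprS -mulrA h IH.
Qed.

Lemma pi3_cc (v : poly3) (S : lhom W W) x i p :
  (forall q, pi3 x (v * q) = S (pi3 x q)) ->
  pi3 x (cc iota3 v i * p) = opc S i (pi3 x p).
Proof.
move=> h; rewrite cc_lam mulr_suml (klin_sum (pi3_klin x)).
by apply: eq_bigr => k _; rewrite -mulrA pi3_scale (pi3_exp _ _ h).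
Qed.

Hypothesis nil12 : forall x, exists r, iter r S12 x = 0.
Hypothesis nil13 : forall x, exists r, iter r S13 x = 0.
Hypothesis nil23 : forall x, exists r, iter r S23 x = 0.

(** By commutativity and local nilpotency all [pi3 x q] lie in the span of finitely many monomials
    in the operators applied to [x]; a bound that serves these serves every [q]. It is applied to
    truncation bounds and to orders of locality. *)
Lemma pi3_uniform x (Pr : nat -> W -> Prop) :
  (forall n n' y, (n <= n')%N -> Pr n y -> Pr n' y) ->
  (forall n c y z, Pr n y -> Pr n z -> Pr n (c *: y + z)) ->
  (forall y, exists n, Pr n y) -> exists n, forall q, Pr n (pi3 x q).
Proof.
move=> mono lin ex.
have iter0 (S : lhom W W) r k y : iter r S y = 0 -> (r <= k)%N -> iter k S y = 0.
  by move=> h le; rewrite -(subnK le) iterD h linear0.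
have unif (Q : nat -> nat -> Prop) (r : nat) :
    (forall n n' i, (n <= n')%N -> Q n i -> Q n' i) ->
    (forall i, exists n, Q n i) -> exists n, forall i, (i < r)%N -> Q n i.
  move=> Qm Qe; elim: r => [|r [n hn]]; first by exists 0%N.
  have [n' hn'] := Qe r; exists (maxn n n') => i; rewrite ltnS leq_eqVlt.
  by case/orP=> [/eqP->|/hn h]; [exact: (Qm _ _ _ (leq_maxr n n') hn')|exact: (Qm _ _ _ (leq_maxl n n') h)].
pose mon i j k := iter k S23 (iter j S13 (iter i S12 x)).
have [r1 h1] := nil12 x; have [r2 h2] := nil13 x; have [r3 h3] := nil23 x.
pose r := maxn r1 (maxn r2 r3).
have swap (S S' : lhom W W) a b y : (forall z, S (S' z) = S' (S z)) ->
    iter a S (iter b S' y) = iter b S' (iter a S y).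
  move=> h; apply: (iter_intertwine (h := iter a S)) => z.
  by apply/esym; apply: (iter_intertwine (h := S')) => ?; rewrite h.
have mon0 i j k : (r <= i)%N || (r <= j)%N || (r <= k)%N -> mon i j k = 0.
  rewrite !geq_max => /orP[/orP[/andP[le _]|/and3P[_ le _]]|/and3P[_ _ le]].
  - by rewrite /mon (iter0 _ _ _ _ h1 le) !linear0.
  - by rewrite /mon (swap _ _ _ _ _ (fun z => esym (S12_S13 z))) (iter0 _ _ _ _ h2 le) !linear0.
  - rewrite /mon (swap _ _ _ _ _ (fun z => esym (S13_S23 z))).
    rewrite (swap _ _ _ _ _ (fun z => esym (S12_S23 z))).
    by rewrite (iter0 _ _ _ _ h3 le) !linear0.
have [n hn] : exists n, forall i, (i < r)%N -> forall j, (j < r)%N ->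
    forall k, (k < r)%N -> Pr n (mon i j k).
  apply: (unif (fun n i => forall j, (j < r)%N -> forall k, (k < r)%N -> Pr n (mon i j k))).
    by move=> n n' i le h j jr k kr; apply: mono le _; apply: h.
  move=> i; apply: (unif (fun n j => forall k, (k < r)%N -> Pr n (mon i j k))).
    by move=> n n' j le h k kr; apply: mono le _; apply: h.
  move=> j; apply: (unif (fun n k => Pr n (mon i j k))) => [n n' k|k].
    exact: mono.
  exact: ex.
have [n0 hn0] := ex 0.
pose m := maxn n n0; exists m => q.
have m0 : Pr m 0 by apply: mono hn0; exact: leq_maxr.
have mm i j k : Pr m (mon i j k).
  have [lei|ltr1] := leqP r i; first by rewrite mon0 ?lei.
  have [lej|ltr2] := leqP r j; first by rewrite mon0 ?lej ?orbT.
  have [lek|ltr3] := leqP r k; first by rewrite mon0 ?lek ?orbT.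
  by apply: mono (hn _ ltr1 _ ltr2 _ ltr3); exact: leq_maxl.
have mD y z : Pr m y -> Pr m z -> Pr m (y + z).
  by move=> hy hz; rewrite -[y]scale1r; apply: lin.
have msum I (s : seq I) (g : I -> W) : (forall i, Pr m (g i)) -> Pr m (\sum_(i <- s) g i).
  by move=> hg; apply: (big_ind (Pr m)).
rewrite /pi3 /peval; apply: (msum) => k; rewrite linear_sum; apply: (msum) => j.
rewrite !linear_sum; apply: (msum) => i; rewrite !linearZ /=.
by rewrite -[_ *: _]addr0; apply: lin => //; exact: mm.
Qed.

End OperatorPolynomials.

(** * Divided powers of the translation operator *)

Section Translation.
Variables (K : numFieldType) (V : lmodType K) (T : lhom V V).

Definition Tdiv r v : V := (r`!%:R)^-1 *: iter r T v.

Lemma Tdiv_linear r : linear (Tdiv r).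
Proof.
move=> c x y; rewrite /Tdiv (iter_linear T) scalerDr !scalerA.
by rewrite [c * _]mulrC.
Qed.

HB.instance Definition _ r := GRing.isLinear.Build K V V *:%R (Tdiv r) (Tdiv_linear r).

Lemma TdivZ r c v : Tdiv r (c *: v) = c *: Tdiv r v. Proof. exact: linearZ. Qed.

Lemma TdivS r v : T (Tdiv r v) = r.+1%:R *: Tdiv r.+1 v.
Proof.
rewrite /Tdiv lhom_scale scalerA factS natrM invfM mulrA divff ?mul1r //.
by rewrite pnatr_eq0.
Qed.

Lemma Tdiv_T r v : Tdiv r (T v) = r.+1%:R *: Tdiv r.+1 v.
Proof. by rewrite -TdivS /Tdiv lhom_scale -iterSr iterS. Qed.

Lemma TdivB r v w : Tdiv r (v - w) = Tdiv r v - Tdiv r w. Proof. exact: linearB. Qed.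

(** For g(z, w) with coefficients [g m n] the hypothesis is T g = (d/dz + d/dw) g, hence g(z, w) =
    e^(w T) g(z - w, 0); the conclusion is its part of degree 0 in z. *)
Lemma translation_solve (g : nat -> nat -> V) :
  (forall m n, T (g m n) = m.+1%:R *: g m.+1 n + n.+1%:R *: g m n.+1) ->
  forall n, g 0%N n = \sum_(r < n.+1) (-1) ^+ (n - r) *: Tdiv r (g (n - r)%N 0%N).
Proof.
move=> hg n.
(* All powers of z are needed, since the recursion in [n] raises [m]. *)
suff h m : g m n = \sum_(r < n.+1)
    ((-1) ^+ (n - r) * 'C(m + n - r, m)%:R) *: Tdiv r (g (m + n - r)%N 0%N).
  by rewrite h; apply: eq_bigr => r _; rewrite bin0 mulr1.
elim: n m => [|n IH] m.
  rewrite big_ord1 /= !addn0 !subn0 binn mulr1 scale1r /Tdiv.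
  by rewrite fact0 invr1 scale1r.
have n0 : n.+1%:R != 0 :> K by rewrite pnatr_eq0.
apply: (scalerI n0); have <- : - (m.+1%:R *: g m.+1 n) + T (g m n) = n.+1%:R *: g m n.+1.
  by rewrite hg addKr.
rewrite !IH [T _]linear_sum !scaler_sumr -sumrN.
pose f r := ((-1) ^+ (n.+1 - r) * ('C(m + n.+1 - r, m) * r)%:R) *:
   Tdiv r (g (m + n.+1 - r)%N 0%N) : V.
pose h r := ((-1) ^+ (n.+1 - r) * (m.+1 * 'C(m + n.+1 - r, m.+1))%:R) *:
   Tdiv r (g (m + n.+1 - r)%N 0%N) : V.
transitivity (\sum_(r < n.+2) h r + \sum_(r < n.+2) f r); last first.
  rewrite -big_split; apply: eq_bigr => r _ /=; rewrite /f /h -scalerDl [RHS]scalerA.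
  congr (_ *: _); rewrite -mulrDr -natrD mulrCA -natrM; congr (_ * _%:R).
  have ler : (r <= n.+1)%N by rewrite -ltnS.
  rewrite mul_bin_left -[X in (X - m)%N]addnBA // addKn mulnC -mulnDr subnK //.
  by rewrite mulnC.
congr (_ + _).
  rewrite [RHS]big_ord_recr /= /h addnK bin_small // muln0 mulr0 scale0r addr0.
  apply: eq_bigr => r _; have ler : (r <= n)%N by rewrite -ltnS.
  rewrite -scaleNr [LHS]scalerA subSn // exprS addSnnS; congr (_ *: _).
  by rewrite natrM; ring.
rewrite [RHS]big_ord_recl /f /= muln0 mulr0 scale0r add0r.
apply: eq_bigr => r _; have ler : (r <= n)%N by rewrite -ltnS.
rewrite lhom_scale TdivS [LHS]scalerA /bump leq0n add1n addnS !subSS; congr (_ *: _).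
by rewrite natrM mulrA.
Qed.

End Translation.

(** * Multiplication by z_1 - z_2 and by theta_12 *)

Section Ser2.
Variables (K : numFieldType) (V : superType K).
Implicit Types F G : ser2 V.

Lemma iter_mul_z12_ext N F G k1 k2 k1' k2' :
  (forall n1 n2, F n1 n2 k1 k2 = G n1 n2 k1' k2') ->
  forall n1 n2, iter N (@mul_z12 K V) F n1 n2 k1 k2 = iter N (@mul_z12 K V) G n1 n2 k1' k2'.
Proof. by move=> h; elim: N => //= N IH n1 n2; rewrite /mul_z12 !IH. Qed.

Lemma iter_mul_z12_mz (A : comNzRingType) N F (f : int -> int -> A -> V) q k1 k2 :
  (forall n1 n2, F n1 n2 k1 k2 = f n1 n2 q) ->
  forall n1 n2, iter N (@mul_z12 K V) F n1 n2 k1 k2 = iter N (@mz K A V) f n1 n2 q.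
Proof. by move=> h; elim: N => //= N IH n1 n2; rewrite /mul_z12 /mz !IH. Qed.

Lemma iter_mul_z12_swap12 N F n1 n2 k1 k2 :
  iter N (@mul_z12 K V) (swap12 F) n1 n2 k1 k2
  = (-1) ^+ N *: iter N (@mul_z12 K V) F n2 n1 k2 k1.
Proof.
elim: N n1 n2 => [|N IH] n1 n2; first by rewrite scale1r.
rewrite !iterS {1}/mul_z12 !IH exprS mulN1r scaleNr -scalerBr -scalerN opprB.
by [].
Qed.

Lemma iter_mul_z12_trunc d N F k1 k2 :
  (forall n1 n2, n2 < d -> F n1 n2 k1 k2 = 0) ->
  forall n1 n2, n2 < d -> iter N (@mul_z12 K V) F n1 n2 k1 k2 = 0.
Proof.
move=> h; elim: N => // N IH n1 n2 lt; rewrite iterS /mul_z12 !IH ?subrr //.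
by apply: lt_trans lt; lia.
Qed.

(** At the lowest power of z_2 only the term z_1 of each factor contributes. *)
Lemma iter_mul_z12_bottom d N F k1 k2 :
  (forall n1 n2, n2 < d -> F n1 n2 k1 k2 = 0) ->
  forall n1, iter N (@mul_z12 K V) F n1 d k1 k2 = F (n1 - N%:Z) d k1 k2.
Proof.
move=> h; elim: N => [|N IH] n1; first by rewrite subr0.
rewrite iterS /mul_z12 IH (iter_mul_z12_trunc N h) ?subr0; last by lia.
by congr (F _ _ _ _); lia.
Qed.

Lemma iter_mul_z12D c N F G H :
  (forall n1 n2 k1 k2, H n1 n2 k1 k2 = c *: F n1 n2 k1 k2 + G n1 n2 k1 k2) ->
  forall n1 n2 k1 k2, iter N (@mul_z12 K V) H n1 n2 k1 k2
    = c *: iter N (@mul_z12 K V) F n1 n2 k1 k2 + iter N (@mul_z12 K V) G n1 n2 k1 k2.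
Proof.
move=> h; elim: N => //= N IH n1 n2 k1 k2.
by rewrite /mul_z12 !IH scalerBr opprD addrACA.
Qed.

(** The binomial theorem for theta_12 = zeta_1 + log(1 - z_2/z_1); [l] counts the factors zeta_1. *)
Lemma iter_mul_theta12 (d : nat) F k2 :
  (forall n1 n2 k1, n2 < - d%:Z -> F n1 n2 k1 k2 = 0) ->
  forall k (B : nat) n1 n2 k1, n2 + d%:Z < B%:Z ->
  iter k (@mul_theta12 K V) F n1 n2 k1 k2 = \sum_(l < k1.+1) 'C(k, l)%:R *:
    \sum_(i < B) lam K (k - l) i *: F (n1 + i%:Z) (n2 - i%:Z) (k1 - l)%N k2.
Proof.
move=> F0; elim=> [|k IH] B n1 n2 k1 lt.
  rewrite big_ord_recl [X in _ + X]big1 ?addr0 => [|l _]; last by rewrite bin_small // scale0r.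
  rewrite bin0 scale1r !subn0 /=.
  case: B lt => [|B] lt; first by rewrite big_ord0 F0 //; lia.
  rewrite big_ord_recl [X in _ + X]big1 ?addr0 => [|i _]; last by rewrite /= scale0r.
  by rewrite /= scale1r.
have trk n1' n2' k1' : n2' < - d%:Z -> iter k (@mul_theta12 K V) F n1' n2' k1' k2 = 0.
  move=> lt'; rewrite (IH 0%N); last by lia.
  by rewrite big1 // => l _; rewrite big_ord0 scaler0.
rewrite iterS {1}/mul_theta12 (@fsum_nat_pos _ B); first last.
- by rewrite invr0 scale0r.
- by move=> n le; rewrite trk ?scaler0 //; lia.
pose f l i := F (n1 + i%:Z) (n2 - i%:Z) (k1 - l)%N k2.
have -> : \sum_(n < B) n%:R^-1 *: iter k (@mul_theta12 K V) F (n1 + n%:Z) (n2 - n%:Z) k1 k2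
    = - \sum_(l < k1.+1) 'C(k, l)%:R *: \sum_(i < B) lam K (k.+1 - l) i *: f l i.
  under eq_bigr => n _.
    rewrite (IH B); last by lia.
    rewrite scaler_sumr.
    over.
  rewrite exchange_big -sumrN; apply: eq_bigr => l _ /=.
  have [lel|ltk] := leqP l k; last first.
    rewrite bin_small // scale0r oppr0; apply: big1 => n _.
    by rewrite scale0r scaler0.
  have e1 (n : 'I_B) (v : V) : n%:R^-1 *: ('C(k, l)%:R *: v) = 'C(k, l)%:R *: (n%:R^-1 *: v).
    by rewrite !scalerA mulrC.
  under eq_bigr => n _ do rewrite e1.
  rewrite -scaler_sumr -scalerN; congr (_ *: _).
  under [X in X = _]eq_bigr => n _ do rewrite scaler_sumr.
  rewrite exchange_big (sum_triangle (g := fun i n : nat => n%:R^-1 *: (lam K (k - l) i *: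
    F (n1 + n%:Z + i%:Z) (n2 - n%:Z - i%:Z) (k1 - l)%N k2))); last first.
    by move=> i n le; rewrite F0 ?scaler0 //; lia.
  rewrite -sumrN; apply: eq_bigr => i _; rewrite subSn // /= -scaleNr opprK scaler_suml.
  apply: eq_bigr => n _; have len : (n <= i)%N by rewrite -ltnS.
  by rewrite scalerA /f; congr (_ *: F _ _ _ _); lia.
rewrite opprK.
transitivity (\sum_(l < k1.+1) ('C(k.+1, l)%:R - 'C(k, l)%:R : K) *:
     (\sum_(i < B) lam K (k.+1 - l) i *: f l i)
   + \sum_(l < k1.+1) 'C(k, l)%:R *: \sum_(i < B) lam K (k.+1 - l) i *: f l i); last first.
  by rewrite -big_split; apply: eq_bigr => l _; rewrite /= -scalerDl subrK.
congr (_ + _); rewrite big_ord_recl !bin0 subrr scale0r add0r.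
case: k1 @f => [|k1] f; first by rewrite big_ord0.
rewrite (IH B) //; apply: eq_bigr => l _; rewrite !lift0 binS natrD addrC addKr.
by rewrite subSS /f; congr (_ *: _).
Qed.

End Ser2.

(** * Derivatives restricted to the diagonal *)

Section Diagonal.
Variables (K : numFieldType) (V : superType K).
Variables (A : comNzRingType) (iota : {rmorphism K -> A}) (u w : A).
Variables (G : ser2 V) (Q : int -> int -> A -> V).
Hypothesis Q_klin : forall m n, klin iota (Q m n).
(** The logarithms enter only through e^(- zeta_1 u - zeta_2 w). *)
Hypothesis GQ : forall m n k1 k2, G m n k1 k2 = Q m n (dpow iota u k1 * dpow iota w k2).

(** D_z acts on z^m e^(- zeta u) as d/dz would on z^(m - u), so its iterates give binomials of the
    shifted exponent. *)
Lemma iter_D_z1 i m n k1 k2 : iter i (@D_z1 K V) G m n k1 k2 = i`!%:R *: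
  Q (m + i%:Z) n (rbin iota ((m + i%:Z)%:~R - u) i * (dpow iota u k1 * dpow iota w k2)).
Proof.
elim: i m k1 => [|i IH] m k1; first by rewrite /= GQ fact0 scale1r addr0 mul1r.
rewrite iterS /D_z1 !IH; have -> : m + 1 + i%:Z = m + i.+1%:Z by lia.
set y := (m + i.+1%:Z)%:~R - u; set b := rbin iota y i.
have e1 c v : (m + 1)%:~R *: (c *: v) = c *: ((m + 1)%:~R *: v) :> V.
  by rewrite !scalerA mulrC.
rewrite e1 -(klin_int (Q_klin _ _) (m + 1)).
have e2 c v : k1.+1%:R *: (c *: v) = c *: (k1.+1%:R *: v) :> V.
  by rewrite !scalerA mulrC.
rewrite e2 -scalerDr -(klin_nat (Q_klin _ _)) -(Q_klin _ _).1.
rewrite factS mulnC natrM -scalerA -!(klin_nat (Q_klin _ _)); congr (Q _ _ (_ * _)).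
rewrite [RHS]mulrA rbinS -/b.
have -> : k1.+1%:R * (b * (dpow iota u k1.+1 * dpow iota w k2))
  = b * ((k1.+1%:R * dpow iota u k1.+1) * dpow iota w k2) by ring.
rewrite dpowS /y.
have -> : (m + i.+1%:Z)%:~R = (m + 1)%:~R + i%:R :> A.
  by rewrite -[i%:R]/(i%:Z%:~R) -intrD; congr (_%:~R); lia.
ring.
Qed.

(** Equating the logarithms merges the two exponentials into e^(- zeta (u + w)), and reindexing by
    [j] absorbs the degree lost by differentiation. *)
Lemma diag_residue (j : nat) p k : diag (D_z1_div j%:Z G) p k =
  \sum_(m \in [set: int]) Q m (p + j%:Z - m)
    (rbin iota (m%:~R - u) j * dpow iota (w + u) k).
Proof.
rewrite (reindex_fsbig (fun m : int => m + j%:Z) [set: int]) /=; last first.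
  split=> // [a b _ _ /addIr //|m _]; exists (m - j%:Z) => //; exact: subrK.
apply: eq_fsbigr => m _.
have -> : p + j%:Z - (m + j%:Z) = p - m by lia.
rewrite dpowD mulr_sumr (klin_sum (Q_klin _ _)); apply: eq_bigr => k1 _.
rewrite /D_z1_div iter_D_z1 scalerA mulVf ?scale1r ?pnatr_eq0 -?lt0n ?fact_gt0 //.
by congr (Q _ _ (_ * _)); rewrite mulrC.
Qed.

End Diagonal.

(** * Products of two fields *)

(* Products [Y(a,z_1) Y(b,z_2) c] seen as linear maps on the threefold tensor product
   [V3] of [V]: [Yc n k] is the coefficient of z^n zeta^k of Y(z) on the twofold tensor
   product [V2] and [Y1 n k] is that of I (x) Y(z).  Below, [jv x] is x (x) vac, [TL] and [TR] are
   T (x) I and I (x) T, and [M1 n] is the coefficient of z^n of Y(z) (x) I. *)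
Section Products.
Variables (K : numFieldType) (V : superType K) (V2 V3 : lmodType K).
Variables (Yc : int -> nat -> lhom V2 V) (Y1 : int -> nat -> lhom V3 V2).
Variables (S12 S13 S23 P12 : lhom V3 V3).

(* The coefficients of mu(e^(theta_12 Shat) Y(a,z_1) (x) Y(b,z_2)) c, for x = a (x) b (x) c. *)
Definition braided_prod (x : V3) : ser2 V := fun n1 n2 k1 k2 =>
  \sum_(i \in [set: nat]) \sum_(l < k1.+1) (l`!%:R)^-1 *:
     Yc (n1 + i%:Z) (k1 - l) (Y1 (n2 - i%:Z) k2 (opc S12 i (iter l S12 x))).

Definition swap_local N x := forall n1 n2 k1 k2,
  iter N (@mul_z12 K V) (braided_prod x) n1 n2 k1 k2
  = iter N (@mul_z12 K V) (swap12 (braided_prod (P12 x))) n1 n2 k1 k2.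

Hypothesis S12_S13 : forall x, S12 (S13 x) = S13 (S12 x).
Hypothesis S12_S23 : forall x, S12 (S23 x) = S23 (S12 x).
Hypothesis S13_S23 : forall x, S13 (S23 x) = S23 (S13 x).
Hypothesis nil12 : forall x, exists r, iter r S12 x = 0.
Hypothesis nil13 : forall x, exists r, iter r S13 x = 0.
Hypothesis nil23 : forall x, exists r, iter r S23 x = 0.
Hypothesis Y1_trunc : forall k x, exists d : nat, forall n, n < - d%:Z -> Y1 n k x = 0.

Local Notation pi3 := (pi3 S12 S13 S23).
Local Notation iota := (iota3 K).
Local Notation s := (v12 K).
Local Notation u := (v13 K).
Local Notation w := (v23 K).

Lemma Y1_pi3_trunc k x : exists d : nat, forall n q, n < - d%:Z -> Y1 n k (pi3 x q) = 0.
Proof.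
have [||k'|d hd] := @pi3_uniform _ _ _ _ _ S12_S13 S12_S23 S13_S23 nil12 nil13 nil23 x
  (fun d y => forall n, n < - d%:Z -> Y1 n k y = 0).
- by move=> d d' y le h n lt; apply: h; lia.
- by move=> d c y z hy hz n lt; rewrite (lhomP (Y1 n k) c y z) hy // hz // scaler0 addr0.
- exact: Y1_trunc.
- by exists d => n q; apply: hd.
Qed.

Let pi_s := pi3_v12 S12_S13 S12_S23.
Let pi_u := pi3_v13 S12 S13_S23.
Let pi_w := pi3_v23 S12 S13 S23.

Lemma braided_prod_bound k2 x : exists d : nat, forall B n1 n2 k1, n2 + d%:Z < B%:Z ->
  braided_prod x n1 n2 k1 k2 = \sum_(i < B) \sum_(l < k1.+1) (l`!%:R)^-1 *:
     Yc (n1 + i%:Z) (k1 - l) (Y1 (n2 - i%:Z) k2 (opc S12 i (iter l S12 x))).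
Proof.
have [d hd] := Y1_pi3_trunc k2 x; exists d => B n1 n2 k1 lt.
apply: fsum_nat => i le; apply: big1 => l _.
rewrite -[x in iter _ _ x](pi3_1 S12 S13 S23) -(pi3_exp _ _ (pi_s _)) -(pi3_cc _ _ (pi_s _)).
by rewrite hd ?linear0 ?scaler0 //; lia.
Qed.

Lemma braided_prod_trunc k2 x : exists d : nat, forall n1 n2 k1, n2 < - d%:Z -> braided_prod x n1 n2 k1 k2 = 0.
Proof.
have [d hd] := braided_prod_bound k2 x; exists d => n1 n2 k1 lt.
by rewrite (hd 0%N) ?big_ord0 //; lia.
Qed.

Lemma braided_prod_linear c x y n1 n2 k1 k2 :
  braided_prod (c *: x + y) n1 n2 k1 k2 = c *: braided_prod x n1 n2 k1 k2 + braided_prod y n1 n2 k1 k2.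
Proof.
have [d hd] := braided_prod_bound k2 x; have [d' hd'] := braided_prod_bound k2 y.
have [e he] := braided_prod_bound k2 (c *: x + y).
pose B := (`|(n2 + d%:Z)%R| + `|(n2 + d'%:Z)%R| + `|(n2 + e%:Z)%R|).+1.
rewrite (hd B) ?(hd' B) ?(he B); [|rewrite /B; lia..].
rewrite scaler_sumr -big_split; apply: eq_bigr => i _ /=.
rewrite scaler_sumr -big_split; apply: eq_bigr => l _ /=.
by do 4 rewrite linearP /=; rewrite scalerDr !scalerA [c * _]mulrC.
Qed.

(** e^(theta_12 S) = e^(zeta_1 S) (1 - z_2/z_1)^S: with [l] factors zeta_1 split off, the remaining
    k - l factors sum up to [opc]. Local nilpotency bounds k, so that the sums may be exchanged. *)
Lemma exp_theta12_braided_prod x (Fk : nat -> ser2 V) :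
  (forall k n1 n2 k1 k2, Fk k n1 n2 k1 k2 = Yc n1 k1 (Y1 n2 k2 (iter k S12 x))) ->
  forall n1 n2 k1 k2,
  \sum_(k \in [set: nat]) (k`!%:R)^-1 *: iter k (@mul_theta12 K V) (Fk k) n1 n2 k1 k2
  = braided_prod x n1 n2 k1 k2.
Proof.
move=> hF n1 n2 k1 k2; have [d1 h1] := Y1_pi3_trunc k2 x; have [r hr] := nil12 x.
have [d2 h2] := braided_prod_bound k2 x.
pose d := maxn d1 d2; pose B := `|(n2 + d%:Z)%R|.+1.
have ltB : n2 + d%:Z < B%:Z by rewrite /B; lia.
have it k : (r <= k)%N -> iter k S12 x = 0.
  by move=> le; rewrite -(subnK le) iterD hr (linear0 (iter (k - r) S12)).
have Ftr k m1 m2 k' : m2 < - d%:Z -> Fk k m1 m2 k' k2 = 0.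
  move=> lt; rewrite hF -[x](pi3_1 S12 S13 S23) -(pi3_exp _ _ (pi_s _)) h1 ?lhom_zero //.
  by move: lt; rewrite /d; lia.
have F0 k m1 m2 k' : (r <= k)%N -> Fk k m1 m2 k' k2 = 0.
  by move=> le; rewrite hF (it k le) !lhom_zero.
have theta k m1 m2 k' lt := @iter_mul_theta12 _ _ d (Fk k) k2 (Ftr k) k B m1 m2 k' lt.
rewrite (@fsum_nat _ r) => [|k le]; last first.
  rewrite theta // big1 ?scaler0 // => l _; rewrite big1 ?scaler0 // => i _.
  by rewrite F0 ?scaler0.
under eq_bigr => k _.
  rewrite theta // scaler_sumr.
  over.
rewrite (h2 B); last by move: ltB; rewrite /d; lia.
rewrite exchange_big [RHS]exchange_big; apply: eq_bigr => l _ /=.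
under eq_bigr => k _ do rewrite !scaler_sumr.
rewrite exchange_big; apply: eq_bigr => i _ /=.
pose g k := Yc (n1 + i%:Z) (k1 - l) (Y1 (n2 - i%:Z) k2 (iter k S12 x)).
have g0 k : (r <= k)%N -> g k = 0 by move=> le; rewrite /g (it k le) !lhom_zero.
transitivity (\sum_(k < r) (k`!%:R^-1 * 'C(k, l)%:R * lam K (k - l) i) *: g k).
  by apply: eq_bigr => k _; rewrite hF -/(g k) !scalerA mulrA.
have -> : (l`!%:R)^-1 *: Yc (n1 + i%:Z) (k1 - l) (Y1 (n2 - i%:Z) k2 (opc S12 i (iter l S12 x)))
   = \sum_(k < i.+1) (l`!%:R^-1 * (lam K k i / k`!%:R)) *: g (k + l)%N.
  rewrite /opc !lhom_sum scaler_sumr; apply: eq_bigr => k _.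
  by rewrite -iterD !lhom_scale scalerA.
pose f k := (k`!%:R^-1 * 'C(k, l)%:R * lam K (k - l) i) *: g k.
rewrite -(@sum_ord_widen _ r (l + (i.+1 + r))%N f) => [|/=|k le]; first last.
- by rewrite /f g0 ?scaler0.
- by rewrite addnA leq_addl.
rewrite big_split_ord /= big1 ?add0r => [|k _]; last first.
  by rewrite /f bin_small ?mulr0 ?mul0r ?scale0r.
rewrite (@sum_ord_widen _ i.+1 (i.+1 + r) (fun k => f (l + k)%N)) => [||k le]; first last.
- by rewrite /f addKn lam_small ?mulr0 ?scale0r.
- exact: leq_addr.
apply: eq_bigr => k _; rewrite /f addKn [(k + l)%N]addnC; congr (_ *: _).
have := fact_bin K (leq_addr k l); rewrite addKn => h.
by rewrite [_^-1 * 'C(_, _)%:R]mulrC -h -mulrA [lam _ _ _ * _]mulrC.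
Qed.

Lemma swap_local_mono N N' x : (N <= N')%N -> swap_local N x -> swap_local N' x.
Proof.
move=> le h n1 n2 k1 k2; rewrite -(subnK le) !iterD.
by apply: iter_mul_z12_ext; move=> m1 m2; exact: h.
Qed.

Lemma swap_local_linear N c x y : swap_local N x -> swap_local N y -> swap_local N (c *: x + y).
Proof.
move=> hx hy n1 n2 k1 k2; rewrite (iter_mul_z12D N (braided_prod_linear c x y)) hx hy.
rewrite (iter_mul_z12_swap12 N (braided_prod (P12 x))) (iter_mul_z12_swap12 N (braided_prod (P12 y))).
rewrite (iter_mul_z12_swap12 N (braided_prod (P12 _))) (lhomP P12 c x y) (iter_mul_z12D N (braided_prod_linear c (P12 x) (P12 y))).
by rewrite scalerDr !scalerA [c * _]mulrC.
Qed.

Hypothesis locality : forall x, exists N, swap_local N x.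

Lemma swap_local_pi3 x : exists N, forall q, swap_local N (pi3 x q).
Proof.
apply: (pi3_uniform S12_S13 S12_S23 S13_S23 nil12 nil13 nil23 x) => //.
- exact: swap_local_mono.
- exact: swap_local_linear.
Qed.


Variables (S P : lhom V2 V2) (jv : lhom V2 V3).
Hypothesis jv_S : forall x, jv (S x) = S12 (jv x).
Hypothesis P12_jv : forall x, P12 (jv x) = jv (P x).
Hypothesis Y1_jv_eq0 : forall n k x, (n < 0) || (0 < k)%N -> Y1 n k (jv x) = 0.
Hypothesis Y1_jv : forall x, Y1 0 0 (jv x) = x.

Let opc_jv i l x : opc S12 i (iter l S12 (jv x)) = jv (opc S i (iter l S x)).
Proof. by rewrite (opc_intertwine _ _ jv_S) (iter_intertwine _ _ jv_S). Qed.

Lemma braided_prod_jv_eq0 n1 n2 k1 k2 x : (n2 < 0) || (0 < k2)%N -> braided_prod (jv x) n1 n2 k1 k2 = 0.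
Proof.
move=> h; rewrite /braided_prod (@fsum_nat _ 0) ?big_ord0 // => i _; apply: big1 => l _.
rewrite opc_jv Y1_jv_eq0 ?linear0 ?scaler0 //.
by case/orP: h => [lt|->]; rewrite ?orbT //; apply/orP; left; lia.
Qed.

Lemma braided_prod_jv0 n k x : braided_prod (jv x) n 0 k 0 = \sum_(l < k.+1) (l`!%:R)^-1 *: Yc n (k - l) (iter l S x).
Proof.
rewrite /braided_prod (@fsum_nat _ 1) => [|i lt]; last first.
  by apply: big1 => l _; rewrite opc_jv Y1_jv_eq0 ?linear0 ?scaler0 //; lia.
rewrite big_ord1; apply: eq_bigr => l _.
by rewrite opc_jv addr0 subr0 Y1_jv opc0.
Qed.

(** With vac as third argument one side of locality is free of zeta_2 and the other of zeta_1, so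
    neither occurs. The lowest coefficient in z_2 then says that e^(zeta S) followed by Y(z) is free
    of zeta, which is inverted by induction on the power of zeta. *)
Theorem Y_log_terms n k x : Yc n k x = ((-1) ^+ k / k`!%:R) *: Yc n 0 (iter k S x).
Proof.
have [k' ltk] := ubnP k; elim: k' k ltk x => // k' IH [|k] ltk x.
  by rewrite fact0 divr1 scale1r.
have [N hN] := locality (jv x).
(* At z_2^0 the factor z_12^N reduces to z_1^N, which the shift by [N] compensates. *)
have := hN (n + N%:Z) 0 k.+1 0%N.
rewrite (iter_mul_z12_swap12 N (braided_prod (P12 (jv x)))) P12_jv.
rewrite (@iter_mul_z12_trunc _ _ (n + N%:Z + 1) _ (braided_prod (jv (P x)))); first last.
- by lia.
- by move=> n1 n2 _; rewrite braided_prod_jv_eq0 ?orbT.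
rewrite (@iter_mul_z12_bottom _ _ 0) => [|n1 n2 lt]; last by rewrite braided_prod_jv_eq0 ?lt.
rewrite addrK scaler0 braided_prod_jv0 big_ord_recl /= fact0 invr1 scale1r subn0 => /eqP.
rewrite addr_eq0 => /eqP ->.
rewrite -[RHS]subr0 -[X in _ = _ - X](scale0r (Yc n 0 (iter k.+1 S x))).
have <- : \sum_(l < k.+2) (-1) ^+ (k.+1 - l) * ((l`!%:R)^-1 * ((k.+1 - l)`!%:R)^-1) = 0 :> K.
  transitivity ((-1 + 1) ^+ k.+1 / k.+1`!%:R : K); last first.
    by rewrite addNr expr0n mul0r.
  rewrite exprDn mulr_suml; apply: eq_bigr => l _.
  by rewrite expr1n mulr1 fact_bin -1?ltnS // mulrA mulr_natr.
rewrite [X in _ - X *: _]big_ord_recl /= fact0 invr1 mul1r scalerDl opprD addrA subrr add0r.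
congr (- _); rewrite scaler_suml; apply: eq_bigr => l _.
have ltl : (l < k.+1)%N := ltn_ord l.
rewrite /bump leq0n !add1n add0n subSS -[S (iter l S x)]/(iter l.+1 S x).
rewrite -[S (iter k S x)]/(iter k.+1 S x) IH; last by lia.
rewrite scalerA mulrCA -iterD; congr (_ *: Yc n 0 (iter _ S x)); lia.
Qed.

Hypothesis Y1_log : forall n k x, Y1 n k x = ((-1) ^+ k / k`!%:R) *: Y1 n 0 (iter k S23 x).
Hypothesis P12_S12 : forall x, P12 (S12 x) = S12 (P12 x).
Hypothesis P12_S13 : forall x, P12 (S13 x) = S23 (P12 x).

Definition XX m n x := Yc m 0 (Y1 n 0 x).

Local Notation dpow := (dpow iota).

(** The coefficient of zeta_1^k when e^(zeta_1 S12) is inserted under the two fields, at zeta_2 = 0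
    and without the factor (1 - z_2/z_1)^S12. *)
Let Dser x k m n q :=
  \sum_(l < k.+1) (l`!%:R)^-1 *: Yc m (k - l) (Y1 n 0 (pi3 x (s ^+ l * q))).

Let braided_prod_pi3 x q m n k1 k2 :
  braided_prod (pi3 x q) m n k1 k2 = Eser iota s (Dser x k1) m n (dpow w k2 * q).
Proof.
rewrite /braided_prod /Eser; apply: eq_fsbigr => i _; apply: eq_bigr => l _.
rewrite Y1_log -(pi3_exp _ _ (pi_s _)) -(pi3_cc _ _ (pi_s _)) -(pi3_exp _ _ (pi_w _)).
rewrite -(lhom_scale (Y1 _ 0)) -pi3_scale //; congr (_ *: Yc _ _ (Y1 _ _ (pi3 _ _))).
by rewrite /dpow; ring.
Qed.

Let braided_prod_P12_pi3 x q m n k :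
  braided_prod (P12 (pi3 x q)) m n 0 k = braided_prod (P12 (pi3 x (dpow u k * q))) m n 0 0.
Proof.
rewrite /braided_prod; apply: eq_fsbigr => i _; rewrite !big_ord1 /= Y1_log.
rewrite -!(opc_intertwine _ _ P12_S12) -(iter_intertwine _ _ P12_S13).
rewrite -(lhom_scale (Y1 _ 0)) -(lhom_scale P12); congr (_ *: Yc _ _ (Y1 _ _ (P12 _))).
rewrite -!(pi3_cc _ _ (pi_s _)) -(pi3_exp _ _ (pi_u _)) -pi3_scale //.
by congr (pi3 _ _); rewrite /dpow; ring.
Qed.

Let F x m n q := XX m n (pi3 x q).

Let F_klin x m n : klin iota (F x m n).
Proof.
split=> [p q|c q]; rewrite /F /XX.
  by rewrite pi3_add !lhom_add.
by rewrite pi3_scale // !lhom_scale.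
Qed.

(** On the exchanged side of locality zeta_1 is the logarithm of the inner field and, since P12
    carries S13 to S23, enters as e^(- zeta_1 S13) only. The factors (z_1 - z_2)^N and (1 -
    z_2/z_1)^S12 are then cancelled, both being injective. *)
Let D_F x k m n q : Dser x k m n q = F x m n (dpow u k * q).
Proof.
have [d hd] := Y1_pi3_trunc 0 x; have [N hN] := swap_local_pi3 x.
pose D m n q := Dser x k m n q - F x m n (dpow u k * q).
have Dtr : trunc d (Dser x k).
  by move=> m' n' q' lt; rewrite /Dser big1 // => l _; rewrite hd ?linear0 ?scaler0.
have Ftr : trunc d (F x) by move=> m' n' q' lt; rewrite /F /XX hd ?linear0.
have Dt : trunc d D by move=> m' n' q' lt; rewrite /D Dtr // Ftr // subrr.
have Dsl m' n' : klin iota (Dser x k m' n').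
  split=> [p1 p2|c p].
    rewrite /Dser -big_split; apply: eq_bigr => l _ /=.
    by rewrite mulrDr pi3_add !lhom_add scalerDr.
  rewrite /Dser scaler_sumr; apply: eq_bigr => l _ /=.
  by rewrite mulrCA pi3_scale // !lhom_scale !scalerA mulrC.
have Dl m' n' : klin iota (D m' n').
  split=> [p1 p2|c p]; rewrite /D.
    by rewrite (Dsl _ _).1 mulrDr (F_klin _ _ _).1 opprD addrACA.
  by rewrite (Dsl _ _).2 mulrCA (F_klin _ _ _).2 scalerBr.
suff h m' n' q' : Eser iota s D m' n' q' = 0.
  by apply: subr0_eq; exact: (Eser_inj Dt Dl h).
move: m' n'.
have Esub m' n' : Eser iota s D m' n' q'
    = Eser iota s (Dser x k) m' n' q' - Eser iota s (F x) m' n' (dpow u k * q').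
  pose B := `|(n' + d%:Z)%R|.+1; have ltB : n' + d%:Z < B%:Z by rewrite /B; lia.
  rewrite !(@EserE _ _ iota _ d B) // -sumrB; apply: eq_bigr => i _.
  by rewrite /D mulrCA.
apply: (@iter_mz_torsion _ _ _ d N (Eser iota s D)); first exact: Eser_trunc.
move=> m' n'.
have e1 := hN q' m' n' k 0%N.
have e2 := hN (dpow u k * q') m' n' 0%N 0%N.
rewrite (iter_mul_z12_swap12 N (braided_prod (P12 _))) in e1.
rewrite (iter_mul_z12_swap12 N (braided_prod (P12 _))) in e2.
have e3 : iter N (@mul_z12 K V) (braided_prod (P12 (pi3 x q'))) n' m' 0 k
   = iter N (@mul_z12 K V) (braided_prod (P12 (pi3 x (dpow u k * q')))) n' m' 0 0.
  by apply: iter_mul_z12_ext => a b; rewrite braided_prod_P12_pi3.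
rewrite e3 -e2 {e2 e3} in e1.
have dw0 : dpow w 0 = 1 by rewrite /dpow fact0 divr1 rmorph1 mul1r.
have D0 : Dser x 0 = F x.
  apply: funext => a; apply: funext => b; apply: funext => q0.
  by rewrite /Dser big_ord1 /= fact0 invr1 scale1r expr0 mul1r.
rewrite (@iter_mul_z12_mz _ _ _ N _ (Eser iota s (Dser x k)) q') in e1; last first.
  by move=> a b; rewrite braided_prod_pi3 dw0 mul1r.
rewrite (@iter_mul_z12_mz _ _ _ N _ (Eser iota s (F x)) (dpow u k * q')) in e1; last first.
  by move=> a b; rewrite braided_prod_pi3 dw0 mul1r D0.
transitivity (iter N (@mz _ _ _) (Eser iota s (Dser x k)) m' n' q'
   - iter N (@mz _ _ _) (Eser iota s (F x)) m' n' (dpow u k * q')); last first.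
  by rewrite e1 subrr.
clear e1 hN; elim: N m' n' => [|N IH] m' n'; first exact: Esub.
by rewrite !iterS /mz !IH !opprD !opprK addrACA.
Qed.

(** By [D_F] the outer logarithm enters as e^(- zeta (S12 + S13)) applied before both fields; by
    [Y_log_terms] it is e^(- zeta S) applied between them. Strong induction removes the lower powers
    of zeta, and comparison leaves the k-th powers. *)
Lemma Y_iter_S_pi3 x k m n q :
  Yc m 0 (iter k S (Y1 n 0 (pi3 x q))) = XX m n (pi3 x ((s + u) ^+ k * q)).
Proof.
have [k' ltk] := ubnP k; elim: k' k ltk m q => // k' IH k ltk m q.
have c0 : (-1) ^+ k / k`!%:R != 0 :> K.
  by rewrite mulf_neq0 ?signr_eq0 ?invr_eq0 ?pnatr_eq0 -?lt0n ?fact_gt0.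
apply: (scalerI c0); rewrite -Y_log_terms.
have D := D_F x k m n q; rewrite /Dser big_ord_recl /= fact0 invr1 scale1r in D.
rewrite expr0 mul1r subn0 in D; apply: (addIr _ (etrans D _)).
have -> : dpow u k = \sum_(l < k.+1) dpow (s + u) (k - l) * dpow (- s) l.
  by rewrite -dpowD; congr (dpow _ _); ring.
rewrite big_ord_recl mulrDl (F_klin _ _ _).1; congr (_ + _).
  by rewrite /= subn0 dpow0 mulr1 -mulrA (F_klin _ _ _).2.
rewrite mulr_suml (klin_sum (F_klin _ _ _)); apply: eq_bigr => l _.
have ltl := ltn_ord l; rewrite /bump leq0n add1n Y_log_terms IH; last by lia.
rewrite !scalerA -[XX _ _ _]/(F x m n _) -(F_klin _ _ _).2; congr (F x m n _).
by rewrite !lift0 dpow_mulN -!mulrA.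
Qed.

Definition S123 y := S12 y + S13 y.

(** S passes through I (x) Y as S12 + S13, but only as seen through the outer [Yc], because locality
    compares products of two fields. *)
Theorem Y_iter_S k m n y :
  Yc m 0 (iter k S (Y1 n 0 y)) = XX m n (iter k S123 y).
Proof.
have := Y_iter_S_pi3 y k m n 1; rewrite pi3_1 => ->; congr (XX _ _ _).
rewrite -[in RHS](pi3_1 S12 S13 S23 y); apply: pi3_exp => q.
by rewrite mulrDl pi3_add pi_s pi_u.
Qed.


Lemma braided_prod00 y m n : braided_prod y m n 0 0
  = \sum_(i \in [set: nat]) XX (m + i%:Z) (n - i%:Z) (opc S12 i y).
Proof.
apply: eq_fsbigr => i _; by rewrite big_ord1 /= fact0 invr1 scale1r.
Qed.

Lemma braided_prod00_pi3 x q m n : braided_prod (pi3 x q) m n 0 0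
  = Eser iota s (fun m n q => XX m n (pi3 x q)) m n q.
Proof. by rewrite braided_prod00; apply: eq_fsbigr => i _; rewrite (pi3_cc _ _ (pi_s _)). Qed.

(** A provisional form of S(a (x) vac) = 0, which comes later from the hexagon axiom. Exchanging a
    and b keeps vac in third place, so the exchanged product has no logarithm in its inner variable;
    the term linear in it is, by locality, the one with S13. *)
Lemma braided_prod_S13_jv x m n : braided_prod (S13 (jv x)) m n 0 0 = 0.
Proof.
have [d hd] := Y1_pi3_trunc 0 (jv x); have [N hN] := swap_local_pi3 (jv x).
have Ftr : trunc d (F (jv x)) by move=> m' n' q' lt; rewrite /F /XX hd ?linear0.
(* [dpow u 1] is - u, the linear part of e^(- zeta u). *)
pose q := dpow u 1 * 1.
have h : forall m n, Eser iota s (F (jv x)) m n q = 0.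
  apply: (@iter_mz_torsion _ _ _ d N (Eser iota s (F (jv x)))); first exact: Eser_trunc.
  move=> m' n'; rewrite -(@iter_mul_z12_mz _ _ _ N (braided_prod (pi3 (jv x) q)) _ _ 0 0); last first.
    by move=> a b; exact: braided_prod00_pi3.
  rewrite hN (iter_mul_z12_swap12 N (braided_prod (P12 _))).
  rewrite (@iter_mul_z12_trunc _ _ (m' + 1) _ (braided_prod (P12 _))) ?scaler0 //; last by lia.
  by move=> n1 n2 _; rewrite -braided_prod_P12_pi3 pi3_1 P12_jv braided_prod_jv_eq0 ?orbT.
have e : S13 (jv x) = (-1) *: pi3 (jv x) q + 0.
  rewrite addr0 -pi3_scale // /q [iota _ * _]mulrA iota_dpow1 pi_u.
  by rewrite pi3_1.
rewrite e braided_prod_linear braided_prod00_pi3 h scaler0 add0r.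
have := braided_prod_linear (-1) 0 0 m n 0 0.
by rewrite scaler0 addr0 scaleN1r addNr.
Qed.

Lemma opcS i x :
  i.+1%:R *: opc S12 i.+1 x = i%:R *: opc S12 i x - S12 (opc S12 i x).
Proof.
rewrite -[x](pi3_1 S12 S13 S23) -!(pi3_cc _ _ (pi_s _)) -pi_s.
have lpi : klin iota (pi3 x) by exact: pi3_klin.
rewrite -!(klin_nat lpi) -(klinB lpi) mulrA ccS; congr (pi3 _ _).
by rewrite !mulr1 mulrBl.
Qed.

Variables (T : lhom V V) (TR : lhom V2 V2).
Hypothesis Yc_T : forall n k x, T (Yc n k x) =
  Yc n k (TR x) + (n + 1)%:~R *: Yc (n + 1) k x + k.+1%:R *: Yc (n + 1) k.+1 x.
Hypothesis jv_T : forall n x, TR (Y1 n 0 (jv x)) = (n + 1)%:~R *: Y1 (n + 1) 0 (jv x).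

Let Yc_1 n x : Yc n 1 x = - Yc n 0 (S x).
Proof. by rewrite Y_log_terms expr1 divr1 scaleN1r. Qed.

(** In D_(z_1) the zeta-derivative contributes - S, that is - S12 - S13. The S13 part vanishes by
    [braided_prod_S13_jv]; the S12 part accounts for the derivatives of (1 - z_2/z_1)^S12, so the
    difference of the two sides telescopes. *)
Lemma braided_prod_jv_T x m n : T (braided_prod (jv x) m n 0 0)
  = (m + 1)%:~R *: braided_prod (jv x) (m + 1) n 0 0 + (n + 1)%:~R *: braided_prod (jv x) m (n + 1) 0 0.
Proof.
have [d hd] := braided_prod_bound 0 (S13 (jv x)).
pose B := (`|n| + `|(n + d%:Z)%R|)%N.+2; pose y i := opc S12 i (jv x).
have yE i : y i = jv (opc S i x) by rewrite /y -(opc_intertwine _ _ jv_S).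
have EB m' n' : n' < B%:Z -> braided_prod (jv x) m' n' 0 0 = \sum_(i < B) XX (m' + i%:Z) (n' - i%:Z) (y i).
  move=> lt; rewrite braided_prod00; apply: (@fsum_nat _ B) => i le.
  by rewrite -/(y i) yE /XX Y1_jv_eq0 ?lhom_zero //; apply/orP; left; lia.
pose A i z := XX (m + i%:Z) (n + 1 - i%:Z) z.
have AB i z z' : A i (z - z') = A i z - A i z'.
  by rewrite /A /XX lhom_add -scaleN1r lhom_scale lhom_add lhom_scale scaleN1r.
have AZ c i z : A i (c *: z) = c *: A i z by rewrite /A /XX !lhom_scale.
rewrite !EB; [|rewrite /B; lia..].
rewrite (linear_sum T) /=.
transitivity (\sum_(i < B) ((n + 1 - i%:Z)%:~R *: A i (y i)
   + (m + 1 + i%:Z)%:~R *: A i.+1 (y i) - A i.+1 (S12 (y i)) - A i.+1 (S13 (y i)))).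
  apply: eq_bigr => i _; rewrite Yc_T Yc_1.
  have := Y_iter_S 1 (m + i%:Z + 1) (n - i%:Z) (y i); rewrite /= => ->.
  rewrite {1 2}yE jv_T -yE lhom_scale scale1r /S123 /A /XX.
  have -> : n + 1 - i.+1%:Z = n - i%:Z by lia.
  have -> : n + 1 - i%:Z = n - i%:Z + 1 by lia.
  have -> : m + i.+1%:Z = m + i%:Z + 1 by lia.
  have -> : m + 1 + i%:Z = m + i%:Z + 1 by lia.
  by rewrite !lhom_add opprD !addrA.
have z13 : \sum_(i < B) A i.+1 (S13 (y i)) = 0.
  rewrite -[RHS](braided_prod_S13_jv x (m + 1) n) (hd B); last by rewrite /B; lia.
  apply: eq_bigr => i _; rewrite big_ord1 /= fact0 invr1 scale1r.
  rewrite -(@opc_intertwine _ _ _ S13 S12 S12) => [|z]; last by rewrite S12_S13.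
  rewrite -/(y i) /A /XX.
  have -> : n + 1 - i.+1%:Z = n - i%:Z by lia.
  by have -> : m + i.+1%:Z = m + 1 + i%:Z by lia.
rewrite sumrB z13 subr0.
have -> : \sum_(i < B) XX (m + 1 + i%:Z) (n - i%:Z) (y i) = \sum_(i < B) A i.+1 (y i).
  apply: eq_bigr => i _; rewrite /A.
  have -> : n + 1 - i.+1%:Z = n - i%:Z by lia.
  by have -> : m + i.+1%:Z = m + 1 + i%:Z by lia.
rewrite -/(A _ _) !scaler_sumr -big_split /=; apply: subr0_eq; rewrite -sumrB.
transitivity (\sum_(i < B) (i.+1%:R *: A i.+1 (y i.+1) - i%:R *: A i (y i))).
  apply: eq_bigr => i _.
  have -> : i.+1%:R *: A i.+1 (y i.+1) = i%:R *: A i.+1 (y i) - A i.+1 (S12 (y i)).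
    by rewrite -!AZ -AB /y opcS.
  rewrite intrB -[(m + 1 + i%:Z)%:~R]/((m + 1 + i%:Z)%:~R) [(m + 1 + i%:Z)%:~R]intrD -!pmulrn.
  rewrite scalerBl scalerDl; apply/eqP; rewrite subr_eq; apply/eqP.
  by rewrite (AC (2*2*1) ((4*5*2)*(3*1))).
rewrite -(big_mkord xpredT (fun i => i.+1%:R *: A i.+1 (y i.+1) - i%:R *: A i (y i))).
rewrite telescope_sumr // scale0r subr0 yE /A /XX Y1_jv_eq0 ?lhom_zero ?scaler0 //.
by apply/orP; left; rewrite /B; lia.
Qed.

Hypothesis SP : forall x, S (P x) = P (S x).

(* Y(b,z) a = e^(zT) Y(a,-z) b at zeta = 0, up to the sign in [P]. *)
Theorem skew_symmetry0 x p R :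
  (forall r : nat, (R <= r)%N -> Yc (p - r%:Z) 0 x = 0) ->
  Yc p 0 (P x) = \sum_(r < R) Tdiv T r (sg K (p - r%:Z) *: Yc (p - r%:Z) 0 x).
Proof.
move=> hR; have [N hN] := locality (jv x).
pose G m n := iter N (@mul_z12 K V) (braided_prod (jv x)) m n 0 0.
pose G' m n := iter N (@mul_z12 K V) (braided_prod (jv (P x))) m n 0 0.
have GG m n : G m n = (-1) ^+ N *: G' n m.
  by rewrite /G hN (iter_mul_z12_swap12 N (braided_prod (P12 _))) P12_jv.
have tr z m n : n < 0 -> iter N (@mul_z12 K V) (braided_prod (jv z)) m n 0 0 = 0.
  by apply: iter_mul_z12_trunc => n1 n2 lt; rewrite braided_prod_jv_eq0 ?lt.
have G0 z m : iter N (@mul_z12 K V) (braided_prod (jv z)) m 0 0 0 = Yc (m - N%:Z) 0 z.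
  rewrite (@iter_mul_z12_bottom _ _ 0) => [|n1 n2 lt]; last by rewrite braided_prod_jv_eq0 ?lt.
  by rewrite braided_prod_jv0 big_ord1 /= fact0 invr1 scale1r.
(* d/dz_1 + d/dz_2 kills z_1 - z_2, so the factor z_12^N does not disturb covariance. *)
have GT m n : T (G m n) = (m + 1)%:~R *: G (m + 1) n + (n + 1)%:~R *: G m (n + 1).
  rewrite /G; elim: {hN G G' GG tr G0}N m n => [|N IH] m n; first exact: braided_prod_jv_T.
  set f := iter N _ _ in IH *.
  rewrite iterS -/f /mul_z12 lhom_add -scaleN1r lhom_scale scaleN1r !IH.
  have -> : m - 1 + 1 = m by lia.
  have -> : n - 1 + 1 = n by lia.
  rewrite !addrK !scalerBr.
  have e (k : int) v : k%:~R *: v = (k + 1)%:~R *: v - v :> V.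
    by rewrite intrD scalerDl scale1r addrK.
  rewrite (e m (f m n 0%N 0%N)) (e n (f m n 0%N 0%N)) !opprD opprK.
  set a := (m + 1)%:~R *: f m n _ _; set b := _ *: f (m + 1) _ _ _.
  set c := _ *: f _ (n + 1) _ _; set a' := (n + 1)%:~R *: f m n _ _; set z := f m n _ _.
  rewrite (AC (3*(1*2)) (((1*4)*(3*5))*(2*6))) /=.
  by rewrite addNr addr0.
have sgN : (-1) ^+ N * (-1) ^+ N = 1 :> K by rewrite -exprMn mulrNN mulr1 expr1n.
have YG r : Yc (p - r) 0 x = G (p + N%:Z - r) 0.
  by rewrite /G G0; congr (Yc _ _ _); lia.
have YP : Yc p 0 (P x) = (-1) ^+ N *: G 0 (p + N%:Z).
  by rewrite GG scalerA sgN scale1r /G' G0 addrK.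
pose f (r : nat) := Tdiv T r (sg K (p - r%:Z) *: Yc (p - r%:Z) 0 x).
have fR r : (R <= r)%N -> f r = 0 by move=> le; rewrite /f hR // scaler0 linear0.
have fN r : p + N%:Z < r%:Z -> f r = 0.
  by move=> lt; rewrite /f YG GG /G' tr ?scaler0 ?linear0 //; lia.
rewrite YP; have [lt0|] := ltP (p + N%:Z) 0.
  by rewrite /G tr // scaler0 big1 // => r _; apply: fN; lia.
case En : (p + N%:Z) => [n|//] _.
(* By locality [G] has no negative powers in either variable. Its part at z_2^0 comes from Y(z) x
   and its part at z_1^0 from Y(z) P x, and translation connects the two. *)
have -> := @translation_solve _ _ T (fun m n => G m%:Z n%:Z) _ n => [|m k]; last first.
  by rewrite GT; congr (_ *: G _ _ + _ *: G _ _); rewrite ?intrD -?natr1 //; lia.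
rewrite -/(\sum_(r < R) f r) -(@sum_ord_widen _ R (maxn R n.+1) f (leq_maxl _ _) fR).
rewrite (@sum_ord_widen _ n.+1 (maxn R n.+1) f (leq_maxr _ _)) => [|r le]; last first.
  by apply: fN; lia.
rewrite scaler_sumr; apply: eq_bigr => r _.
have ler : (r <= n)%N by rewrite -ltnS.
rewrite /f YG TdivZ [LHS]scalerA -exprD; congr (_ *: Tdiv T r (G _ _)).
  have -> : p - r%:Z = (n - r)%N%:Z - N%:Z by lia.
  by rewrite sgB !sg_nat -exprD addnC.
lia.
Qed.

Lemma Y_log_P n k x : Yc n k (P x) = ((-1) ^+ k / k`!%:R) *: Yc n 0 (P (iter k S x)).
Proof.
rewrite Y_log_terms; congr (_ *: Yc _ _ _).
by apply/esym; apply: (iter_intertwine (h := P)) => z; rewrite SP.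
Qed.

Theorem skew_symmetry k x p R :
  (forall r : nat, (R <= r)%N -> Yc (p - r%:Z) k x = 0) ->
  Yc p k (P x) = \sum_(r < R) Tdiv T r (sg K (p - r%:Z) *: Yc (p - r%:Z) k x).
Proof.
have c0 : (-1) ^+ k / k`!%:R != 0 :> K.
  by rewrite mulf_neq0 ?signr_eq0 ?invr_eq0 ?pnatr_eq0 -?lt0n ?fact_gt0.
move=> hR; rewrite Y_log_P (@skew_symmetry0 _ _ R) => [|r le]; last first.
  by apply: (scalerI c0); rewrite -Y_log_terms hR // scaler0.
rewrite scaler_sumr; apply: eq_bigr => r _.
by rewrite [in RHS]Y_log_terms -TdivZ !scalerA mulrC.
Qed.

Variable TL : lhom V2 V2.
Hypothesis TL_P : forall x, TL (P x) = P (TR x).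
Hypothesis PK : forall x, P (P x) = x.
Hypothesis Yc_trunc : forall k x, exists d : nat, forall n, n < - d%:Z -> Yc n k x = 0.

(* Y(Ta,z) = D_z Y(a,z) *)
Theorem Y_translation p k x : Yc p k (TL x)
  = (p + 1)%:~R *: Yc (p + 1) k x + k.+1%:R *: Yc (p + 1) k.+1 x.
Proof.
rewrite -(PK x) TL_P; move: (P x) => {}x.
have [d1 h1] := Yc_trunc k x; have [d2 h2] := Yc_trunc k.+1 x.
have [d3 h3] := Yc_trunc k (TR x).
pose R := (`|p| + d1 + d2 + d3)%N.+2.
rewrite !(@skew_symmetry _ _ _ R) => [|r le|r le|r le];
  [|by first [apply: h1|apply: h2|apply: h3]; rewrite /R in le; lia..].
pose y r := Yc (p + 1 - r%:Z) k x; pose z r := Yc (p + 1 - r%:Z) k.+1 x.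
have cov r : Yc (p - r%:Z) k (TR x)
    = T (y r.+1) - (p + 1 - r%:Z)%:~R *: y r - k.+1%:R *: z r.
  apply/eqP; rewrite eq_sym !subr_eq; apply/eqP.
  have -> : y r.+1 = Yc (p - r%:Z) k x by rewrite /y; congr (Yc _ _ _); lia.
  rewrite Yc_T /y /z.
  have -> : p - r%:Z + 1 = p + 1 - r%:Z by lia.
  by rewrite -!addrA [X in _ + X]addrC.
rewrite !scaler_sumr -big_split /=; apply: subr0_eq; rewrite -sumrB.
(* Since T^(r) T = (r + 1) T^(r + 1) for divided powers, the terms pair up and the sum telescopes;
   the last term vanishes by truncation. *)
pose h r := (sg K (p + 1 - r%:Z) * r%:R) *: Tdiv T r (y r).
transitivity (\sum_(r < R) (h r.+1 - h r)).
  apply: eq_bigr => r _; rewrite cov -/(y r) -/(z r) !TdivZ /h.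
  have s1 : sg K (p - r%:Z) = - sg K (p + 1 - r%:Z).
    have -> : p - r%:Z = p + 1 - r%:Z - 1 by lia.
    by rewrite sgB [sg K 1]expr1 mulrN1.
  have -> : p + 1 - r.+1%:Z = p - r%:Z by lia.
  rewrite s1 !TdivB !TdivZ Tdiv_T; set c := sg K _.
  rewrite [(p + 1 - r%:Z)%:~R]intrB -pmulrn; set b := (p + 1)%:~R.
  move: (Tdiv T r.+1 _) (Tdiv T r (y r)) (Tdiv T r (z r)) => v1 v2 v3.
  rewrite !scalerBr !scalerA opprD (AC (3*2) ((1*(2*4))*(3*5))) /=.
  rewrite -!opprD -!scalerDl.
  have -> : - c * k.+1%:R + k.+1%:R * c = 0 by ring.
  have -> : - c * (b - r%:R) + b * c = c * r%:R by ring.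
  by rewrite scale0r subr0.
rewrite -(big_mkord xpredT (fun r => h r.+1 - h r)) telescope_sumr // /h mulr0 scale0r subr0.
by rewrite /y h1 ?linear0 ?scaler0 // /R; lia.
Qed.

Variable P23 : lhom V3 V3.
Hypothesis STR : forall x, S (TR x) = TR (S x).
Hypothesis P23_S13 : forall x, P23 (S13 x) = S12 (P23 x).
Hypothesis P23_S12 : forall x, P23 (S12 x) = S13 (P23 x).
Hypothesis P23_S23 : forall x, P23 (S23 x) = S23 (P23 x).
Hypothesis P12_S23 : forall x, P12 (S23 x) = S13 (P12 x).
Hypothesis Y1_skew : forall z p R,
  (forall r : nat, (R <= r)%N -> Y1 (p - r%:Z) 0 (P23 z) = 0) ->
  Y1 p 0 z = \sum_(r < R) sg K (p - r%:Z) *: Tdiv TR r (Y1 (p - r%:Z) 0 (P23 z)).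

Variable M1 : int -> lhom V3 V2.
Hypothesis P_Y1 : forall k z, P (Y1 k 0 (P12 (P23 z))) = M1 k z.

Definition S1323 y := S13 y + S23 y.

(** [Y_iter_S] carried over by skew-symmetry: [P_Y1] expresses Y (x) I through I (x) Y, and P23
    followed by P12 takes S13 to S12 and S23 to S13. *)
Lemma Y_iter_S_M1 p k a z :
  Yc p 0 (iter k S (M1 a z)) = Yc p 0 (M1 a (iter k S1323 z)).
Proof.
have e : P12 (P23 (iter k S1323 z)) = iter k S123 (P12 (P23 z)).
  apply: (iter_intertwine (h := fun y => P12 (P23 y))) => y.
  by rewrite /S1323 !lhom_add P23_S13 P23_S23 P12_S12 P12_S23.
rewrite -!P_Y1 e -(@iter_intertwine _ _ _ P S S) => [|y]; last by rewrite SP.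
set y := P12 (P23 z).
have [d hd] := Yc_trunc 0 (iter k S (Y1 a 0 y)).
pose R := (`|p| + d).+1%N.
have h r : Yc (p - r%:Z) 0 (iter k S (Y1 a 0 y)) = Yc (p - r%:Z) 0 (Y1 a 0 (iter k S123 y)).
  by rewrite Y_iter_S.
rewrite (@skew_symmetry0 _ _ R) => [|r le]; last by apply: hd; rewrite /R in le; lia.
rewrite (@skew_symmetry0 (Y1 a 0 (iter k S123 y)) _ R) => [|r le]; last first.
  by rewrite -h; apply: hd; rewrite /R in le; lia.
by apply: eq_bigr => r _; rewrite h.
Qed.

(** * Translation of a product of two fields and the n-th product *)

Section TripleFamily.
Variable x : V3.

(** Up to sign the product Y(a,z_1) Y(c,z_2) b, if x is a (x) b (x) c. *)
Let AA m n q := XX m n (P23 (pi3 x q)).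

Let AA_klin m n : klin iota (AA m n).
Proof.
split=> [p q|c q]; rewrite /AA /XX.
  by rewrite pi3_add !lhom_add.
by rewrite pi3_scale // !lhom_scale.
Qed.

Let falling (i l : nat) : K := (-1) ^+ l * (i ^_ l)%:R.

(** From [T, Y(a,z)] = D_z Y(a,z), moving T^i to the left of Y(a,z) yields the sum of (-1)^l
    binom(i, l) T^(i - l) D_z^l Y(a,z). The l! of D_z^l is part of [falling], and its divided power
    gives [rbin], the exponent being shifted by the outer logarithm S12 + S13. *)
Lemma Y_iter_TR n i k m q :
  Yc m 0 (iter i TR (iter k S (Y1 n 0 (P23 (pi3 x q))))) =
  \sum_(l < i.+1) falling i l *: iter (i - l) T
     (AA (m + l%:Z) n (rbin iota ((m + l%:Z)%:~R - (s + u)) l * ((s + u) ^+ k * q))).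
Proof.
elim: i k m q => [|i IH] k m q.
  rewrite big_ord1 /= /falling ffactn0 expr0 mul1r scale1r addr0 mul1r.
  rewrite Y_iter_S /AA; congr (XX _ _ _).
  have h q' : P23 (pi3 x ((s + u) * q')) = S123 (P23 (pi3 x q')).
    by rewrite mulrDl pi3_add lhom_add pi_s pi_u // P23_S12 P23_S13 /S123 addrC.
  elim: k => [|k IH]; first by rewrite expr0 mul1r.
  by rewrite exprS -mulrA h -IH.
pose b l := rbin iota ((m + l%:Z)%:~R - (s + u)) l.
pose E l := iter (i.+1 - l) T (AA (m + l%:Z) n (b l * ((s + u) ^+ k * q))).
set wv := iter i TR (iter k S (Y1 n 0 (P23 (pi3 x q)))).
have -> : Yc m 0 (iter i.+1 TR (iter k S (Y1 n 0 (P23 (pi3 x q)))))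
    = T (Yc m 0 wv) - ((m + 1)%:~R *: Yc (m + 1) 0 wv - Yc (m + 1) 0 (S wv)).
  by rewrite iterS -/wv Yc_T Yc_1 scale1r -[X in X - _]addrA addrK.
have -> : S wv = iter i TR (iter k.+1 S (Y1 n 0 (P23 (pi3 x q)))).
  by rewrite /wv iterS; apply: (iter_intertwine (h := S)) => z; rewrite STR.
rewrite !IH (linear_sum T) /= scaler_sumr -!sumrB.
transitivity (\sum_(l < i.+1) (falling i l *: E l - (falling i l * l.+1%:R) *: E l.+1)).
  apply: eq_bigr => l _; have lel : (l <= i)%N by rewrite -ltnS.
  congr (_ - _).
    by rewrite lhom_scale -iterS /E subSn.
  have e1 (a c : K) v : a *: (c *: v) = c *: (a *: v) :> V by rewrite !scalerA mulrC.
  rewrite e1 -scalerBr -[RHS]scalerA; congr (_ *: _).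
  rewrite /E subSS -!iter_scale -iter_sub; congr (iter _ _ _).
  have -> : m + 1 + l%:Z = m + l.+1%:Z by lia.
  rewrite -(klin_nat (AA_klin _ _)) [l.+1%:R * _]mulrA /b rbinS.
  rewrite -(klin_int (AA_klin _ _) (m + 1)) -(klinB (AA_klin _ _)); congr (AA _ _ _).
  have -> : (m + l.+1%:Z)%:~R = (m + 1)%:~R + l%:R :> poly3 K.
    by rewrite -[l%:R]/(l%:Z%:~R) -intrD; congr (_%:~R); lia.
  rewrite exprS. ring.
rewrite sumrB; have step l : falling i.+1 l.+1 = falling i l.+1 - falling i l * l.+1%:R.
  have le : (i ^_ l.+1 + l.+1 * i ^_ l = i.+1 ^_ l.+1)%N.
    rewrite ffactSS ffactnSr mulnC -mulnDl; have [lel|lt] := leqP l i; last by rewrite ffact_small // !muln0.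
    by congr (_ * _)%N; lia.
  by rewrite /falling -le natrD natrM exprS; ring.
rewrite [RHS]big_ord_recl [X in X - _]big_ord_recl.
rewrite [X in _ = X + _](_ : _ = falling i 0 *: E 0%N); last first.
  by rewrite /falling !ffactn0 /E.
rewrite -addrA; congr (_ + _); rewrite [RHS](_ : _ = \sum_(l < i.+1)
   (falling i l.+1 *: E l.+1 - (falling i l * l.+1%:R) *: E l.+1)); last first.
  by apply: eq_bigr => l _; rewrite !lift0 step scalerBl.
rewrite sumrB; congr (_ - _); rewrite big_ord_recr /= /falling ffact_small //.
by rewrite mulr0 scale0r addr0.
Qed.

Let uniform_trunc k (h : lhom V3 V3) :
  exists d : nat, forall n q, n < - d%:Z -> Y1 n k (h (pi3 x q)) = 0.
Proof.
have [||y|d hd] := @pi3_uniform _ _ _ _ _ S12_S13 S12_S23 S13_S23 nil12 nil13 nil23 x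
  (fun d y => forall n, n < - d%:Z -> Y1 n k (h y) = 0).
- by move=> d d' y le hy n lt; apply: hy; lia.
- move=> d c y z hy hz n lt.
  by rewrite lhom_add lhom_scale lhom_add lhom_scale hy // hz // scaler0 addr0.
- exact: Y1_trunc.
- by exists d => n q; apply: hd.
Qed.

Let uniform_swap_local (h : lhom V3 V3) : exists N, forall q, swap_local N (h (pi3 x q)).
Proof.
apply: (pi3_uniform S12_S13 S12_S23 S13_S23 nil12 nil13 nil23 x (Pr := fun N y => swap_local N (h y))).
- by move=> N N' y; exact: swap_local_mono.
- by move=> N c y z hy hz; rewrite lhom_add lhom_scale; exact: swap_local_linear.
- by move=> y; exact: locality.
Qed.

(** Skew-symmetry replaces Y(b,z_2) c by e^(z_2 T) Y(c,- z_2) b, and e^(z_2 T) passes to the left of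
    Y(a,z_1) by translating z_1 to z_1 - z_2. The translated logarithm produces the power - S12 -
    S13 of 1 - z_2/z_1. *)
Let XX_AA d :
  (forall n q, n < - d%:Z -> Y1 n 0 (P23 (pi3 x q)) = 0) ->
  forall B m n q, n + d%:Z < B%:Z ->
  XX m n (pi3 x q) = \sum_(r < B) Tdiv T r (sg K (n - r%:Z) *: \sum_(l < B)
     AA (m + l%:Z) (n - r%:Z - l%:Z) (rbin iota ((m + l%:Z)%:~R - s - u) l * q)).
Proof.
move=> hd B m n q lt; rewrite {1}/XX (@Y1_skew _ _ B) => [|r le]; last by apply: hd; lia.
pose g (r l : nat) : V := Tdiv T r (sg K (n - r%:Z) *:
  AA (m + l%:Z) (n - r%:Z - l%:Z) (rbin iota ((m + l%:Z)%:~R - s - u) l * q)).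
transitivity (\sum_(r < B) \sum_(l < B) g r l); last first.
  by apply: eq_bigr => r _; rewrite scaler_sumr (linear_sum (Tdiv T r)).
rewrite (sum_triangle (g := g)) => [|r l le]; last first.
  by rewrite /g /AA /XX hd ?lhom_zero ?scaler0 ?linear0 //; lia.
rewrite (linear_sum (Yc m 0)) /=; apply: eq_bigr => r _.
have := Y_iter_TR (n - r%:Z) r 0 m q; rewrite /= => e.
rewrite lhom_scale /Tdiv lhom_scale e !scaler_sumr; apply: eq_bigr => l _.
have lel : (l <= r)%N by rewrite -ltnS.
have -> : n - r%:Z = n - (r - l)%N%:Z - l%:Z by lia.
rewrite /g TdivZ /Tdiv !scalerA expr0 mul1r [- (s + u)]opprD [_ + (- s - u)]addrA.
congr (_ *: _); rewrite sgB sg_nat /falling.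
have f : (r`!%:R)^-1 * (r ^_ l)%:R = ((r - l)`!%:R)^-1 :> K.
  rewrite -(ffact_fact lel) natrM invfM mulrC mulrA divff ?mul1r //.
  by rewrite pnatr_eq0 -lt0n ffact_gt0.
have sq : (-1) ^+ l * (-1) ^+ l = 1 :> K by rewrite -exprMn mulrNN mulr1 expr1n.
rewrite -f; transitivity (sg K (n - (r - l)%N%:Z) * ((-1) ^+ l * (-1) ^+ l)
   * (r`!%:R^-1 * (r ^_ l)%:R)); first by ring.
by rewrite sq mulr1.
Qed.

(* Y(a,z)_(n) Y(b,z) = Y(a_(n) b, z) *)
Theorem nprod_formula (n : int) : exists N0, forall N, (N0 <= N)%N -> forall p k,
  diag (D_z1_div (N%:Z - 1 - n) (iter N (@mul_z12 K V) (braided_prod x))) p k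
  = Yc p k (M1 (- n - 1) x).
Proof.
have [M hM] := uniform_swap_local P23.
have [d1 h1] := Y1_pi3_trunc 0 x; have [d2 h2] := uniform_trunc 0 P23.
have [d3 h3] := uniform_trunc 0 (comphom P12 P23).
(* The residue computation asks for [d <= N], and the summand |n| makes the order N - 1 - n of the
   derivative nonnegative. *)
pose d := (d1 + d2 + d3)%N; exists (d + `|n|).+1 => N leN p k.
have [j Ej] : exists j : nat, N%:Z - 1 - n = j%:Z by exists `|(N%:Z - 1 - n)%R|%N; lia.
pose BB m n q := XX m n (P12 (P23 (pi3 x q))).
have BB_klin a b : klin iota (BB a b).
  split=> [q q'|c q]; rewrite /BB /XX.
    by rewrite pi3_add !lhom_add.
  by rewrite pi3_scale // !lhom_scale.
have tX : trunc d (fun m n q => XX m n (pi3 x q)).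
  by move=> a b q lt; rewrite /XX h1 ?lhom_zero //; move: lt; rewrite /d; lia.
have tA : trunc d AA by move=> a b q lt; rewrite /AA /XX h2 ?lhom_zero //; move: lt; rewrite /d; lia.
have tB : trunc d BB.
  move=> a b q lt; rewrite /BB /XX.
  have -> : Y1 b 0 (P12 (P23 (pi3 x q))) = 0 by apply: h3; move: lt; rewrite /d; lia.
  by rewrite lhom_zero.
have EA a b q : braided_prod (P23 (pi3 x q)) a b 0 0 = Eser iota u AA a b q.
  rewrite braided_prod00; apply: eq_fsbigr => i _; congr (XX _ _ _).
  by rewrite (pi3_cc _ _ (pi_u _)) (opc_intertwine _ _ P23_S13).
have EB a b q : braided_prod (P12 (P23 (pi3 x q))) a b 0 0 = Eser iota u BB a b q.
  rewrite braided_prod00; apply: eq_fsbigr => i _; congr (XX _ _ _).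
  by rewrite (pi3_cc _ _ (pi_u _)) (opc_intertwine _ _ P23_S13) (opc_intertwine _ _ P12_S12).
have AB a b q : iter M (@mz _ _ _) (Eser iota u AA) a b q
    = (-1) ^+ M *: iter M (@mz _ _ _) (Eser iota u BB) b a q.
  rewrite -(@iter_mul_z12_mz _ _ _ M (braided_prod (P23 (pi3 x q))) _ _ 0 0) // hM.
  rewrite (iter_mul_z12_swap12 M (braided_prod (P12 _))); congr (_ *: _).
  by apply: iter_mul_z12_mz.
have hd n' q : n' < - d%:Z -> Y1 n' 0 (P23 (pi3 x q)) = 0.
  by move=> lt; apply: h2; move: lt; rewrite /d; lia.
have XA := XX_AA hd.
have leN' : (d <= N)%N by lia.
pose y := Y1 (j%:Z - N%:Z) 0 (P12 (P23 (pi3 x (dpow (w + u) k)))).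
have [dy hy] := Yc_trunc 0 y.
pose B := (`|(p + j%:Z + M%:Z + d%:Z)%R| + `|p| + dy).+1.
have GQ a b k1 k2 : iter N (@mul_z12 K V) (braided_prod x) a b k1 k2
    = iter N (@mz _ _ _) (Eser iota s (F x)) a b (dpow u k1 * dpow w k2).
  apply: iter_mul_z12_mz => a' b'; rewrite -{1}[x](pi3_1 S12 S13 S23) braided_prod_pi3.
  apply: eq_fsbigr => i _; rewrite D_F; congr (F x _ _ _).
  by rewrite mulr1 mulrCA.
have Fq a b : klin iota (iter N (@mz _ _ _) (Eser iota s (F x)) a b).
  apply: iter_mz_klin => {}a {}b; apply: (@Eser_klin _ _ _ _ d); first exact: tX.
  by move=> a' b'; exact: F_klin.
rewrite Ej (@diag_residue _ _ _ iota u w _ _ Fq GQ).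
rewrite (@residue_assoc _ _ iota _ d s u AA tA AA_klin _ (Tdiv T : nat -> {linear V -> V})
   tX XA M N BB tB BB_klin AB leN' p j B); last by rewrite /B; lia.
(* The translates form the right side of skew-symmetry for [y], in which a_(n) b stands in the
   second place; exchanging moves it to the first. *)
transitivity (Yc p 0 (P y)).
  rewrite (@skew_symmetry0 y _ B) => [|r le]; last by apply: hy; rewrite /B in le; lia.
  by [].
rewrite /y P_Y1; have -> : j%:Z - N%:Z = - n - 1 by lia.
(* The logarithm of the field of a_(n) b is governed by S, that is by S13 + S23 before the product,
   which agrees with [dpow (w + u) k]. *)
rewrite [RHS]Y_log_terms Y_iter_S_M1 -!lhom_scale; congr (Yc _ _ (M1 _ _)).
rewrite -[dpow _ _]mulr1 dpowE -mulrA pi3_scale //; congr (_ *: _).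
rewrite -[x in RHS](pi3_1 S12 S13 S23) ; apply: pi3_exp => q.
by rewrite mulrDl pi3_add pi_w pi_u // /S1323 addrC.
Qed.

End TripleFamily.
End Products.

(** * Tensor products of superspaces *)

Section TensorMaps.
Variable K : fieldType.
Implicit Types U W X Z : lmodType K.

Lemma tens_generated U W (Pr : tens U W -> Prop) :
  (forall c x y, Pr x -> Pr y -> Pr (c *: x + y)) ->
  (forall u w, Pr (tpure u w)) -> forall x, Pr x.
Proof.
move=> lin pure x; rewrite -(tmk_repr x) tmkE.
have Pr0 : Pr 0.
  have -> : 0 = -1 *: tpure 0 0 + tpure 0 0 :> tens U W by rewrite scaleN1r addNr.
  exact: lin.
by apply: (big_ind Pr) => // y z hy hz; rewrite -[y]scale1r; exact: lin.
Qed.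

Lemma tens_ext U W X (f g : tens U W -> X) : linear f -> linear g ->
  (forall u w, f (tpure u w) = g (tpure u w)) -> f =1 g.
Proof.
move=> lf lg h; apply: tens_generated => // c x y hx hy.
by rewrite lf lg hx hy.
Qed.

Lemma linear_comp_lin U W X (f : U -> W) (g : W -> X) :
  linear f -> linear g -> linear (g \o f).
Proof. by move=> lf lg c x y; rewrite /= lf lg. Qed.

Lemma lin0 U W (f : U -> W) : linear f -> f 0 = 0.
Proof. by move=> lf; exact: (linear0 (mkhom lf)). Qed.

Lemma linZ U W (f : U -> W) c x : linear f -> f (c *: x) = c *: f x.
Proof. by move=> lf; exact: (lhom_scale (mkhom lf)). Qed.

Lemma linD U W (f : U -> W) x y : linear f -> f (x + y) = f x + f y.
Proof. by move=> lf; exact: (lhom_add (mkhom lf)). Qed.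

Lemma linsum U W (f : U -> W) I (r : seq I) (Q : pred I) (g : I -> U) : linear f ->
  f (\sum_(i <- r | Q i) g i) = \sum_(i <- r | Q i) f (g i).
Proof. by move=> lf; exact: (lhom_sum (mkhom lf)). Qed.

Lemma bilin_tmap U U' W W' (f : U -> U') (g : W -> W') : linear f -> linear g ->
  bilin (fun u w => tpure (f u) (g w)).
Proof.
move=> lf lg; split=> [w|u] c x y /=.
  by rewrite lf tpure_linl.
by rewrite lg tpure_linr.
Qed.

Lemma tmap_lin U U' W W' (f : U -> U') (g : W -> W') : linear f -> linear g ->
  linear (tmap f g).
Proof. by move=> lf lg; apply/tlift_linear/bilin_tmap. Qed.

Lemma tmap_tpure U U' W W' (f : U -> U') (g : W -> W') u w : linear f -> linear g ->
  tmap f g (tpure u w) = tpure (f u) (g w).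
Proof. by move=> lf lg; apply/tlift_tpure/bilin_tmap. Qed.

Lemma id_lin U : linear (@id U). Proof. by []. Qed.

Lemma tmap_comp U U' U'' W W' W'' (f : U -> U') (f' : U' -> U'') (g : W -> W')
    (g' : W' -> W'') : linear f -> linear f' -> linear g -> linear g' ->
  forall x, tmap f' g' (tmap f g x) = tmap (f' \o f) (g' \o g) x.
Proof.
move=> lf lf' lg lg'; apply: tens_ext => [||u w].
- by apply: (linear_comp_lin (tmap_lin lf lg)); apply: tmap_lin.
- by apply: tmap_lin; apply: linear_comp_lin.
- by rewrite !tmap_tpure //; apply: linear_comp_lin.
Qed.

Lemma tmap_id U W (f : U -> U) (g : W -> W) : f =1 id -> g =1 id -> tmap f g =1 id.
Proof.
move=> /funext -> /funext -> ; apply: tens_ext => [||u w //]; first exact: tmap_lin.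
  exact: id_lin.
by rewrite tmap_tpure.
Qed.

Lemma linear_combo U W (f g : U -> W) c : linear f -> linear g ->
  linear (fun t => c *: f t + g t).
Proof.
move=> lf lg a x y; rewrite lf lg !scalerDr !scalerA [a * c]mulrC.
exact: addrACA.
Qed.

Lemma bilin_tassoc U W X (x : X) : bilin (fun (u : U) (w : W) => tpure u (tpure w x)).
Proof.
split=> [w|u] c y z; first by rewrite tpure_linl.
by rewrite tpure_linl tpure_linr.
Qed.

Lemma bilin_tassoc2 U W X : bilin (fun (t : tens U W) (x : X) =>
  tlift (fun u w => tpure u (tpure w x)) t).
Proof.
split=> [x|t]; first exact/tlift_linear/bilin_tassoc.
move=> c x y; move: t; apply: tens_ext => [||u w].
- exact/tlift_linear/bilin_tassoc.
- apply: linear_combo; exact/tlift_linear/bilin_tassoc.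
- rewrite !tlift_tpure; [|exact: bilin_tassoc..].
  by rewrite !tpure_linr.
Qed.

Lemma tassoc_lin U W X : linear (@tassoc K U W X).
Proof. exact/tlift_linear/bilin_tassoc2. Qed.

Lemma tassoc_tpure U W X (u : U) (w : W) (x : X) :
  tassoc (tpure (tpure u w) x) = tpure u (tpure w x).
Proof.
rewrite /tassoc tlift_tpure; last exact: bilin_tassoc2.
by rewrite tlift_tpure //; exact: bilin_tassoc.
Qed.

Lemma bilin_tassocV U W X (u : U) : bilin (fun (w : W) (x : X) => tpure (tpure u w) x).
Proof.
split=> [x|w] c y z; last by rewrite tpure_linr.
by rewrite tpure_linr tpure_linl.
Qed.

Lemma bilin_tassocV2 U W X : bilin (fun (u : U) (t : tens W X) =>
  tlift (fun w x => tpure (tpure u w) x) t).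
Proof.
split=> [t|u]; last exact/tlift_linear/bilin_tassocV.
move=> c x y; move: t; apply: tens_ext => [||w z].
- exact/tlift_linear/bilin_tassocV.
- apply: linear_combo; exact/tlift_linear/bilin_tassocV.
- rewrite !tlift_tpure; [|exact: bilin_tassocV..].
  by rewrite !tpure_linl.
Qed.

Lemma tassocV_lin U W X : linear (@tassocV K U W X).
Proof. exact/tlift_linear/bilin_tassocV2. Qed.

Lemma tassocV_tpure U W X (u : U) (w : W) (x : X) :
  tassocV (tpure u (tpure w x)) = tpure (tpure u w) x.
Proof.
rewrite /tassocV tlift_tpure; last exact: bilin_tassocV2.
by rewrite tlift_tpure //; exact: bilin_tassocV.
Qed.

Lemma tens3_ext U W X Z (f g : tens (tens U W) X -> Z) : linear f -> linear g ->
  (forall u w x, f (tpure (tpure u w) x) = g (tpure (tpure u w) x)) -> f =1 g.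
Proof.
move=> lf lg h; apply: tens_ext => // t x; move: t; apply: tens_ext => // [c y z|c y z].
  by rewrite tpure_linl lf.
by rewrite tpure_linl lg.
Qed.

Lemma tassocVK U W X : cancel (@tassocV K U W X) (@tassoc K U W X).
Proof.
apply: tens_ext => [||u t]; first by move=> c x y; rewrite tassocV_lin tassoc_lin.
  exact: id_lin.
move: t; apply: tens_ext => [||w x].
- by move=> c x y; rewrite tpure_linr tassocV_lin tassoc_lin.
- exact: tpure_linr.
- by rewrite tassocV_tpure tassoc_tpure.
Qed.

Lemma tassocK U W X : cancel (@tassoc K U W X) (@tassocV K U W X).
Proof.
apply: tens3_ext => [||u w x]; first by move=> c y z; rewrite tassoc_lin tassocV_lin.
  exact: id_lin.
by rewrite tassoc_tpure tassocV_tpure.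
Qed.

End TensorMaps.

Section SuperTensor.
Variable K : fieldType.

Section Parity.
Variable U : superType K.
Implicit Types (a b : U) (p q : bool).

Lemma parity_spr p a : has_parity p (spr p a).
Proof. by rewrite /has_parity spr_proj eqxx. Qed.

Lemma spr_parity p q a : has_parity p a -> spr q a = if q == p then a else 0.
Proof. by move=> h; rewrite -{1}h spr_proj; case: ifP => // _; exact: h. Qed.

Lemma parity_ext (W : lmodType K) (f g : U -> W) : linear f -> linear g ->
  (forall p a, has_parity p a -> f a = g a) -> f =1 g.
Proof.
move=> lf lg h a; rewrite -(spr_sum a) !linD //.
by rewrite !(h _ _ (parity_spr _ _)).
Qed.

End Parity.

Lemma parity_app (U W : superType K) (f : lhom U W) p q a :
  has_parity p f -> has_parity q a -> has_parity (p (+) q) (f a).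
Proof.
move=> hf ha; rewrite /has_parity.
have -> : f a = spr (p (+) q) (f a).
  rewrite -{1}hf -[LHS]/(\sum_(q' : bool) spr (p (+) q') (f (spr q' a))).
  rewrite (bigD1 q) //= big1 ?addr0 => [|q' ne]; first by rewrite ha.
  by rewrite (spr_parity q' ha) (negbTE ne) !linear0.
exact: parity_spr.
Qed.

Lemma tens_parity_ext (U U' : superType K) (W : lmodType K) (f g : tens U U' -> W) :
  linear f -> linear g ->
  (forall p q a b, has_parity p a -> has_parity q b -> f (tpure a b) = g (tpure a b)) ->
  f =1 g.
Proof.
move=> lf lg h; apply: tens_ext => // a b; move: a.
apply: parity_ext => [c x y|c x y|p a ha].
- by rewrite tpure_linl lf.
- by rewrite tpure_linl lg.
move: b; apply: parity_ext => [c x y|c x y|q b hb].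
- by rewrite tpure_linr lf.
- by rewrite tpure_linr lg.
- exact: h ha hb.
Qed.

Lemma tens3_parity_ext (U : superType K) (W : lmodType K) (f g : tens (tens U U) U -> W) :
  linear f -> linear g ->
  (forall p q r a b c, has_parity p a -> has_parity q b -> has_parity r c ->
    f (tpure (tpure a b) c) = g (tpure (tpure a b) c)) ->
  f =1 g.
Proof.
move=> lf lg h; apply: tens_ext => // t c; move: t.
apply: tens_parity_ext => [e x y|e x y|p q a b ha hb].
- by rewrite tpure_linl lf.
- by rewrite tpure_linl lg.
move: c; apply: parity_ext => [e x y|e x y|r c hc].
- by rewrite tpure_linr lf.
- by rewrite tpure_linr lg.
- exact: h ha hb hc.
Qed.

Lemma linear_bigsum (U W : lmodType K) (I : Type) (r : seq I) (f : I -> U -> W) :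
  (forall i, linear (f i)) -> linear (fun x => \sum_(i <- r) f i x).
Proof.
move=> lf c x y; rewrite scaler_sumr -big_split; apply: eq_bigr => i _; exact: lf.
Qed.

Lemma linear_scaled (U W : lmodType K) (f : U -> W) e :
  linear f -> linear (fun x => e *: f x).
Proof. by move=> lf c x y; rewrite lf scalerDr !scalerA [e * c]mulrC. Qed.

Lemma bilin_sswap (U : superType K) : bilin (fun a b : U => \sum_(p : bool) \sum_(q : bool)
    (-1) ^+ (p && q) *: tpure (spr q b) (spr p a)).
Proof.
split=> [b|a]; apply: linear_bigsum => p; apply: linear_bigsum => q;
  apply: linear_scaled => c x y; rewrite linearP.
  by rewrite tpure_linr.
by rewrite tpure_linl.
Qed.

Lemma sswap_lin (U : superType K) : linear (@sswap K U).
Proof. exact/tlift_linear/bilin_sswap. Qed.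

Lemma sswap_tpure (U : superType K) p q (a b : U) : has_parity p a -> has_parity q b ->
  sswap (tpure a b) = (-1) ^+ (p && q) *: tpure b a.
Proof.
move=> ha hb; rewrite /sswap tlift_tpure; last exact: bilin_sswap.
rewrite (bigD1 p) //= [X in _ + X]big1 ?addr0 => [|p' ne]; last first.
  apply: big1 => q' _; rewrite (spr_parity p' ha) (negbTE ne).
  by rewrite (lin0 (tpure_linr _)) scaler0.
rewrite (bigD1 q) //= big1 ?addr0 => [|q' ne]; first by rewrite ha hb.
by rewrite (spr_parity q' hb) (negbTE ne) (lin0 (tpure_linl _)) scaler0.
Qed.

Lemma signb_sq (e : bool) : (-1) ^+ e * (-1) ^+ e = 1 :> K.
Proof. by case: e; rewrite /= ?mulrNN mulr1. Qed.

Lemma sswapK (U : superType K) : involutive (@sswap K U).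
Proof.
apply: tens_parity_ext => [c x y|c x y //|p q a b ha hb].
  by rewrite !sswap_lin.
rewrite (sswap_tpure ha hb) (linZ _ _ (@sswap_lin U)) (sswap_tpure hb ha).
by rewrite scalerA andbC signb_sq scale1r.
Qed.

Lemma sswap_tmap (U U' : superType K) (f : U -> U') : linear f ->
  (forall p a, has_parity p a -> has_parity p (f a)) ->
  forall x, sswap (tmap f f x) = tmap f f (sswap x).
Proof.
move=> lf hf; apply: tens_parity_ext => [c x y|c x y|p q a b ha hb].
- by rewrite (tmap_lin lf lf) sswap_lin.
- by rewrite sswap_lin (tmap_lin lf lf).
rewrite (sswap_tpure ha hb) (linZ _ _ (tmap_lin lf lf)) !tmap_tpure //.
by rewrite (sswap_tpure (hf _ _ ha) (hf _ _ hb)).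
Qed.

Lemma bilin_stens (U U' W W' : superType K) (phi : lhom U U') (psi : lhom W W') :
  bilin (fun a b => \sum_(p : bool) \sum_(q : bool)
    (-1) ^+ (p && q) *: tpure (phi (spr p a)) ((spr q psi : lhom W W') b)).
Proof.
split=> [b|a]; apply: linear_bigsum => p; apply: linear_bigsum => q;
  apply: linear_scaled => c x y.
  by rewrite (spr_linear p) (lhomP phi) tpure_linl.
by rewrite (lhomP (spr q psi : lhom W W')) tpure_linr.
Qed.

Lemma stens_lin (U U' W W' : superType K) (phi : lhom U U') (psi : lhom W W') :
  linear (stens phi psi).
Proof. exact/tlift_linear/bilin_stens. Qed.

Lemma sum_bool2 (W : zmodType) (F : bool -> bool -> W) p q :
  (forall p' q', (p' != p) || (q' != q) -> F p' q' = 0) ->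
  \sum_(p' : bool) \sum_(q' : bool) F p' q' = F p q.
Proof.
move=> h; rewrite !big_bool /=; case: p q h => [] [] h.
- by rewrite [F true false]h // [F false true]h // [F false false]h // !addr0.
- by rewrite [F true true]h // [F false true]h // [F false false]h // !addr0 add0r.
- by rewrite [F true true]h // [F true false]h // [F false false]h // !addr0 add0r.
- by rewrite [F true true]h // [F true false]h // [F false true]h // !add0r.
Qed.

Lemma stens_tpure (U U' W W' : superType K) (phi : lhom U U') (psi : lhom W W') p q a b :
  has_parity p a -> has_parity q psi ->
  stens phi psi (tpure a b) = (-1) ^+ (p && q) *: tpure (phi a) (psi b).
Proof.
move=> ha hp; rewrite /stens tlift_tpure; last exact: bilin_stens.
rewrite (@sum_bool2 _ (fun p' q' => (-1) ^+ (p' && q')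
   *: tpure (phi (spr p' a)) ((spr q' psi : lhom W W') b)) p q) ?ha ?hp // => p' q'.
case/orP=> /negbTE ne.
  by rewrite (spr_parity p' ha) ne lhom_zero (lin0 (tpure_linl _)) scaler0.
by rewrite (spr_parity q' hp) ne (lin0 (tpure_linr _)) scaler0.
Qed.

End SuperTensor.

(** * Legs of an operator and signed permutations of three factors *)

Section Legs.
Variable K : fieldType.
Variable U : superType K.
Implicit Types (S : tens U U -> tens U U) (x : tens (tens U U) U).

Lemma leg12_lin S : linear S -> linear (leg12 S).
Proof. by move=> lS; apply: tmap_lin => //; exact: id_lin. Qed.

Lemma leg23_lin S : linear S -> linear (leg23 S).
Proof.
move=> lS c x y; rewrite /leg23 tassoc_lin (tmap_lin (@id_lin _ _) lS).
by rewrite tassocV_lin.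
Qed.

Lemma leg13_lin S : linear S -> linear (leg13 S).
Proof.
move=> lS c x y; rewrite /leg13 (leg23_lin (@sswap_lin _ U)) (leg12_lin lS).
by rewrite (leg23_lin (@sswap_lin _ U)).
Qed.

Lemma leg12_tpure S t c : linear S -> leg12 S (tpure t c) = tpure (S t) c.
Proof. by move=> lS; rewrite /leg12 tmap_tpure //; exact: id_lin. Qed.

Lemma leg23_tpure S a b c : linear S ->
  leg23 S (tpure (tpure a b) c) = tassocV (tpure a (S (tpure b c))).
Proof. by move=> lS; rewrite /leg23 tassoc_tpure tmap_tpure //; exact: id_lin. Qed.

Lemma leg12_comp S S' x : linear S -> linear S' -> leg12 S (leg12 S' x) = leg12 (S \o S') x.
Proof. by move=> lS lS'; rewrite /leg12 tmap_comp //; exact: id_lin. Qed.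

Lemma leg23_comp S S' x : linear S -> linear S' -> leg23 S (leg23 S' x) = leg23 (S \o S') x.
Proof. by move=> lS lS'; rewrite /leg23 tassocVK tmap_comp //; exact: id_lin. Qed.

Lemma leg12_swapK : involutive (leg12 (@sswap K U)).
Proof.
move=> x; rewrite leg12_comp; [|exact: sswap_lin..].
by apply: tmap_id => // t; exact: sswapK.
Qed.

Lemma leg23_swapK : involutive (leg23 (@sswap K U)).
Proof.
move=> x; rewrite leg23_comp; [|exact: sswap_lin..].
by rewrite /leg23 tmap_id ?tassocK // => t; exact: sswapK.
Qed.

Lemma leg23_leg13 S x : leg23 (@sswap K U) (leg13 S x) = leg12 S (leg23 (@sswap K U) x).
Proof. by rewrite /leg13 leg23_swapK. Qed.

Lemma leg23_leg12 S x : leg23 (@sswap K U) (leg12 S x) = leg13 S (leg23 (@sswap K U) x).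
Proof. by rewrite /leg13 leg23_swapK. Qed.

Lemma leg12_commute S S' x : linear S -> linear S' -> (forall t, S (S' t) = S' (S t)) ->
  leg12 S (leg12 S' x) = leg12 S' (leg12 S x).
Proof.
move=> lS lS' h; rewrite !leg12_comp //; congr (leg12 _ x).
by apply: funext => t /=.
Qed.

Lemma leg23_commute S S' x : linear S -> linear S' -> (forall t, S (S' t) = S' (S t)) ->
  leg23 S (leg23 S' x) = leg23 S' (leg23 S x).
Proof.
move=> lS lS' h; rewrite !leg23_comp //; congr (leg23 _ x).
by apply: funext => t /=.
Qed.

Lemma leg12_sum (I : Type) (r : seq I) (F : I -> tens U U -> tens U U) x :
  (forall i, linear (F i)) ->
  leg12 (fun t => \sum_(i <- r) F i t) x = \sum_(i <- r) leg12 (F i) x.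
Proof.
move=> lF; move: x; apply: tens_ext => [||t c].
- exact/leg12_lin/linear_bigsum.
- by apply: linear_bigsum => i; exact: leg12_lin.
rewrite leg12_tpure; last exact: linear_bigsum.
rewrite (linsum _ _ _ (tpure_linl c)); apply: eq_bigr => i _.
by rewrite leg12_tpure.
Qed.

Lemma leg23_sum (I : Type) (r : seq I) (F : I -> tens U U -> tens U U) x :
  (forall i, linear (F i)) ->
  leg23 (fun t => \sum_(i <- r) F i t) x = \sum_(i <- r) leg23 (F i) x.
Proof.
move=> lF; move: x; apply: tens3_ext => [||a b c].
- exact/leg23_lin/linear_bigsum.
- by apply: linear_bigsum => i; exact: leg23_lin.
rewrite leg23_tpure; last exact: linear_bigsum.
rewrite (linsum _ _ _ (tpure_linr a)) (linsum _ _ _ (@tassocV_lin _ _ _ _)).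
by apply: eq_bigr => i _; rewrite leg23_tpure.
Qed.

Lemma leg13_sum (I : Type) (r : seq I) (F : I -> tens U U -> tens U U) x :
  (forall i, linear (F i)) ->
  leg13 (fun t => \sum_(i <- r) F i t) x = \sum_(i <- r) leg13 (F i) x.
Proof.
move=> lF; rewrite /leg13 leg12_sum //.
by rewrite (linsum _ _ _ (leg23_lin (@sswap_lin _ U))).
Qed.

Lemma opsum_lin (s : seq (lhom U U * lhom U U)) : linear (opsum s).
Proof. by apply: linear_bigsum => f; exact: stens_lin. Qed.

Lemma even_endo2_lin S : even_endo2 S -> linear S.
Proof. by case=> s _ hs c x y; rewrite !hs opsum_lin. Qed.

(** On its way to c the factor g passes both a and b, whence the sign. *)
Lemma leg13_stens_tpure (f g : lhom U U) r p q p' a b c :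
  has_parity r f -> has_parity r g ->
  has_parity p a -> has_parity q b -> has_parity p' c ->
  leg13 (stens f g) (tpure (tpure a b) c)
  = (-1) ^+ ((p (+) q) && r) *: tpure (tpure (f a) b) (g c).
Proof.
move=> hf hg ha hb hc; rewrite /leg13.
have lsw := leg23_lin (@sswap_lin _ U); have lS := stens_lin f g.
have sw (u v w : U) e e' : has_parity e v -> has_parity e' w ->
    leg23 (@sswap K U) (tpure (tpure u v) w) = (-1) ^+ (e && e') *: tpure (tpure u w) v.
  move=> hv hw; rewrite leg23_tpure; last exact: sswap_lin.
  rewrite (sswap_tpure hv hw) (linZ _ _ (tpure_linr u)) (linZ _ _ (@tassocV_lin _ _ _ _)).
  by rewrite tassocV_tpure.
rewrite (sw _ _ _ _ _ hb hc) (linZ _ _ (leg12_lin lS)) leg12_tpure //.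
rewrite (stens_tpure _ _ ha hg) (linZ _ _ (tpure_linl b)) !(linZ _ _ lsw).
rewrite (sw _ _ _ _ _ (parity_app hg hc) hb) !scalerA -!signr_addb.
by congr ((-1) ^+ _ *: _); case: p q r p' {ha hb hc hf hg} => [] [] [] [].
Qed.

Lemma leg12_leg13_stens (f g : lhom U U) r x : has_parity r f -> has_parity r g ->
  leg12 (@sswap K U) (leg13 (stens f g) x) = leg23 (stens f g) (leg12 (@sswap K U) x).
Proof.
move=> hf hg; move: x; have lS := stens_lin f g.
have l12 := leg12_lin (@sswap_lin _ U); have l13 := leg13_lin lS.
have l23 := leg23_lin lS.
apply: tens3_parity_ext => [c x y|c x y|p q p' a b c ha hb hc].
- by rewrite l13 l12.
- by rewrite l12 l23.
rewrite (leg13_stens_tpure hf hg ha hb hc) (linZ _ _ l12).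
rewrite !leg12_tpure; [|exact: sswap_lin..].
rewrite (sswap_tpure (parity_app hf ha) hb) (sswap_tpure ha hb).
rewrite !(linZ _ _ (tpure_linl _)) (linZ _ _ l23) leg23_tpure //.
rewrite (stens_tpure _ _ ha hg) (linZ _ _ (tpure_linr _)) (linZ _ _ (@tassocV_lin _ _ _ _)).
rewrite tassocV_tpure !scalerA -!signr_addb.
by congr ((-1) ^+ _ *: _); case: p q r {ha hb hf hg} => [] [] [].
Qed.

(** Evenness of S supplies homogeneous factors of equal parity, for which the sign of moving b past
    f a makes up for that of moving g past b. *)
Lemma leg12_leg13 S x : even_endo2 S ->
  leg12 (@sswap K U) (leg13 S x) = leg23 S (leg12 (@sswap K U) x).
Proof.
case=> s hs /funext ->; rewrite leg13_sum => [|f]; last exact: stens_lin.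
rewrite (linsum _ _ _ (leg12_lin (@sswap_lin _ U))) leg23_sum => [|f]; last exact: stens_lin.
rewrite big_seq [RHS]big_seq; apply: eq_bigr => f /hs[p [h1 h2]].
exact: leg12_leg13_stens h1 h2.
Qed.

Lemma leg12_leg23 S x : even_endo2 S ->
  leg12 (@sswap K U) (leg23 S x) = leg13 S (leg12 (@sswap K U) x).
Proof. by move=> hS; rewrite -{1}[x]leg12_swapK -leg12_leg13 // leg12_swapK. Qed.

End Legs.

Section LegMorphisms.
Variables (K : fieldType) (U U' : superType K) (h : U -> U').
Hypothesis lh : linear h.
Variables (S : tens U U -> tens U U) (S' : tens U' U' -> tens U' U').
Hypothesis lS : linear S.
Hypothesis lS' : linear S'.
Hypothesis hS : forall t, tmap h h (S t) = S' (tmap h h t).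
Local Notation h3 := (tmap (tmap h h) h).

Let lh2 : linear (tmap h h). Proof. exact: tmap_lin. Qed.
Let lh3 : linear h3. Proof. exact: tmap_lin. Qed.

Lemma leg12_tmap x : h3 (leg12 S x) = leg12 S' (h3 x).
Proof.
move: x; apply: tens_ext => [c x y|c x y|t c].
- by rewrite (leg12_lin lS) lh3.
- by rewrite lh3 (leg12_lin lS').
by rewrite leg12_tpure // !tmap_tpure // leg12_tpure // hS.
Qed.

Lemma tmap_tassocV a t : h3 (tassocV (tpure a t)) = tassocV (tpure (h a) (tmap h h t)).
Proof.
move: t; apply: tens_ext => [c x y|c x y|b c].
- by rewrite tpure_linr tassocV_lin lh3.
- by rewrite lh2 tpure_linr tassocV_lin.
by rewrite tassocV_tpure !tmap_tpure // tassocV_tpure.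
Qed.

Lemma leg23_tmap x : h3 (leg23 S x) = leg23 S' (h3 x).
Proof.
move: x; apply: tens3_ext => [c x y|c x y|a b c].
- by rewrite (leg23_lin lS) lh3.
- by rewrite lh3 (leg23_lin lS').
by rewrite leg23_tpure // tmap_tassocV hS !tmap_tpure // leg23_tpure.
Qed.

End LegMorphisms.

Lemma leg13_tmap (K : fieldType) (U U' : superType K) (h : U -> U')
    (S : tens U U -> tens U U) (S' : tens U' U' -> tens U' U') x :
  linear h -> (forall p a, has_parity p a -> has_parity p (h a)) ->
  linear S -> linear S' -> (forall t, tmap h h (S t) = S' (tmap h h t)) ->
  tmap (tmap h h) h (leg13 S x) = leg13 S' (tmap (tmap h h) h x).
Proof.
move=> lh ph lS lS' hS.
have sw t : tmap h h (sswap t) = sswap (tmap h h t) by rewrite sswap_tmap.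
have swl := @sswap_lin K U; have swl' := @sswap_lin K U'.
by rewrite /leg13 (leg23_tmap lh swl swl' sw) (leg12_tmap lh lS lS' hS) (leg23_tmap lh swl swl' sw).
Qed.

Lemma parity_hom (K : fieldType) (U W : superType K) p (f : lhom U W) :
  (forall q a, has_parity q a -> has_parity (p (+) q) (f a)) -> has_parity p f.
Proof.
move=> h; apply: lhom_ext => u.
rewrite -[LHS]/(\sum_(q : bool) spr (p (+) q) (f (spr q u))).
rewrite -[in RHS](spr_sum u) (lhom_add f) big_bool /= addrC; congr (_ + _).
  exact: (h false _ (parity_spr false u)).
exact: (h true _ (parity_spr true u)).
Qed.

Lemma tmap_stens (K : fieldType) (U U' : superType K) (h : U -> U')
    (f g : lhom U U) (F G : lhom U' U') r :
  linear h -> (forall p a, has_parity p a -> has_parity p (h a)) ->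
  has_parity r g -> has_parity r G ->
  (forall a, h (f a) = F (h a)) -> (forall a, h (g a) = G (h a)) ->
  forall t, tmap h h (stens f g t) = stens F G (tmap h h t).
Proof.
move=> lh ph hg hG hf hg'; have lh2 := tmap_lin lh lh.
apply: tens_parity_ext => [c x y|c x y|p q a b ha hb].
- by rewrite stens_lin lh2.
- by rewrite lh2 stens_lin.
rewrite (stens_tpure _ _ ha hg) (linZ _ _ lh2) !tmap_tpure // hf hg'.
by rewrite (stens_tpure _ _ (ph _ _ ha) hG).
Qed.

Lemma stens_even (K : fieldType) (U U' W W' : superType K) (f : lhom U U') (g : lhom W W') :
  has_parity false g -> stens f g =1 tmap f g.
Proof.
move=> hg; apply: tens_parity_ext => [||p q a b ha hb]; first exact: stens_lin.
  exact: tmap_lin (lhomP f) (lhomP g).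
rewrite (stens_tpure _ _ ha hg) andbF expr0 scale1r.
by rewrite (tmap_tpure _ _ (lhomP f) (lhomP g)).
Qed.

Lemma idhom_even (K : fieldType) (U : superType K) : has_parity false (idhom U).
Proof. by apply: parity_hom => q a; rewrite addFb. Qed.

Section LocallyNilpotent.
Variables (K : numFieldType) (W : lmodType K) (f : W -> W).
Hypothesis lf : linear f.

Lemma iter_lin k : linear (iter k f).
Proof. exact: (iter_linear (mkhom lf)). Qed.

Lemma iter_eq0_mono r r' x : (r <= r')%N -> iter r f x = 0 -> iter r' f x = 0.
Proof. by move=> le h; rewrite -(subnK le) iterD h (lin0 (iter_lin _)). Qed.

Lemma nil_combo c x y : (exists r, iter r f x = 0) -> (exists r, iter r f y = 0) ->
  exists r, iter r f (c *: x + y) = 0.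
Proof.
move=> [r hr] [r' hr']; exists (maxn r r'); rewrite iter_lin.
rewrite (iter_eq0_mono (leq_maxl r r') hr) (iter_eq0_mono (leq_maxr r r') hr').
by rewrite scaler0 addr0.
Qed.

End LocallyNilpotent.

Lemma nil_conjugate (K : numFieldType) (W : lmodType K) (f g h : W -> W) :
  linear h -> involutive h -> (forall x, h (f x) = g (h x)) ->
  (forall x, exists r, iter r f x = 0) -> forall x, exists r, iter r g x = 0.
Proof.
move=> lh hK hfg nf x; have [r hr] := nf (h x); exists r.
by rewrite -[x]hK -(iter_intertwine r _ hfg) hr (lin0 lh).
Qed.

(** * The operator S *)

Section StateOperator.
Variables (K : numFieldType) (V : superType K) (vac : V) (T : lhom V V) (Y : lhom V (LF V)).
Variables (m : nat) (Phi Psi : 'I_m -> lhom (LF V) (LF V)).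
Hypothesis HV : log_vertex_algebra Phi Psi vac T Y.

Local Notation S := (Sop Phi Psi vac Y).
Local Notation Sh := (Shat Phi Psi).
Local Notation ev := (eval0 vac).
Local Notation YY := (tmap Y Y).
Local Notation Y3 := (tmap (tmap Y Y) Y).
Local Notation sw := (@sswap K V).

Lemma eval0_lin : linear (@eval0 K V vac).
Proof. by move=> c A B; rewrite /eval0 lhomD lserD lhomZ lserZ. Qed.
Let lY : linear Y. Proof. exact: lhomP. Qed.
Let lY2 : linear YY. Proof. exact: tmap_lin. Qed.
Lemma eval0_Y a : ev (Y a) = a.
Proof. exact: (lva_creation HV). Qed.

Lemma Y_even p a : has_parity p a -> has_parity p (Y a).
Proof. by move=> ha; have := parity_app (lva_Y_even HV) ha; rewrite addFb. Qed.

Lemma eval0_even p A : has_parity p A -> has_parity p (ev A).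
Proof.
move=> hA; have := parity_app hA (lva_vac_even HV); rewrite addbF => h.
by rewrite /has_parity /eval0 -{2}h.
Qed.

Lemma Shat_lin : linear Sh.
Proof. by apply: linear_bigsum => i; exact: stens_lin. Qed.

Definition state_op (F : lhom (LF V) (LF V)) : lhom V V :=
  mkhom (linear_comp_lin (linear_comp_lin lY (lhomP F)) eval0_lin).

Lemma state_op_parity p F : has_parity p F -> has_parity p (state_op F).
Proof.
move=> hF; apply: parity_hom => q a ha.
exact/eval0_even/(parity_app hF)/Y_even.
Qed.

(** The factors of Shat preserve the range of [Y], and there [eval0] is the inverse of [Y]. *)
Lemma Y_state_op i a : Y (state_op (Phi i) a) = Phi i (Y a) /\
  Y (state_op (Psi i) a) = Psi i (Y a).
Proof.
have [[b _ hb] [c _ hc]] := local_inv (lva_local HV) i (ex_intro2 _ _ a I erefl).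
have Ev (F : lhom (LF V) (LF V)) d : Y d = F (Y a) -> Y (state_op F a) = F (Y a).
  by move=> e; rewrite -[state_op F a]/(ev (F (Y a))) -e eval0_Y.
by split; apply: Ev; eassumption.
Qed.

Lemma tmap_eval0_Y t : tmap ev ev (YY t) = t.
Proof. by rewrite (tmap_comp lY eval0_lin lY eval0_lin); apply: tmap_id => a; exact: eval0_Y. Qed.

Lemma tmap_Y_inj : injective YY.
Proof. by move=> t t' e; rewrite -[t]tmap_eval0_Y e tmap_eval0_Y. Qed.

Lemma tmap3_Y_inj : injective Y3.
Proof.
apply: (@can_inj _ _ _ (tmap (tmap ev ev) ev)) => x.
rewrite (tmap_comp lY2 (tmap_lin eval0_lin eval0_lin) lY eval0_lin).
by apply: tmap_id => [t|a] /=; [exact: tmap_eval0_Y|exact: eval0_Y].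
Qed.

Lemma tmap_Y_stens t i : YY (stens (state_op (Phi i)) (state_op (Psi i)) t)
  = stens (Phi i) (Psi i) (YY t).
Proof.
have [r [h1 h2]] := lva_parity HV i.
apply: (tmap_stens lY _ (state_op_parity h2) h2) => [p a|a|a]; first exact: Y_even.
  by have [] := Y_state_op i a.
by have [] := Y_state_op i a.
Qed.

Lemma Sop_sum t : S t = \sum_(i < m) stens (state_op (Phi i)) (state_op (Psi i)) t.
Proof.
rewrite /Sop /Shat -[RHS]tmap_eval0_Y (linsum _ _ _ lY2).
by congr (tmap ev ev _); apply: eq_bigr => i _; rewrite tmap_Y_stens.
Qed.

Lemma tmap_Y_Sop t : YY (S t) = Sh (YY t).
Proof.
rewrite Sop_sum (linsum _ _ _ lY2) /Shat.
by apply: eq_bigr => i _; rewrite tmap_Y_stens.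
Qed.

Lemma Sop_even : even_endo2 S.
Proof.
exists [seq (state_op (Phi i), state_op (Psi i)) | i <- enum 'I_m] => [f|t].
  case/mapP => i _ ->; have [r [h1 h2]] := lva_parity HV i.
  by exists r; split; exact: state_op_parity.
by rewrite Sop_sum /opsum big_map big_enum.
Qed.

Lemma Sop_lin : linear S.
Proof. exact: even_endo2_lin Sop_even. Qed.

Lemma Sop_swap t : S (sw t) = sw (S t).
Proof.
move: t; apply: tens_ext => [c x y|c x y|a b].
- by rewrite sswap_lin Sop_lin.
- by rewrite Sop_lin sswap_lin.
apply: tmap_Y_inj; rewrite tmap_Y_Sop -!sswap_tmap //; [|exact: Y_even..].
rewrite tmap_Y_Sop tmap_tpure //.
by apply: (braid_swap (lva_braid HV)); exists a + exists b.
Qed.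

Lemma Y3_leg12 x : Y3 (leg12 S x) = leg12 Sh (Y3 x).
Proof. exact: leg12_tmap Sop_lin Shat_lin tmap_Y_Sop x. Qed.
Lemma Y3_leg23 x : Y3 (leg23 S x) = leg23 Sh (Y3 x).
Proof. exact: leg23_tmap Sop_lin Shat_lin tmap_Y_Sop x. Qed.
Lemma Y3_leg13 x : Y3 (leg13 S x) = leg13 Sh (Y3 x).
Proof. exact: leg13_tmap Y_even Sop_lin Shat_lin tmap_Y_Sop. Qed.

Lemma leg12_leg23_comm x : leg12 S (leg23 S x) = leg23 S (leg12 S x).
Proof.
have l1 := leg12_lin Sop_lin; have l2 := leg23_lin Sop_lin.
move: x; apply: tens3_ext => [c x y|c x y|a b c]; [by rewrite l2 l1|by rewrite l1 l2|].
apply: tmap3_Y_inj; rewrite Y3_leg12 !Y3_leg23 Y3_leg12 !tmap_tpure //.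
by apply: (braid_12_23 (lva_braid HV)); eexists.
Qed.

Lemma leg13_leg23_comm x : leg13 S (leg23 S x) = leg23 S (leg13 S x).
Proof.
have l1 := leg13_lin Sop_lin; have l2 := leg23_lin Sop_lin.
move: x; apply: tens3_ext => [c x y|c x y|a b c]; [by rewrite l2 l1|by rewrite l1 l2|].
apply: tmap3_Y_inj; rewrite Y3_leg13 !Y3_leg23 Y3_leg13 !tmap_tpure //.
by apply: (braid_13_23 (lva_braid HV)); eexists.
Qed.

Lemma leg12_leg13_comm x : leg12 S (leg13 S x) = leg13 S (leg12 S x).
Proof.
have l1 := leg12_lin Sop_lin; have l2 := leg13_lin Sop_lin.
move: x; apply: tens3_ext => [c x y|c x y|a b c]; [by rewrite l2 l1|by rewrite l1 l2|].
apply: tmap3_Y_inj; rewrite Y3_leg12 !Y3_leg13 Y3_leg12 !tmap_tpure //.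
by apply: (braid_12_13 (lva_braid HV)); eexists.
Qed.

Theorem Sop_braiding : braiding_map S.
Proof.
split=> *; [exact: Sop_even|exact: Sop_swap|exact: leg12_leg23_comm
  |exact: leg13_leg23_comm|exact: leg12_leg13_comm].
Qed.

Lemma tmap_Y_iter k t : YY (iter k S t) = iter k Sh (YY t).
Proof. exact: iter_intertwine tmap_Y_Sop. Qed.

Theorem Sop_nil t : exists r, iter r S t = 0.
Proof.
move: t; apply: tens_generated => [c x y|a b]; first exact/nil_combo/Sop_lin.
have [||r _ hr] := local_nil (lva_local HV) (A := Y a) (B := Y b); try by eexists.
exists r; apply: tmap_Y_inj; rewrite tmap_Y_iter tmap_tpure // hr.
by rewrite (lin0 lY2).
Qed.

Lemma iter_leg12_tpure k t c : iter k (leg12 S) (tpure t c) = tpure (iter k S t) c.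
Proof.
apply/esym; apply: (@iter_intertwine _ _ _ (fun t => tpure t c)) => {}t.
by rewrite leg12_tpure //; exact: Sop_lin.
Qed.

Lemma leg12_nil x : exists r, iter r (leg12 S) x = 0.
Proof.
move: x; apply: tens_generated => [c x y|t c]; first exact/nil_combo/leg12_lin/Sop_lin.
have [r hr] := Sop_nil t; exists r.
by rewrite iter_leg12_tpure hr (lin0 (tpure_linl c)).
Qed.

Lemma leg13_nil x : exists r, iter r (leg13 S) x = 0.
Proof.
move: x; apply: (nil_conjugate (leg23_lin (@sswap_lin K V)) (@leg23_swapK K V) _ leg12_nil) => x.
by rewrite leg23_leg12.
Qed.

Lemma leg23_nil x : exists r, iter r (leg23 S) x = 0.
Proof.
move: x; apply: (nil_conjugate (leg12_lin (@sswap_lin K V)) (@leg12_swapK K V) _ leg13_nil) => x.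
exact: leg12_leg13 Sop_even.
Qed.

End StateOperator.

Section FieldCoefficients.
Variables (K : fieldType) (V : superType K) (Y : lhom V (LF V)).

Lemma bilin_Yz : bilin (fun a b : V => Y a b).
Proof.
split=> [b|a]; last exact: lhomP.
by move=> c x y; rewrite (lhomP Y) lhomD lhomZ.
Qed.

Lemma Yz_lin : linear (Yz Y).
Proof. exact: tlift_linear bilin_Yz. Qed.

Lemma Yz_tpure a b : Yz Y (tpure a b) = Y a b.
Proof. exact: tlift_tpure bilin_Yz. Qed.

Lemma Yz_coef_lin n k : linear (Yz_coef Y n k).
Proof. by move=> c x y; rewrite /Yz_coef Yz_lin lserD lserZ. Qed.

Lemma Yz_coef_tpure n k a b : Yz_coef Y n k (tpure a b) = Y a b n k.
Proof. by rewrite /Yz_coef Yz_tpure. Qed.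

Definition Ycoef n k : lhom (tens V V) V := mkhom (Yz_coef_lin n k).

Definition Ycoef23 n k : lhom (tens (tens V V) V) (tens V V) :=
  mkhom (linear_comp_lin (@tassoc_lin _ _ _ _) (tmap_lin (@id_lin _ _) (lhomP (Ycoef n k)))).

Definition Ycoef12 n : lhom (tens (tens V V) V) (tens V V) :=
  mkhom (tmap_lin (lhomP (Ycoef n 0)) (@id_lin _ _)).

Lemma Ycoef_tpure n k a b : Ycoef n k (tpure a b) = Y a b n k.
Proof. exact: Yz_coef_tpure. Qed.

Lemma Ycoef23_tpure n k a b c :
  Ycoef23 n k (tpure (tpure a b) c) = tpure a (Y b c n k).
Proof.
rewrite -[LHS]/(tmap id (Ycoef n k) (tassoc (tpure (tpure a b) c))).
by rewrite tassoc_tpure (tmap_tpure _ _ (@id_lin _ _) (lhomP (Ycoef n k))) Ycoef_tpure.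
Qed.

Lemma Ycoef23_assoc n k a t :
  Ycoef23 n k (tassocV (tpure a t)) = tpure a (Ycoef n k t).
Proof.
rewrite -[LHS]/(tmap id (Ycoef n k) (tassoc (tassocV (tpure a t)))).
by rewrite tassocVK (tmap_tpure _ _ (@id_lin _ _) (lhomP (Ycoef n k))).
Qed.

Lemma Ycoef12_tpure n t c : Ycoef12 n (tpure t c) = tpure (Ycoef n 0 t) c.
Proof.
exact: tmap_tpure (lhomP (Ycoef n 0)) (@id_lin _ _).
Qed.

Lemma Ycoef_trunc k x : exists d : nat, forall n, n < - d%:Z -> Ycoef n k x = 0.
Proof.
have [n0 h] := (lserP (Yz Y x)).2 k; exists `|n0|%N => n lt.
by apply: h; lia.
Qed.

Lemma Ycoef23_trunc k x : exists d : nat, forall n, n < - d%:Z -> Ycoef23 n k x = 0.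
Proof.
move: x; apply: tens_generated => [c x y [d hd] [d' hd']|t c].
  exists (maxn d d') => n lt; rewrite (lhomP (Ycoef23 n k)) hd ?hd' ?scaler0 ?addr0 //.
    by move: lt; rewrite /maxn; case: ifP; lia.
  by move: lt; rewrite /maxn; case: ifP; lia.
move: t; apply: tens_generated => [e x y [d hd] [d' hd']|a b].
  exists (maxn d d') => n lt; rewrite (tpure_linl c) (lhomP (Ycoef23 n k)).
  rewrite hd ?hd' ?scaler0 ?addr0 //.
    by move: lt; rewrite /maxn; case: ifP; lia.
  by move: lt; rewrite /maxn; case: ifP; lia.
have [d hd] := Ycoef_trunc k (tpure b c); exists d => n /hd.
by rewrite Ycoef23_tpure Ycoef_tpure => ->; exact: lin0 (tpure_linr _).
Qed.

End FieldCoefficients.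

Lemma ad_homogeneous (K : fieldType) (V : superType K) (phi : lhom V V) (A : LF V) p q v :
  has_parity p phi -> has_parity q A ->
  ad phi A v = smap phi (A v) - (-1) ^+ (p && q) *: A (phi v).
Proof.
move=> hp hq; have -> : ad phi A = comphom (smap phi) A - (-1) ^+ (p && q) *: comphom A phi.
  rewrite -[LHS]/(ad_field phi A) /ad_field.
  rewrite (@sum_bool2 _ (fun p q => comphom (smap (spr p phi : lhom V V)) (spr q A : LF V)
     - (-1) ^+ (p && q) *: comphom (spr q A : LF V) (spr p phi : lhom V V)) p q).
    by rewrite hp hq.
  move=> p' q' /orP[] /negbTE ne.
    rewrite (spr_parity p' hp) ne; apply: lhom_ext => u.
    rewrite -[LHS]/(smap 0 ((spr q' A : LF V) u) - (-1) ^+ (p' && q') *: (spr q' A : LF V) 0).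
    rewrite (lhom_zero (spr q' A : LF V)) scaler0 subr0.
    by apply: lser_ext.
  rewrite (spr_parity q' hq) ne; apply: lhom_ext => u.
  rewrite -[LHS]/(smap (spr p' phi : lhom V V) (0 : lser V) - (-1) ^+ (p' && q') *: (0 : lser V)).
  by rewrite scaler0 subr0; exact: lhom_zero.
by [].
Qed.

Section TwoFields.
Variables (K : numFieldType) (V : superType K).

Lemma bilin_prod2 v : bilin (fun a b : LF V => (fun n1 n2 k1 k2 => a (b v n2 k2) n1 k1)
  : int -> int -> nat -> nat -> V).
Proof.
split=> [B|A] c x y; apply: funext => n1; apply: funext => n2; apply: funext => k1;
  apply: funext => k2.
  by rewrite lhomD lhomZ.
by rewrite lhomD lhomZ lserD lserZ (lhomP A).
Qed.

Lemma prod2_lin v c x y n1 n2 k1 k2 :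
  prod2 (c *: x + y) v n1 n2 k1 k2
  = c *: prod2 x v n1 n2 k1 k2 + prod2 y v n1 n2 k1 k2 :> V.
Proof. by rewrite /prod2 (tlift_linear (bilin_prod2 v)). Qed.

Lemma prod2_tpure A B v n1 n2 k1 k2 :
  prod2 (tpure A B) v n1 n2 k1 k2 = A (B v n2 k2) n1 k1 :> V.
Proof. by rewrite /prod2 (tlift_tpure _ _ (bilin_prod2 v)). Qed.

Lemma prod2_tmap (Y : lhom V (LF V)) t v n1 n2 k1 k2 :
  prod2 (tmap Y Y t) v n1 n2 k1 k2 = Ycoef Y n1 k1 (Ycoef23 Y n2 k2 (tpure t v)).
Proof.
move: t; apply: tens_ext => [c x y|c x y|a b].
- by rewrite (tmap_lin (lhomP Y) (lhomP Y)) prod2_lin.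
- by rewrite tpure_linl (lhomP (Ycoef23 Y n2 k2)) (lhomP (Ycoef Y n1 k1)).
- rewrite (tmap_tpure _ _ (lhomP Y) (lhomP Y)) Ycoef23_tpure Ycoef_tpure.
  exact: prod2_tpure.
Qed.

End TwoFields.

(** * Independence of the n-th product from the order N *)

Section DiagonalShift.
Variables (K : numFieldType) (V : superType K).
Implicit Types F G : ser2 V.

Definition bounded_below F := forall k1 k2, exists d : nat, forall n1 n2,
  (n1 < - d%:Z) || (n2 < - d%:Z) -> F n1 n2 k1 k2 = 0.

Lemma bounded_below_uniform F k : bounded_below F -> exists d : nat,
  forall n1 n2 k1, (k1 <= k)%N -> (n1 < - d%:Z) || (n2 < - d%:Z) ->
  F n1 n2 k1 (k - k1)%N = 0.
Proof.
move=> bF; suff: forall l, exists d : nat, forall n1 n2 k1, (k1 <= l)%N ->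
    (n1 < - d%:Z) || (n2 < - d%:Z) -> F n1 n2 k1 (k - k1)%N = 0 by apply.
elim=> [|l [d hd]].
  have [d hd] := bF 0%N k; exists d => n1 n2 k1; rewrite leqn0 => /eqP -> h.
  by rewrite subn0 hd.
have [d' hd'] := bF l.+1 (k - l.+1)%N; exists (d + d')%N => n1 n2 k1.
rewrite leq_eqVlt => /orP[/eqP -> h|lt h].
  by apply: hd'; case/orP: h; lia.
by apply: hd => //; case/orP: h; lia.
Qed.

Lemma diagE F p k (d : nat) B :
  (forall n1 n2 k1, (k1 <= k)%N -> (n1 < - d%:Z) || (n2 < - d%:Z) ->
    F n1 n2 k1 (k - k1)%N = 0) ->
  p + d%:Z < B%:Z - d%:Z ->
  diag F p k = \sum_(i < B) \sum_(k1 < k.+1) F (i%:Z - d%:Z) (p - (i%:Z - d%:Z)) k1 (k - k1)%N.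
Proof.
move=> h lt; rewrite /diag (@fsum_int _ d B) //.
- move=> n lt'; apply: big1 => k1 _; apply: h; first by rewrite -ltnS.
  by rewrite lt'.
- move=> n le; apply: big1 => k1 _; apply: h; first by rewrite -ltnS.
  by apply/orP; right; lia.
Qed.

Lemma bounded_below_mul_z12 F : bounded_below F -> bounded_below (mul_z12 F).
Proof.
move=> bF k1 k2; have [d hd] := bF k1 k2; exists d => n1 n2 /orP h.
by rewrite /mul_z12 !hd ?subrr //; apply/orP; case: h; lia.
Qed.

Lemma bounded_below_D_z1 F : bounded_below F -> bounded_below (D_z1 F).
Proof.
move=> bF k1 k2; have [d hd] := bF k1 k2; have [d' hd'] := bF k1.+1 k2.
exists (d + d').+1 => n1 n2 /orP h; rewrite /D_z1 hd ?hd' ?scaler0 ?addr0 //;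
  by apply/orP; case: h; lia.
Qed.

(** z_1 - z_2 vanishes on the diagonal: the sum telescopes between two regions where [F] is zero. *)
Lemma diag_mul_z12 F p k : bounded_below F -> diag (mul_z12 F) p k = 0.
Proof.
move=> bF; have [d hd] := bounded_below_uniform k (bounded_below_mul_z12 bF).
have [d' hd'] := bounded_below_uniform k bF.
pose B := `|(p + (d + d')%:Z + (d + d')%:Z)%R|%N.+2.
rewrite (diagE (F := mul_z12 F) (p := p) (k := k) (d := d + d') (B := B)); first 1 last.
- by move=> n1 n2 k1 le /orP h; apply: hd => //; apply/orP; case: h; lia.
- by rewrite /B; lia.
pose f (i : nat) : V := \sum_(k1 < k.+1)
  F (i%:Z - (d + d')%:Z - 1) (p - (i%:Z - (d + d')%:Z)) k1 (k - k1)%N.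
have E i : \sum_(k1 < k.+1) mul_z12 F (i%:Z - (d + d')%:Z) (p - (i%:Z - (d + d')%:Z)) k1 (k - k1)%N
    = f i - f i.+1.
  rewrite -sumrB; apply: eq_bigr => k1 _; rewrite /mul_z12.
  by congr (_ - F _ _ _ _); lia.
under eq_bigr => i _ do rewrite E.
have tel n : \sum_(i < n) (f i - f i.+1) = f 0%N - f n.
  elim: n => [|n IH]; first by rewrite big_ord0 subrr.
  by rewrite big_ord_recr IH /= addrA subrK.
rewrite tel /f !big1 ?subrr // => k1 _;
  (apply: hd'; first by rewrite -ltnS); apply/orP; [right|left]; rewrite /B; lia.
Qed.

Lemma diag_combo F G H c p k : bounded_below F -> bounded_below G ->
  (forall n1 n2 k1 k2, H n1 n2 k1 k2 = F n1 n2 k1 k2 + c *: G n1 n2 k1 k2) ->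
  diag H p k = diag F p k + c *: diag G p k.
Proof.
move=> bF bG hH; have [d hd] := bounded_below_uniform k bF.
have [d' hd'] := bounded_below_uniform k bG.
pose B := `|(p + (d + d')%:Z + (d + d')%:Z)%R|%N.+1.
have zF n1 n2 k1 : (k1 <= k)%N -> (n1 < - (d + d')%:Z) || (n2 < - (d + d')%:Z) ->
    F n1 n2 k1 (k - k1)%N = 0.
  by move=> le /orP h; apply: hd => //; apply/orP; case: h; lia.
have zG n1 n2 k1 : (k1 <= k)%N -> (n1 < - (d + d')%:Z) || (n2 < - (d + d')%:Z) ->
    G n1 n2 k1 (k - k1)%N = 0.
  by move=> le /orP h; apply: hd' => //; apply/orP; case: h; lia.
have ltB : p + (d + d')%:Z < B%:Z - (d + d')%:Z by rewrite /B; lia.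
rewrite (diagE zF ltB) (diagE zG ltB) (diagE (F := H) _ ltB); last first.
  by move=> n1 n2 k1 le h; rewrite hH zF // zG // scaler0 addr0.
rewrite scaler_sumr -big_split; apply: eq_bigr => i _ /=.
by rewrite scaler_sumr -big_split; apply: eq_bigr => k1 _ /=.
Qed.

Lemma D_z1_mul_z12 F n1 n2 k1 k2 :
  D_z1 (mul_z12 F) n1 n2 k1 k2 = mul_z12 (D_z1 F) n1 n2 k1 k2 + F n1 n2 k1 k2.
Proof.
have E (a e : K) (x y z w : V) : (a + 1) *: (x - y) + e *: (z - w)
    = (a *: x + e *: z) - ((a + 1) *: y + e *: w) + x.
  rewrite !scalerBr scalerDl scale1r opprD.
  by rewrite (AC (3*2) ((1*4)*(3*5)*2)).
rewrite /D_z1 /mul_z12 subrK addrK.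
have -> : (n1 + 1)%:~R = n1%:~R + 1 :> K by rewrite (intrD K n1 1).
exact: E.
Qed.

Lemma iter_D_z1_mul_z12 i F n1 n2 k1 k2 :
  iter i.+1 (@D_z1 K V) (mul_z12 F) n1 n2 k1 k2
  = mul_z12 (iter i.+1 (@D_z1 K V) F) n1 n2 k1 k2 + i.+1%:R *: iter i (@D_z1 K V) F n1 n2 k1 k2.
Proof.
elim: i n1 n2 k1 k2 => [|i IH] n1 n2 k1 k2.
  by rewrite scale1r [LHS]D_z1_mul_z12.
have E (a c e : K) (x y z w : V) : a *: (x + c *: y) + e *: (z + c *: w)
    = (a *: x + e *: z) + c *: (a *: y + e *: w).
  by rewrite !scalerDr !scalerA ![c * _]mulrC addrACA.
transitivity (D_z1 (mul_z12 (iter i.+1 (@D_z1 K V) F)) n1 n2 k1 k2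
    + i.+1%:R *: D_z1 (iter i (@D_z1 K V) F) n1 n2 k1 k2).
  by rewrite iterS /D_z1 !IH; exact: E.
by rewrite D_z1_mul_z12 -addrA [i.+2%:R]mulrS [(1 + _) *: _]scalerDl scale1r.
Qed.

Lemma bounded_below_iter_D_z1 i F : bounded_below F -> bounded_below (iter i (@D_z1 K V) F).
Proof. by move=> bF; elim: i => //= i; exact: bounded_below_D_z1. Qed.

Lemma diag_scale c F p k : bounded_below F ->
  diag (fun n1 n2 k1 k2 => c *: F n1 n2 k1 k2) p k = c *: diag F p k.
Proof.
move=> bF; pose Z : ser2 V := fun _ _ _ _ => 0.
have bZ : bounded_below Z by move=> *; exists 0%N.
have dZ : diag Z p k = 0.
  by rewrite /diag fsbig1 // => n _; apply: big1.
rewrite (@diag_combo Z F _ c) ?dZ ?add0r // => n1 n2 k1 k2.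
by rewrite add0r.
Qed.

(** For divided powers [D^(j + 1), z_1 - z_2] = D^(j), and only the commutator survives on the
    diagonal. Hence raising N by one leaves the n-th product unchanged. *)
Theorem diag_D_z1_div_mul_z12 (j : int) F p k : bounded_below F ->
  diag (D_z1_div (j + 1) (mul_z12 F)) p k = diag (D_z1_div j F) p k.
Proof.
move=> bF; case: j => [i|[|i]].
- have -> : i%:Z + 1 = i.+1%:Z by lia.
  rewrite /D_z1_div diag_scale; last exact/bounded_below_iter_D_z1/bounded_below_mul_z12.
  have bi := bounded_below_iter_D_z1 i bF; have bi1 := bounded_below_iter_D_z1 i.+1 bF.
  rewrite diag_scale // (@diag_combo _ _ _ _ _ _ (bounded_below_mul_z12 bi1) bi
    (iter_D_z1_mul_z12 i F)).
  rewrite diag_mul_z12 // add0r scalerA factS natrM invfM mulrAC mulVf ?mul1r //.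
  by rewrite pnatr_eq0.
(* For j = -1 the left side is the diagonal of z_12 F, and the right side is 0 by the convention on
   negative divided powers. *)
- have -> : Negz 0 + 1 = 0%:Z by [].
  rewrite /D_z1_div diag_scale; last exact: bounded_below_mul_z12.
  rewrite diag_mul_z12 // scaler0 /diag fsbig1 // => n _; exact: big1.
- have -> : Negz i.+1 + 1 = Negz i by lia.
  by [].
Qed.

End DiagonalShift.

Lemma scaler_comb2 (K : fieldType) (W : lmodType K) (a b c : K) (x y x' y' : W) :
  a *: (c *: x + x') + b *: (c *: y + y')
  = c *: (a *: x + b *: y) + (a *: x' + b *: y').
Proof. by rewrite !scalerDr !scalerA addrACA [a * c]mulrC [b * c]mulrC. Qed.

(** * The calculus applied to a logarithmic vertex algebra *)

Section Calculus.
Variables (K : numFieldType) (V : superType K) (vac : V) (T : lhom V V) (Y : lhom V (LF V)).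
Variables (m : nat) (Phi Psi : 'I_m -> lhom (LF V) (LF V)).
Hypothesis HV : log_vertex_algebra Phi Psi vac T Y.

Local Notation S := (Sop Phi Psi vac Y).
Local Notation Sh := (Shat Phi Psi).
Local Notation YY := (tmap Y Y).

Let lS : linear S. Proof. exact: Sop_lin HV. Qed.
Let lsw : linear (@sswap K V). Proof. exact: sswap_lin. Qed.

Let SS : lhom (tens V V) (tens V V) := mkhom lS.
Let PP : lhom (tens V V) (tens V V) := mkhom lsw.
Let L12 := mkhom (leg12_lin lS).
Let L13 := mkhom (leg13_lin lS).
Let L23 := mkhom (leg23_lin lS).
Let P12 := mkhom (leg12_lin lsw).
Let P23 := mkhom (leg23_lin lsw).
Let jv : lhom (tens V V) (tens (tens V V) V) := mkhom (tpure_linl vac).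
Let TL : lhom (tens V V) (tens V V) := mkhom (tmap_lin (lhomP T) (@id_lin _ _)).
Let TR : lhom (tens V V) (tens V V) := mkhom (tmap_lin (@id_lin _ _) (lhomP T)).
Local Notation braided_prod := (braided_prod (Ycoef Y) (Ycoef23 Y) L12).
Local Notation swap_local := (swap_local (Ycoef Y) (Ycoef23 Y) L12 P12).

Let S12_S13 x : L12 (L13 x) = L13 (L12 x). Proof. exact: leg12_leg13_comm HV x. Qed.
Let S12_S23 x : L12 (L23 x) = L23 (L12 x). Proof. exact: leg12_leg23_comm HV x. Qed.
Let S13_S23 x : L13 (L23 x) = L23 (L13 x). Proof. exact: leg13_leg23_comm HV x. Qed.
Let nil12 x : exists r, iter r L12 x = 0. Proof. exact: leg12_nil HV x. Qed.
Let nil13 x : exists r, iter r L13 x = 0. Proof. exact: leg13_nil HV x. Qed.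
Let nil23 x : exists r, iter r L23 x = 0. Proof. exact: leg23_nil HV x. Qed.
Let Y1_trunc := @Ycoef23_trunc _ _ Y.

Lemma exp_theta12_tmap t v n1 n2 k1 k2 :
  exp_theta12 Sh (YY t) v n1 n2 k1 k2 = braided_prod (tpure t v) n1 n2 k1 k2.
Proof.
apply: (exp_theta12_braided_prod S12_S13 S12_S23 S13_S23 nil12 nil13 nil23 Y1_trunc) => k a b d e.
rewrite -(tmap_Y_iter HV) prod2_tmap; congr (Ycoef Y _ _ (Ycoef23 Y _ _ _)).
by rewrite -(iter_leg12_tpure HV).
Qed.

Lemma ser2_ext (F G : ser2 V) : (forall n1 n2 k1 k2, F n1 n2 k1 k2 = G n1 n2 k1 k2) -> F = G.
Proof.
move=> h; apply: funext => n1; apply: funext => n2; apply: funext => k1; apply: funext => k2.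
exact: h.
Qed.

Let exp_theta12_braided_prod t v : exp_theta12 Sh (YY t) v = braided_prod (tpure t v).
Proof. by apply: ser2_ext => *; exact: exp_theta12_tmap. Qed.

Let swap_YY t : sswap (YY t) = YY (sswap t).
Proof. by rewrite (sswap_tmap (lhomP Y) (Y_even HV)). Qed.

Let P12_tpure t v : P12 (tpure t v) = tpure (sswap t) v.
Proof. exact: leg12_tpure lsw. Qed.

Let locality x : exists N, swap_local N x.
Proof.
have combo c y z : (exists N, swap_local N y) -> (exists N, swap_local N z) -> exists N, swap_local N (c *: y + z).
  move=> [N hN] [N' hN']; exists (maxn N N').
  apply: (swap_local_linear S12_S13 S12_S23 S13_S23 nil12 nil13 nil23 Y1_trunc).
    exact: swap_local_mono (leq_maxl N N') hN.
  exact: swap_local_mono (leq_maxr N N') hN'.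
move: x; apply: tens_generated => [c x y|t v]; first exact: combo.
move: t; apply: tens_generated => [c x y|a b].
  by rewrite tpure_linl; exact: combo.
have [||N hN] := local_comm (lva_local HV) (A := Y a) (B := Y b); try by eexists.
exists N => n1 n2 k1 k2; have := hN v.
rewrite -(tmap_tpure _ _ (lhomP Y) (lhomP Y)) swap_YY !exp_theta12_braided_prod -P12_tpure.
by move=> ->.
Qed.

Let jv_S x : jv (SS x) = L12 (jv x). Proof. exact/esym/leg12_tpure/lS. Qed.
Let P12_jv x : P12 (jv x) = jv (PP x). Proof. exact: P12_tpure. Qed.

Let Y1_jv_eq0 n k x : (n < 0) || (0 < k)%N -> Ycoef23 Y n k (jv x) = 0.
Proof.
move=> h; move: x; apply: tens_generated => [c x y hx hy|a b].
  by rewrite (lhomP jv) (lhomP (Ycoef23 Y n k)) hx hy scaler0 addr0.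
rewrite -[jv _]/(tpure (tpure a b) vac) Ycoef23_tpure (lva_creation_reg HV) //.
exact: lin0 (tpure_linr a).
Qed.

Let Y1_jv x : Ycoef23 Y 0 0 (jv x) = x.
Proof.
move: x; apply: tens_generated => [c x y hx hy|a b].
  by rewrite (lhomP jv) (lhomP (Ycoef23 Y 0 0)) hx hy.
by rewrite -[jv _]/(tpure (tpure a b) vac) Ycoef23_tpure (lva_creation HV).
Qed.

Lemma Ycoef_log n k x : Ycoef Y n k x = ((-1) ^+ k / k`!%:R) *: Ycoef Y n 0 (iter k S x).
Proof. exact: (Y_log_terms locality jv_S P12_jv Y1_jv_eq0 Y1_jv n k x). Qed.

Let iter_L23 k a t : iter k L23 (tassocV (tpure a t)) = tassocV (tpure a (iter k S t)).
Proof.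
apply/esym; apply: (@iter_intertwine _ _ _ (fun t => tassocV (tpure a t))) => {}t.
rewrite -[RHS]/(tassocV (tmap id S (tassoc (tassocV (tpure a t))))) tassocVK.
by rewrite (tmap_tpure _ _ (@id_lin _ _) lS).
Qed.

Let Y1_log n k x :
  Ycoef23 Y n k x = ((-1) ^+ k / k`!%:R) *: Ycoef23 Y n 0 (iter k L23 x).
Proof.
rewrite -[x](@tassocK K V V V); move: (tassoc x).
apply: tens_generated => [c y z hy hz|a t].
  rewrite tassocV_lin (lhomP (Ycoef23 Y n k)) hy hz (iter_lin (leg23_lin lS)).
  rewrite (lhomP (Ycoef23 Y n 0)) scalerDr !scalerA.
  by rewrite [c * _]mulrC.
rewrite iter_L23 !Ycoef23_assoc Ycoef_log.
exact: linZ (tpure_linr a).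
Qed.

Let P12_S12 x : P12 (L12 x) = L12 (P12 x).
Proof. by apply: leg12_commute => // t; rewrite (Sop_swap HV). Qed.

Let P12_S13 x : P12 (L13 x) = L23 (P12 x).
Proof. exact: leg12_leg13 (Sop_even HV). Qed.

Let T_lser a b n k : T (Y a b n k) = Y a (T b) n k
  + ((n + 1)%:~R *: Y a b (n + 1) k + k.+1%:R *: Y a b (n + 1) k.+1).
Proof.
move: a; apply: parity_ext => [c x y|c x y|p a ha].
- by rewrite (lhomP Y) lhomD lhomZ lserD lserZ (lhomP T).
- rewrite (lhomP Y) !lhomD !lhomZ !lserD !lserZ scaler_comb2 addrACA.
  by rewrite [in RHS]scalerDr.
have := ad_homogeneous b (lva_T_even HV) (Y_even HV ha).
rewrite (lva_cov HV) andFb expr0 scale1r => /(congr1 (fun A : lser V => A n k)).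
rewrite -[LHS]/((n + 1)%:~R *: Y a b (n + 1) k + k.+1%:R *: Y a b (n + 1) k.+1) => ->.
by rewrite -[RHS]/(Y a (T b) n k + (T (Y a b n k) - Y a (T b) n k)) addrC subrK.
Qed.

Let Yc_T n k x : T (Ycoef Y n k x) = Ycoef Y n k (TR x)
  + (n + 1)%:~R *: Ycoef Y (n + 1) k x + k.+1%:R *: Ycoef Y (n + 1) k.+1 x.
Proof.
rewrite -addrA; move: x; apply: tens_ext => [c x y|c x y|a b].
- by rewrite (lhomP (Ycoef Y n k)) (lhomP T).
- rewrite (lhomP TR) (lhomP (Ycoef Y n k)) (lhomP (Ycoef Y (n + 1) k)).
  by rewrite (lhomP (Ycoef Y (n + 1) k.+1)) scaler_comb2 [LHS]addrACA [in RHS]scalerDr.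
have -> : TR (tpure a b) = tpure a (T b) by exact: tmap_tpure (@id_lin _ _) (lhomP T).
by rewrite !Ycoef_tpure T_lser.
Qed.

Let jv_T n x : TR (Ycoef23 Y n 0 (jv x)) = (n + 1)%:~R *: Ycoef23 Y (n + 1) 0 (jv x).
Proof.
move: x; apply: tens_ext => [c x y|c x y|a b].
- by rewrite (lhomP jv) (lhomP (Ycoef23 Y n 0)) (lhomP TR).
- rewrite (lhomP jv) (lhomP (Ycoef23 Y (n + 1) 0)) scalerDr !scalerA.
  by rewrite [_ * c]mulrC.
rewrite -[jv _]/(tpure (tpure a b) vac) !Ycoef23_tpure.
rewrite -[LHS]/(tmap id T (tpure a (Y b vac n 0))) (tmap_tpure _ _ (@id_lin _ _) (lhomP T)).
rewrite T_lser (lva_T_vac HV) (lhom_zero (Y b)) lser0 add0r.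
have -> : Y b vac (n + 1) 1%N = 0 by apply: (lva_creation_reg HV); rewrite orbT.
rewrite scaler0 addr0.
exact: linZ (tpure_linr a).
Qed.

Let SP x : SS (PP x) = PP (SS x). Proof. exact: Sop_swap HV x. Qed.
Let PK x : PP (PP x) = x. Proof. exact: sswapK. Qed.

Let TL_P x : TL (PP x) = PP (TR x).
Proof.
move: x; apply: tens_parity_ext => [c x y|c x y|p q a b ha hb].
- by rewrite (lhomP PP) (lhomP TL).
- by rewrite (lhomP TR) (lhomP PP).
rewrite -[PP (tpure a b)]/(sswap (tpure a b)) (sswap_tpure ha hb) (linZ _ _ (lhomP TL)).
rewrite -[TR _]/(tmap id T (tpure a b)) -[TL _]/(tmap T id (tpure b a)).
rewrite (tmap_tpure _ _ (@id_lin _ _) (lhomP T)) (tmap_tpure _ _ (lhomP T) (@id_lin _ _)).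
have hT := parity_app (lva_T_even HV) hb; rewrite addFb in hT.
exact/esym/sswap_tpure.
Qed.

Let Yc_trunc := @Ycoef_trunc _ _ Y.

Let Ycoef_translation n k x : Ycoef Y n k (TL x)
  = (n + 1)%:~R *: Ycoef Y (n + 1) k x + k.+1%:R *: Ycoef Y (n + 1) k.+1 x.
Proof.
exact: (Y_translation S12_S13 S12_S23 S13_S23 nil12 nil13 nil23 Y1_trunc locality
  jv_S P12_jv Y1_jv_eq0 Y1_jv Y1_log P12_S12 P12_S13 Yc_T jv_T SP TL_P PK Yc_trunc).
Qed.

Lemma Y_T a : Y (T a) = Dz V (Y a).
Proof.
apply: lhom_ext => b; apply: lser_ext => n k.
have -> : Y (T a) b n k = Ycoef Y n k (TL (tpure a b)).
  by rewrite -[TL _]/(tmap T id _) (tmap_tpure _ _ (lhomP T) (@id_lin _ _)) Ycoef_tpure.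
by rewrite Ycoef_translation !Ycoef_tpure.
Qed.

(** The axiom concerns D_z on fields; [Y_T] turns it into a statement about T on states. *)
Lemma Sop_TL x : tmap T id (S x) = S (tmap T id x).
Proof.
apply: (tmap_Y_inj HV); rewrite (tmap_Y_Sop HV).
have E y : YY (tmap T id y) = tmap (Dz V) id (YY y).
  rewrite !tmap_comp; [|exact: lhomP|exact: lhomP|exact: lhomP|exact: id_lin
    |exact: lhomP|exact: lhomP|exact: id_lin|exact: lhomP].
  by congr (tmap _ _ y); apply: funext => a; rewrite /= Y_T.
by rewrite !E (tmap_Y_Sop HV) (lva_Dz HV).
Qed.

Let STR x : SS (TR x) = TR (SS x).
Proof.
have sPP : injective PP by exact: inv_inj PK.
apply: sPP; rewrite -SP -!TL_P -SP; exact/esym/Sop_TL.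
Qed.

Let P23_S13 x : P23 (L13 x) = L12 (P23 x). Proof. exact: leg23_leg13. Qed.
Let P23_S12 x : P23 (L12 x) = L13 (P23 x). Proof. exact: leg23_leg12. Qed.
Let P23_S23 x : P23 (L23 x) = L23 (P23 x).
Proof. by apply: leg23_commute => // t; rewrite (Sop_swap HV). Qed.
Let P12_S23 x : P12 (L23 x) = L13 (P12 x).
Proof. exact: leg12_leg23 (Sop_even HV). Qed.

Let Ycoef_skew x p R :
  (forall r : nat, (R <= r)%N -> Ycoef Y (p - r%:Z) 0 x = 0) ->
  Ycoef Y p 0 (PP x) = \sum_(r < R) Tdiv T r (sg K (p - r%:Z) *: Ycoef Y (p - r%:Z) 0 x).
Proof.
exact: (skew_symmetry S12_S13 S12_S23 S13_S23 nil12 nil13 nil23 Y1_trunc locality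
  jv_S P12_jv Y1_jv_eq0 Y1_jv Y1_log P12_S12 P12_S13 Yc_T jv_T SP).
Qed.

Let Tdiv_TR r a v : Tdiv TR r (tpure a v) = tpure a (Tdiv T r v).
Proof.
rewrite /Tdiv; have -> : iter r TR (tpure a v) = tpure a (iter r T v).
  apply/esym; apply: (@iter_intertwine _ _ _ (tpure a)) => {}v.
  exact/esym/(tmap_tpure _ _ (@id_lin _ _) (lhomP T)).
exact/esym/(linZ _ _ (tpure_linr a)).
Qed.

Let Y1_skew z p R :
  (forall r : nat, (R <= r)%N -> Ycoef23 Y (p - r%:Z) 0 (P23 z) = 0) ->
  Ycoef23 Y p 0 z = \sum_(r < R) sg K (p - r%:Z) *: Tdiv TR r (Ycoef23 Y (p - r%:Z) 0 (P23 z)).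
Proof.
pose F w r := sg K (p - r%:Z) *: Tdiv TR r (Ycoef23 Y (p - r%:Z) 0 (P23 w)).
(* The length of the sum depends on the tensor, so additivity is proved for all sufficiently long
   sums. *)
move=> hz; suff [R0 hR0] : exists R0, forall R', (R0 <= R')%N ->
    Ycoef23 Y p 0 z = \sum_(r < R') F z r.
  rewrite (hR0 (R + R0)%N) ?leq_addl //.
  apply: (sum_ord_widen (f := F z)); first exact: leq_addr.
  by move=> r le; rewrite /F hz // (lin0 (Tdiv_linear TR r)) scaler0.
rewrite -[z](@tassocK K V V V); move: (tassoc z) => {hz z}.
apply: tens_generated => [c x y [R1 h1] [R2 h2]|a t].
  exists (R1 + R2)%N => R' le; rewrite tassocV_lin (lhomP (Ycoef23 Y p 0)).
  rewrite (h1 R') ?(h2 R') 1?(leq_trans _ le) ?leq_addl ?leq_addr //.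
  rewrite scaler_sumr -big_split; apply: eq_bigr => r _ /=.
  rewrite /F (lhomP P23) (lhomP (Ycoef23 Y (p - r%:Z) 0)) Tdiv_linear scalerDr !scalerA.
  by rewrite [c * _]mulrC.
have [d hd] := Yc_trunc 0 (PP t); exists `|(p + d%:Z)%R|.+1 => R' le.
have E r : F (tassocV (tpure a t)) r
    = tpure a (Tdiv T r (sg K (p - r%:Z) *: Ycoef Y (p - r%:Z) 0 (PP t))).
  rewrite /F; have -> : P23 (tassocV (tpure a t)) = tassocV (tpure a (PP t)).
    rewrite -[LHS]/(tassocV (tmap id (@sswap K V) (tassoc (tassocV (tpure a t))))).
    by rewrite tassocVK (tmap_tpure _ _ (@id_lin _ _) lsw).
  by rewrite Ycoef23_assoc Tdiv_TR TdivZ (linZ _ _ (tpure_linr a)).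
under eq_bigr => r _ do rewrite E.
rewrite -(linsum _ _ _ (tpure_linr a)) Ycoef23_assoc -{1}[t]PK; congr (tpure a _).
by apply: Ycoef_skew => r le'; apply: hd; lia.
Qed.

Let Ycoef_parity p q a b n k : has_parity p a -> has_parity q b ->
  has_parity (p (+) q) (Y a b n k).
Proof.
move=> ha hb; have h := parity_app (Y_even HV ha) hb.
by rewrite /has_parity -{2}h.
Qed.

Let P_Y1 k z : PP (Ycoef23 Y k 0 (P12 (P23 z))) = Ycoef12 Y k z.
Proof.
move: z; apply: tens3_parity_ext => [c x y|c x y|p q r a b c ha hb hc].
- by rewrite (lhomP P23) (lhomP P12) (lhomP (Ycoef23 Y k 0)) (lhomP PP).
- exact: lhomP.
have -> : P23 (tpure (tpure a b) c) = (-1) ^+ (q && r) *: tpure (tpure a c) b.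
  rewrite -[LHS]/(leg23 (@sswap K V) _) leg23_tpure // (sswap_tpure hb hc).
  by rewrite (linZ _ _ (tpure_linr a)) (linZ _ _ (@tassocV_lin _ _ _ _)) tassocV_tpure.
rewrite (linZ _ _ (lhomP P12)) P12_tpure (sswap_tpure ha hc).
rewrite (linZ _ _ (tpure_linl b)) scalerA (linZ _ _ (lhomP (Ycoef23 Y k 0))).
rewrite (linZ _ _ (lhomP PP)) Ycoef23_tpure Ycoef12_tpure Ycoef_tpure.
rewrite -[PP _]/(sswap _) (sswap_tpure hc (Ycoef_parity k 0 ha hb)) scalerA.
rewrite -!signr_addb.
have -> : (q && r) (+) (p && r) (+) (r && (p (+) q)) = false.
  by case: p q r {ha hb hc} => [] [] [].
by rewrite expr0 scale1r.
Qed.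

Let nprod_braided_prod x n : exists N0, forall N, (N0 <= N)%N -> forall p k,
  diag (D_z1_div (N%:Z - 1 - n) (iter N (@mul_z12 K V) (braided_prod x))) p k
  = Ycoef Y p k (Ycoef12 Y (- n - 1) x).
Proof.
exact: (nprod_formula S12_S13 S12_S23 S13_S23 nil12 nil13 nil23 Y1_trunc locality
  jv_S P12_jv Y1_jv_eq0 Y1_jv Y1_log P12_S12 P12_S13 Yc_T jv_T SP Yc_trunc STR
  P23_S13 P23_S12 P23_S23 P12_S23 Y1_skew P_Y1).
Qed.

(** Locality exchanges the variables, so the bound on the second variable of the exchanged product
    bounds z_1. *)
Let bounded_braided_prod N x : swap_local N x -> bounded_below (iter N (@mul_z12 K V) (braided_prod x)).
Proof.
move=> hN k1 k2.
have trunc := braided_prod_trunc (Ycoef Y) S12_S13 S12_S23 S13_S23 nil12 nil13 nil23 Y1_trunc.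
have [d hd] := trunc k2 x; have [d' hd'] := trunc k1 (P12 x).
exists (d + d')%N => n1 n2 /orP[lt|lt]; last first.
  by apply: (@iter_mul_z12_trunc _ _ (- d%:Z)) => [? ? ?|]; [exact: hd|lia].
rewrite hN (iter_mul_z12_swap12 N (braided_prod (P12 x))).
rewrite (@iter_mul_z12_trunc _ _ (- d'%:Z)) ?scaler0 //; last by lia.
by move=> ? ? ?; exact: hd'.
Qed.

(** The formula is available for large orders only. Any admissible order is raised to such a one
    without changing the diagonal, so all of them define the same field and [xget] selects it. *)
Lemma nprod_Y n a b : nprod Sh n (Y a) (Y b) = Y (Ycoef Y (- n - 1) 0 (tpure a b)).
Proof.
have tY : tpure (Y a) (Y b) = YY (tpure a b) by rewrite (tmap_tpure _ _ (lhomP Y) (lhomP Y)).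
have key N : local_order Sh N (tpure (Y a) (Y b)) -> forall v p k,
    nprod_coef Sh N n (tpure (Y a) (Y b)) v p k = Y (Ycoef Y (- n - 1) 0 (tpure a b)) v p k.
  rewrite tY => hN v p k; rewrite /nprod_coef exp_theta12_braided_prod.
  have lN : swap_local N (tpure (tpure a b) v).
    move=> n1 n2 k1 k2; have := hN v.
    by rewrite swap_YY !exp_theta12_braided_prod -P12_tpure => ->.
  rewrite -Ycoef_tpure -Ycoef12_tpure.
  have [N0 h] := nprod_braided_prod (tpure (tpure a b) v) n.
  rewrite -(h (N + N0)%N) ?leq_addl //; move: (tpure (tpure a b) v) lN => x lN.
  elim: N0 {h} => [|j ->]; first by rewrite addn0.
  have bN : bounded_below (iter (N + j) (@mul_z12 K V) (braided_prod x)).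
    by apply: bounded_braided_prod; apply: swap_local_mono lN; exact: leq_addr.
  rewrite -(diag_D_z1_div_mul_z12 _ _ _ bN) addnS.
  by have -> : (N + j).+1%:Z - 1 - n = (N + j)%:Z - 1 - n + 1 by lia.
rewrite /nprod; set E := [set _ | _].
have [||N hN] := local_comm (lva_local HV) (A := Y a) (B := Y b); try by eexists.
apply: (@xget_unique _ _ E) => [|A [N' [hN' hA]]].
  by exists N; split=> // v p k; rewrite key.
by apply: lhom_ext => v; apply: lser_ext => p k; rewrite hA key.
Qed.

(** [tlift] is meaningful for bilinear maps, and the bilinearity of [nprod] on fields is read off
    from [nprod_Y]. *)
Lemma nprodY_tens n t : nprodY Phi Psi Y n t = Y (Ycoef Y (- n - 1) 0 t).
Proof.
rewrite /nprodY; have -> : (fun a b => nprod Sh n (Y a) (Y b))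
    = (fun a b => Y (Ycoef Y (- n - 1) 0 (tpure a b))).
  by apply: funext => a; apply: funext => b; exact: nprod_Y.
have hb : bilin (fun a b => Y (Ycoef Y (- n - 1) 0 (tpure a b))).
  split=> [b|a] c x y.
    by rewrite tpure_linl (lhomP (Ycoef Y (- n - 1) 0)) (lhomP Y).
  by rewrite tpure_linr (lhomP (Ycoef Y (- n - 1) 0)) (lhomP Y).
move: t; apply: tens_ext => [||a b]; first exact: tlift_linear.
  exact: linear_comp_lin (lhomP (Ycoef Y (- n - 1) 0)) (lhomP Y).
exact: tlift_tpure.
Qed.

(** The hexagon axiom pulled back along the injective Y (x) Y; the representing element it asks for
    is [leg13 S x + leg23 S x]. *)
Theorem Sop_mul n x : S (tmap (mu_n Y n) id x) = tmap (mu_n Y n) id (leg13 S x + leg23 S x).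
Proof.
pose mu := Ycoef Y (- n - 1) 0.
have E y : YY (tmap (mu_n Y n) id y) = tmap (nprodY Phi Psi Y n) Y y.
  rewrite (tmap_comp (lhomP mu) (lhomP Y) (@id_lin _ _) (lhomP Y)).
  by congr (tmap _ _ y); apply: funext => t; rewrite nprodY_tens.
apply: (tmap_Y_inj HV); rewrite (tmap_Y_Sop HV) !E.
apply: (lva_hexagon HV).
rewrite (linD _ _ (tmap_lin (tmap_lin (lhomP Y) (lhomP Y)) (lhomP Y))).
by rewrite (Y3_leg13 HV) (Y3_leg23 HV).
Qed.

Let stens_T : stens T (idhom V) =1 tmap T id.
Proof. exact: stens_even (idhom_even V). Qed.

Lemma mu_derivation n : derivation (mu_n Y n) T.
Proof.
move=> x; rewrite stens_T (stens_even _ (lva_T_even HV)).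
rewrite -[LHS]/(T (Ycoef Y (- n - 1) 0 x)) Yc_T -addrA addrC; congr (_ + _).
exact/esym/Ycoef_translation.
Qed.

Lemma mu_unit : two_sided_unit vac (mu_n Y (-1)).
Proof.
move=> a; rewrite /mu_n opprK subrr !Yz_coef_tpure (lva_creation HV).
by rewrite (lva_vac_id HV).
Qed.

Let sswap_vac a : sswap (tpure vac a) = tpure a vac.
Proof.
move: a; apply: parity_ext => [c x y|c x y|p a ha].
- by rewrite tpure_linr lsw.
- by rewrite tpure_linl.
by rewrite (sswap_tpure (lva_vac_even HV) ha) andFb expr0 scale1r.
Qed.

(** For n = -1 the vacuum is a unit, so compatibility applied to vac (x) vac (x) a says that S(vac
    (x) a) is twice itself; symmetry moves vac to the right. *)
Lemma Sop_vac a : S (tpure a vac) = 0.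
Proof.
have lmu := tmap_lin (lhomP (Ycoef Y (- -1 - 1) 0)) (@id_lin _ V).
have mt t (c : V) : tmap (mu_n Y (-1)) id (tpure t c) = tpure (mu_n Y (-1) t) c.
  exact: (tmap_tpure t c (lhomP (Ycoef Y (- -1 - 1) 0)) (@id_lin _ V)).
have S_vac : S (tpure vac a) = 0.
  have := Sop_mul (-1) (tpure (tpure vac vac) a).
  rewrite mt (mu_unit vac).1 (linD _ _ lmu) => e.
  apply: (addIr (S (tpure vac a))); rewrite add0r [RHS]e; congr (_ + _).
    rewrite /leg13 leg23_tpure // sswap_vac tassocV_tpure leg12_tpure //.
    move: (S (tpure vac a)); apply: tens_ext => [||b c].
    - exact: id_lin.
    - move=> c x y; rewrite tpure_linl (leg23_lin lsw); exact: lmu.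
    rewrite leg23_tpure // -[tpure c vac]sswap_vac sswapK tassocV_tpure.
    by rewrite mt (mu_unit b).2.
  rewrite leg23_tpure //; move: (S (tpure vac a)); apply: tens_ext => [||b c].
  - exact: id_lin.
  - move=> c x y; rewrite tpure_linr tassocV_lin; exact: lmu.
  by rewrite tassocV_tpure mt (mu_unit b).1.
by rewrite -sswap_vac (Sop_swap HV) S_vac (lin0 lsw).
Qed.

Theorem mu_compatible n : compatible_braiding vac T (mu_n Y n) S.
Proof.
split; [exact: Sop_braiding HV|exact: Sop_vac|move=> x|exact: Sop_mul].
by rewrite !stens_T Sop_TL.
Qed.

(** Up to a scalar the coefficient of zeta^k is an n-th product preceded by S12^k, and S12 commutes
    with S13 and S23. *)
Theorem Sop_Yz_coef n k x :
  S (tmap (Yz_coef Y n k) id x) = tmap (Yz_coef Y n k) id (leg13 S x + leg23 S x).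
Proof.
have E y : tmap (Yz_coef Y n k) id y
    = ((-1) ^+ k / k`!%:R) *: tmap (mu_n Y (- n - 1)) id (iter k (leg12 S) y).
  move: y; apply: tens_ext => [||t c].
  - exact: tmap_lin (lhomP (Ycoef Y n k)) (@id_lin _ V).
  - apply/linear_scaled/linear_comp_lin; first exact: (iter_lin (leg12_lin lS)).
    exact: tmap_lin (lhomP (Ycoef Y (- (- n - 1) - 1) 0)) (@id_lin _ V).
  rewrite (iter_leg12_tpure HV).
  rewrite (tmap_tpure _ _ (lhomP (Ycoef Y n k)) (@id_lin _ V)).
  rewrite (tmap_tpure _ _ (lhomP (Ycoef Y (- (- n - 1) - 1) 0)) (@id_lin _ V)).
  rewrite -(linZ _ _ (tpure_linl c)); congr (tpure _ c).
  rewrite -[LHS]/(Ycoef Y n k t) Ycoef_log; congr (_ *: Ycoef Y _ _ _).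
  by rewrite opprB opprK [1 + n]addrC addrK.
rewrite !E (linZ _ _ lS) Sop_mul; congr (_ *: tmap _ _ _).
rewrite (linD _ _ (iter_lin (leg12_lin lS) k)).
congr (_ + _); apply: iter_intertwine => y.
  exact/esym/S12_S13.
exact/esym/S12_S23.
Qed.

End Calculus.

(** * Factors of S *)

Section Functionals.
Variables (K : fieldType) (W : lmodType K).

(* The kernel of the functional is a maximal subspace avoiding [u]. *)
Lemma separating_functional (u : W) : u != 0 ->
  exists2 h : W -> K^o, linear h & h u = 1.
Proof.
move=> u0; pose P (A : set W) := (forall c x y, A x -> A y -> A (c *: x + y)) /\ ~ A u.
have [|A [[linA Au] maxA]] := @Zorn_bigcup W P.
  move=> F FP tF; split=> [c x y [X FX Xx] [Z FZ Zy]|[X FX Xu]]; last by have [_ []] := FP _ FX.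
  have [XZ|ZX] := tF _ _ FX FZ.
    by exists Z => //; apply: (FP _ FZ).1 => //; exact: XZ.
  by exists X => //; apply: (FP _ FX).1 => //; exact: ZX.
have A0 : A 0.
  apply: contrapT => A0; apply: (maxA [set 0]); last first.
    by split=> [c x y -> ->|/esym/eqP]; rewrite ?scaler0 ?addr0 // eq_sym (negbTE u0).
  split=> [x Ax|/(_ 0 erefl) //]; case: A0.
  by have := linA (-1) _ _ Ax Ax; rewrite scaleN1r addNr.
have AZ c x : A x -> A (c *: x) by move=> Ax; have := linA c _ _ Ax A0; rewrite addr0.
have exA v : exists c, A (v - c *: u).
  apply: contrapT => nex.
  pose B := [set w | exists a c, A a /\ w = a + c *: v].
  have Av : ~ A v by move=> Av; apply: nex; exists 0; rewrite scale0r subr0.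
  apply: (maxA B).
    split=> [x Ax|BA]; first by exists x, 0; rewrite scale0r addr0.
    by apply/Av/BA; exists 0, 1; rewrite scale1r add0r.
  split=> [c _ _ [a [d [Aa ->]]] [a' [d' [Aa' ->]]]|[a [c [Aa e]]]].
    exists (c *: a + a'), (c * d + d'); split; first exact: linA.
    by rewrite scalerDr addrACA scalerA -scalerDl.
  have c0 : c != 0 by apply/eqP => c0; apply: Au; rewrite e c0 scale0r addr0.
  apply: nex; exists c^-1; rewrite e scalerDr scalerA mulVf // scale1r opprD addrCA subrr addr0.
  by rewrite -scaleNr; exact: AZ.
have uniqA v c c' : A (v - c *: u) -> A (v - c' *: u) -> c = c'.
  move=> h h'; apply/eqP; rewrite -subr_eq0; apply: contra_notT Au => ne.
  have := AZ (c - c')^-1 _ (linA (-1) _ _ h h').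
  by rewrite scaleN1r opprB addrA subrK -scalerBl scalerA mulVf ?scale1r.
pose h v : K^o := projT1 (cid (exA v)).
have hA v : A (v - h v *: u) by rewrite /h; case: cid.
exists h; last by apply: uniqA (hA u) _; rewrite scale1r subrr.
move=> c x y; apply: uniqA (hA _) _.
rewrite -[c *: h x + h y]/(c * h x + h y) scalerDl opprD addrACA -scalerA -scalerBr.
exact: linA.
Qed.

(** A functional with value 1 at [d i] contracts the first factor and leaves a linear relation among
    the [g] whose i-th coefficient is 1. *)
Lemma tens_indep (U : lmodType K) (X : Type) m (d : 'I_m -> W) (g : 'I_m -> X -> U) :
  (forall c : 'I_m -> K, (forall x, \sum_(i < m) c i *: g i x = 0) -> forall i, c i = 0) ->
  (forall x, \sum_(i < m) tpure (d i) (g i x) = 0) -> forall i, d i = 0.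
Proof.
move=> indep h i; apply/eqP/negPn/negP => /separating_functional[e le e1].
have hb : bilin (fun w (u : U) => (e w : K) *: u).
  split=> [u|w] c x y; first by rewrite le scalerDl scalerA.
  by rewrite scalerDr !scalerA [c * _]mulrC.
have E x : \sum_(j < m) (e (d j) : K) *: g j x = 0.
  have := congr1 (tlift (fun w (u : U) => (e w : K) *: u)) (h x).
  rewrite (linsum _ _ _ (tlift_linear hb)) (lin0 (tlift_linear hb)) => E; rewrite -[RHS]E.
  by apply: eq_bigr => j _; rewrite tlift_tpure.
by have := indep (fun j => e (d j)) E i; rewrite e1 => /eqP; rewrite oner_eq0.
Qed.

End Functionals.

Section Elimination.
Variables (K : fieldType) (U W : lmodType K).

(** A linear relation among the second factors removes one term, at the cost of changing the first
    factors. *)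
Lemma bilin_eliminate (X : lmodType K) (B : U -> W -> X) m (f : 'I_m.+1 -> U)
    (g : 'I_m.+1 -> W) (c : 'I_m.+1 -> K) j : bilin B ->
  \sum_i c i *: g i = 0 -> c j != 0 ->
  \sum_i B (f i) (g i)
  = \sum_(i < m) B (f (lift j i) - (c (lift j i) / c j) *: f j) (g (lift j i)).
Proof.
move=> [bl br] h cj.
have {}h : g j = - \sum_(i < m) (c (lift j i) / c j) *: g (lift j i).
  apply: (scalerI cj); apply/eqP; rewrite scalerN -addr_eq0 scaler_sumr; apply/eqP.
  rewrite -[RHS]h (bigD1_ord j) //=; congr (_ + _); apply: eq_bigr => i _.
  by rewrite scalerA mulrCA divff ?mulr1.
rewrite (bigD1_ord j) //= {1}h.
rewrite -[B (f j) _]/(mkhom (br (f j)) _) -sumrN (lhom_sum (mkhom (br (f j)))).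
rewrite -big_split; apply: eq_bigr => i _ /=.
rewrite -scaleNr -[_ - _]addrC -scaleNr bl; congr (_ + _).
by rewrite (linZ _ _ (br (f j))).
Qed.

End Elimination.

Section TensorEndomorphisms.
Variable K : fieldType.

Lemma lhom_sum_app (U W : lmodType K) I (r : seq I) (f : I -> lhom U W) x :
  (\sum_(i <- r) f i) x = \sum_(i <- r) f i x.
Proof. exact: (big_morph (fun g : lhom U W => g x)). Qed.

Lemma has_parity_lin (U : superType K) p c (x y : U) :
  has_parity p x -> has_parity p y -> has_parity p (c *: x + y).
Proof. by move=> hx hy; rewrite /has_parity (spr_linear p) hx hy. Qed.

Lemma lin_depP (W : lmodType K) m (f : 'I_m -> W) : ~ lin_indep f ->
  exists c j, \sum_(i < m) c i *: f i = 0 /\ c j != 0.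
Proof.
by move=> /existsNP[c /not_implyP[h /existsNP[j /eqP cj]]]; exists c, j.
Qed.

Section OneSpace.
Variable U : superType K.
Implicit Types f g : lhom U U.

Lemma bilin_stens_factors t : bilin (fun f g => stens f g t).
Proof.
have E f g a b : stens f g (tpure a b) = \sum_(p : bool) \sum_(q : bool)
    (-1) ^+ (p && q) *: tpure (f (spr p a)) ((spr q g : lhom U U) b).
  exact: tlift_tpure (bilin_stens f g).
pose F a b f g := \sum_(p : bool) \sum_(q : bool)
  (-1) ^+ (p && q) *: tpure (f (spr p a) : U) ((spr q g : lhom U U) b).
split=> [g|f] c x y; move: t; (apply: tens_ext; first exact: stens_lin);
  try (apply: linear_combo; exact: stens_lin); move=> a b; rewrite !E.
  have lF : linear (fun f : lhom U U => F a b f g).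
    apply: linear_bigsum => p; apply: linear_bigsum => q; apply: linear_scaled => e u v.
    by rewrite lhomD lhomZ tpure_linl.
  exact: lF.
have lF : linear (F a b f).
  apply: linear_bigsum => p; apply: linear_bigsum => q; apply: linear_scaled => e u v.
  by rewrite (spr_linear q e u v) lhomD lhomZ tpure_linr.
exact: lF.
Qed.

(* [(phi (x) psi)(a (x) b) = phi(a) (x) (twist p psi)(b)] for [a] of parity [p]. *)
Definition twist (p : bool) g : lhom U U := spr false g + (-1) ^+ p *: spr true g.

Lemma twist_lin p : linear (twist p).
Proof.
move=> c f g; rewrite /twist !(spr_linear _ c f g) !scalerDr !scalerA [_ * c]mulrC.
exact: addrACA.
Qed.

Lemma twistK p : involutive (twist p).
Proof.
move=> g; rewrite {1}/twist.
have -> : spr false (twist p g) = spr false g.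
  rewrite /twist addrC (spr_linear false) (spr_parity _ (parity_spr true g)).
  by rewrite (spr_parity _ (parity_spr false g)) /= scaler0 add0r.
have -> : spr true (twist p g) = (-1) ^+ p *: spr true g.
  rewrite /twist addrC (spr_linear true) (spr_parity _ (parity_spr true g)).
  by rewrite (spr_parity _ (parity_spr false g)) /= addr0.
by rewrite scalerA signb_sq scale1r spr_sum.
Qed.

Lemma stens_twist f g p a b : has_parity p a ->
  stens f g (tpure a b) = tpure (f a) (twist p g b).
Proof.
move=> ha; rewrite -{1}(spr_sum g).
have := (bilin_stens_factors (tpure a b)).2 f 1 (spr false g) (spr true g).
rewrite !scale1r => ->.
rewrite !(stens_tpure _ _ ha (parity_spr _ g)) andbF andbT expr0 scale1r.
by rewrite /twist lhomD lhomZ -(linZ _ _ (tpure_linr (f a))) -(linD _ _ (tpure_linr (f a))).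
Qed.

Lemma twist_indep m p (g : 'I_m -> lhom U U) (c : 'I_m -> K) : lin_indep g ->
  (forall b, \sum_(i < m) c i *: twist p (g i) b = 0) -> forall i, c i = 0.
Proof.
move=> ig h; apply: ig; rewrite -[LHS](twistK p).
suff -> : twist p (\sum_(i < m) c i *: g i) = 0 by exact: lin0 (twist_lin p).
apply: lhom_ext => b; rewrite -[RHS](h b).
rewrite (linsum _ _ _ (twist_lin p)) lhom_sum_app; apply: eq_bigr => i _.
by rewrite (linZ _ _ (twist_lin p)) lhomZ.
Qed.

(** Injectivity of End(U) (x) End(U) -> End(U (x) U). If the [g] are dependent, one term is
    eliminated from both sums at once; if they are independent, every [f i] vanishes. *)
Lemma stens_inj m (f g : 'I_m -> lhom U U) :
  (forall t, \sum_(i < m) stens (f i) (g i) t = 0) ->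
  \sum_(i < m) tpure (f i) (g i) = 0.
Proof.
elim: m f g => [|m IH] f g h; first by rewrite big_ord0.
have [ig|/lin_depP[c [j [hc cj]]]] := pselect (lin_indep g); last first.
  have htp : bilin (fun f g : lhom U U => tpure f g) by split; [exact: tpure_linl|exact: tpure_linr].
  rewrite (bilin_eliminate f htp hc cj); apply: IH => t.
  by rewrite -(bilin_eliminate f (bilin_stens_factors t) hc cj).
have f0 i : f i = 0.
  apply: lhom_ext; apply: (parity_ext (lhomP (f i)) (lhomP 0)) => p a ha.
  apply: (@tens_indep _ _ _ _ _ (fun i => f i a) (fun i b => twist p (g i) b)).
    by move=> c; exact: twist_indep.
  move=> b; rewrite -[RHS](h (tpure a b)); apply: eq_bigr => k _.
  by rewrite (stens_twist _ _ _ ha).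
by apply: big1 => i _; rewrite f0 (lin0 (tpure_linl _)).
Qed.

Lemma opsum_inj (s : seq (lhom U U * lhom U U)) :
  (forall t, opsum s t = 0) -> \sum_(f <- s) tpure f.1 f.2 = 0.
Proof.
move=> h; rewrite (big_nth (0, 0)) big_mkord; apply: stens_inj => t.
by rewrite -[RHS](h t) /opsum (big_nth (0, 0)) big_mkord.
Qed.

Definition homogeneous_sum (S : tens U U -> tens U U) m
    (f g : 'I_m -> lhom U U) (p : 'I_m -> bool) :=
  (forall i, has_parity (p i) (f i) /\ has_parity (p i) (g i)) /\
  (forall t, S t = \sum_(i < m) stens (f i) (g i) t).

Lemma homogeneous_sum_reduce S m (f g : 'I_m.+1 -> lhom U U) p :
  homogeneous_sum S f g p -> ~ lin_indep g ->
  exists (f' g' : 'I_m -> lhom U U) p', homogeneous_sum S f' g' p'.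
Proof.
move=> [par hS] /lin_depP[c [j [hc cj]]].
(* Only the part of the relation of parity [p j] is kept, so that the new first factors stay
   homogeneous. *)
pose c' i := if p i == p j then c i else 0.
have hc' : \sum_i c' i *: g i = 0.
  transitivity (spr (p j) (\sum_i c i *: g i)).
    rewrite (linsum _ _ _ (spr_linear (p j))).
    apply: eq_bigr => i _; rewrite (linZ _ _ (spr_linear (p j))) (spr_parity _ (par i).2).
    by rewrite /c' eq_sym; case: ifP; rewrite ?scale0r ?scaler0.
  by rewrite hc (lin0 (spr_linear (p j))).
have cj' : c' j != 0 by rewrite /c' eqxx.
exists (fun i => f (lift j i) - (c' (lift j i) / c' j) *: f j), (fun i => g (lift j i)).
exists (fun i => p (lift j i)); split=> [i|t].
  split; last by have [] := par (lift j i).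
  have [hl _] := par (lift j i); have [hj _] := par j.
  rewrite /c'; case: eqP => [e|_]; last by rewrite mul0r scale0r subr0.
  by rewrite addrC -scaleNr; apply: has_parity_lin; rewrite // e.
by rewrite hS (bilin_eliminate f (bilin_stens_factors t) hc' cj').
Qed.

Lemma sswap_stens f g r t : has_parity r f -> has_parity r g ->
  sswap (stens f g (sswap t)) = stens g ((-1) ^+ r *: f) t.
Proof.
move=> hf hg; have lsw := @sswap_lin _ U; have lS := stens_lin f g.
move: t; apply: tens_parity_ext => [c x y|c x y|p q a b ha hb].
- by rewrite lsw lS lsw.
- exact: stens_lin.
have hf' : has_parity r ((-1) ^+ r *: f).
  by have := has_parity_lin ((-1) ^+ r) hf hf; rewrite /has_parity (linZ _ _ (spr_linear r)) hf.
rewrite (sswap_tpure ha hb) (linZ _ _ lS) (linZ _ _ lsw) (stens_tpure _ _ hb hg).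
rewrite (linZ _ _ lsw) (sswap_tpure (parity_app hf hb) (parity_app hg ha)).
rewrite (stens_tpure _ _ ha hf') lhomZ (linZ _ _ (tpure_linr (g a))) !scalerA -!signr_addb.
by congr ((-1) ^+ _ *: _); case: p q r {ha hb hf hg hf'} => [] [] [].
Qed.

Lemma homogeneous_sum_swap S m (f g : 'I_m -> lhom U U) p :
  (forall t, S (sswap t) = sswap (S t)) -> homogeneous_sum S f g p ->
  homogeneous_sum S g (fun i => (-1) ^+ (p i) *: f i) p.
Proof.
move=> swS [par hS]; split=> [i|t].
  have [hf hg] := par i; split=> //.
  by rewrite /has_parity (linZ _ _ (spr_linear (p i))) hf.
rewrite -[t](@sswapK _ U) swS hS (linsum _ _ _ (@sswap_lin _ U)) sswapK.
by apply: eq_bigr => i _; have [hf hg] := par i; rewrite (sswap_stens _ hf hg).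
Qed.

Lemma lin_indep_sign m (f : 'I_m -> lhom U U) (p : 'I_m -> bool) :
  lin_indep (fun i => (-1) ^+ (p i) *: f i) <-> lin_indep f.
Proof.
have aux (h : 'I_m -> lhom U U) : lin_indep h -> lin_indep (fun i => (-1) ^+ (p i) *: h i).
  move=> ih c hc i; have := ih (fun i => c i * (-1) ^+ (p i)).
  have E : \sum_(i < m) (c i * (-1) ^+ (p i)) *: h i = 0.
    by rewrite -[RHS]hc; apply: eq_bigr => k _; rewrite scalerA.
  by move=> /(_ E i)/eqP; rewrite mulf_eq0 signr_eq0 orbF => /eqP.
split=> [/aux|]; last exact: aux.
by congr lin_indep; apply: funext => i; rewrite scalerA signb_sq scale1r.
Qed.

(** Symmetry under P interchanges the two rows of factors, so a dependence among the [f] shortens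
    the sum just as one among the [g] does. *)
Lemma homogeneous_sum_indep S m (f g : 'I_m -> lhom U U) p :
  (forall t, S (sswap t) = sswap (S t)) -> homogeneous_sum S f g p ->
  exists m' (f' g' : 'I_m' -> lhom U U) p',
    [/\ homogeneous_sum S f' g' p', lin_indep f' & lin_indep g'].
Proof.
move=> swS; elim: m f g p => [|m IH] f g p hs.
  by exists 0%N, f, g, p; split=> // c _ [].
have [ig|ig] := pselect (lin_indep g); last first.
  by have [f' [g' [p' /IH]]] := homogeneous_sum_reduce hs ig.
have [jf|jf] := pselect (lin_indep f); first by exists m.+1, f, g, p.
have hs' := homogeneous_sum_swap swS hs.
have /(homogeneous_sum_reduce hs')[f' [g' [p' /IH]]] :
  ~ lin_indep (fun i => (-1) ^+ (p i) *: f i) by move/lin_indep_sign.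
by [].
Qed.

End OneSpace.
End TensorEndomorphisms.

Section FactorDerivations.
Variables (K : fieldType) (V : superType K) (Y : lhom V (LF V)).
Variables (S : tens V V -> tens V V) (m : nat) (f g : 'I_m -> lhom V V) (p : 'I_m -> bool).
Hypothesis Y_parity : forall q a, has_parity q a -> has_parity q (Y a).
Hypothesis S_fg : homogeneous_sum S f g p.
Hypothesis indep_g : lin_indep g.
Hypothesis S_Y : forall n k (x : tens (tens V V) V),
  S (tmap (Yz_coef Y n k) id x) = tmap (Yz_coef Y n k) id (leg13 S x + leg23 S x).

Lemma Yz_coef_parity q r a b n k : has_parity q a -> has_parity r b ->
  has_parity (q (+) r) (Y a b n k).
Proof.
move=> ha hb; have h := parity_app (Y_parity ha) hb.
by rewrite /has_parity -{2}h.
Qed.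

Lemma stens_idl (h : lhom V V) q a b : has_parity q a ->
  forall r, has_parity r h -> stens (idhom V) h (tpure a b) = (-1) ^+ (q && r) *: tpure a (h b).
Proof. by move=> ha r hh; rewrite (stens_tpure _ _ ha hh). Qed.

Lemma stens_idr (h : lhom V V) a b : stens h (idhom V) (tpure a b) = tpure (h a) b.
Proof.
rewrite (stens_even _ (idhom_even V)).
exact: (tmap_tpure a b (lhomP h) (@id_lin _ V)).
Qed.

(** Applied to a (x) b (x) c, compatibility becomes the vanishing of the sum of d_j (x) g_j(c),
    where d_j is the derivation defect of [f j] on a and b. As c varies, independence of the [g]
    kills each defect. *)
Lemma factor_Yder i : Yder Y (f i).
Proof.
apply: tens_parity_ext => [c x y|c x y|q r a b ha hb].
- by rewrite Yz_lin (lhomP (smap (f i))).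
- rewrite !stens_lin !Yz_lin scalerDr; exact: addrACA.
apply: lser_ext => n k; rewrite stens_idr (stens_idl _ ha (S_fg.1 i).1).
rewrite (linZ _ _ (Yz_lin Y)) lserD lserZ !Yz_tpure -[LHS]/(f i (Y a b n k)).
pose X := Ycoef Y n k.
have lX : linear (tmap X (@id V)) by exact: tmap_lin (lhomP X) (@id_lin _ V).
have Xt t c : tmap X id (tpure t c) = tpure (X t) (c : V).
  exact: (tmap_tpure t c (lhomP X) (@id_lin _ V)).
(* The sign of moving [g j] past the state a_(n) b, of parity p(a) + p(b). *)
pose e j := (-1) ^+ ((q (+) r) && p j) : K.
pose d j := e j *: (f j (Y a b n k) - Y (f j a) b n k)
  - (-1) ^+ (r && p j) *: Y a (f j b) n k.
have d0 j : d j = 0.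
  apply: (@tens_indep _ _ _ _ _ d (fun i c => g i c)) => [c hc|c].
    by apply: indep_g; apply: lhom_ext => c'; rewrite lhom_sum_app -[RHS](hc c').
  move: c; apply: parity_ext => [||s c hc].
  - apply: linear_bigsum => l u x y; rewrite (lhomP (g l)) tpure_linr //.
  - by move=> u x y; rewrite scaler0 addr0.
  have := S_Y n k (tpure (tpure a b) c).
  rewrite (linD _ _ lX) !Xt -[X _]/(Ycoef Y n k _) Ycoef_tpure.
  have -> : S = fun t => \sum_(j < m) stens (f j) (g j) t.
    by apply: funext => t; rewrite S_fg.2.
  rewrite leg13_sum => [|l]; last exact: stens_lin.
  rewrite leg23_sum => [|l]; last exact: stens_lin.
  move/eqP; rewrite !(linsum _ _ _ lX) -subr_eq0 opprD -!sumrN -!big_split => /eqP E.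
  rewrite -[RHS]E; apply: eq_bigr => l _ /=; have [hf hg] := S_fg.1 l.
  rewrite (leg13_stens_tpure hf hg ha hb hc) leg23_tpure; last exact: stens_lin.
  rewrite (stens_tpure _ _ (Yz_coef_parity n k ha hb) hg) (stens_tpure _ _ hb hg).
  rewrite (linZ _ _ (tpure_linr a)) (linZ _ _ (@tassocV_lin _ _ _ _)) tassocV_tpure.
  rewrite !(linZ _ _ lX) !Xt -![X _]/(Ycoef Y n k _) !Ycoef_tpure.
  rewrite /d -!(linZ _ _ (tpure_linl (g l c))) scalerBr.
  by rewrite -!scaleN1r -!(linZ _ _ (tpure_linl (g l c))) -!(linD _ _ (tpure_linl (g l c))) addrA.
have := d0 i; rewrite /d => /eqP; rewrite subr_eq0 => /eqP E.
have := congr1 (fun v => e i *: v) E; rewrite scalerA signb_sq scale1r => /eqP.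
rewrite subr_eq addrC => /eqP ->; congr (_ + _); rewrite scalerA /e -signr_addb.
by congr ((-1) ^+ _ *: _); case: q r (p i) {ha hb d d0 E e} => [] [] [].
Qed.

End FactorDerivations.

Section Adjoint.
Variables (K : fieldType) (V : superType K) (Y : lhom V (LF V)).
Hypothesis Y_parity : forall q a, has_parity q a -> has_parity q (Y a).

Lemma ad_Yder (f : lhom V V) p a : has_parity p f -> Yder Y f -> ad f (Y a) = Y (f a).
Proof.
move=> hf Df; move: a; apply: parity_ext => [c x y|c x y|q a ha].
- by rewrite (lhomP Y) (lhomP (ad f)).
- by rewrite (lhomP f) (lhomP Y).
apply: lhom_ext => b; rewrite (ad_homogeneous b hf (Y_parity ha)).
have := Df (tpure a b); rewrite stens_idr (stens_idl _ ha hf) (linZ _ _ (Yz_lin Y)).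
by rewrite !Yz_tpure => ->; rewrite andbC addrK.
Qed.

Lemma ad_parity (f : lhom V V) p : has_parity p f -> has_parity p (ad f).
Proof.
move=> hf; apply: parity_hom => q A hA; apply: parity_hom => r v hv.
rewrite (ad_homogeneous v hf hA) addrC -scaleNr; apply: has_parity_lin.
  have := parity_app hA (parity_app hf hv); rewrite addbCA addbA; exact.
have h := parity_app hA hv; apply: lser_ext => n k.
rewrite -[RHS]/(f (A v n k)) -addbA; have hn : has_parity (q (+) r) (A v n k) by rewrite /has_parity -{2}h.
exact: (parity_app hf hn).
Qed.

Lemma ad_lin : linear (@ad K V).
Proof.
move=> c f g; apply: lhom_ext => A; rewrite -[LHS]/(ad_field (c *: f + g) A).
rewrite -[RHS]/(c *: ad_field f A + ad_field g A) /ad_field.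
rewrite scaler_sumr -big_split; apply: eq_bigr => p _ /=.
rewrite scaler_sumr -big_split; apply: eq_bigr => q _ /=.
rewrite (spr_linear p c f g); apply: lhom_ext => v; apply: lser_ext => n k.
set B : LF V := spr q A; set F : lhom V V := spr p f; set G : lhom V V := spr p g.
rewrite -[LHS]/((c *: F (B v n k) + G (B v n k)) - (-1) ^+ (p && q) *: B (c *: F v + G v) n k).
rewrite -[RHS]/(c *: (F (B v n k) - (-1) ^+ (p && q) *: B (F v) n k)
  + (G (B v n k) - (-1) ^+ (p && q) *: B (G v) n k)).
rewrite (lhomP B) lserD lserZ scalerDr opprD addrACA scalerBr !scalerA.
by rewrite [c * _]mulrC.
Qed.

(** By [opsum_inj] the operator determines the element of End(V) (x) End(V), so (ad (x) ad)(S) does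
    not depend on the representation. *)
Lemma opsum_ad_eq (s s' : seq (lhom V V * lhom V V)) :
  (forall t, opsum s t = opsum s' t) -> forall x : tens (LF V) (LF V),
  opsum [seq (ad f.1, ad f.2) | f <- s] x = opsum [seq (ad f.1, ad f.2) | f <- s'] x.
Proof.
move=> h x; pose B (f g : lhom V V) := stens (ad f) (ad g) x.
have hB : bilin B.
  split=> [g|f] c f1 f2; rewrite /B ad_lin.
    exact: (bilin_stens_factors x).1.
  exact: (bilin_stens_factors x).2.
have E s0 : opsum [seq (ad f.1, ad f.2) | f <- s0] x
    = tlift B (\sum_(f <- s0) tpure f.1 f.2).
  rewrite (linsum _ _ _ (tlift_linear hB)) /opsum big_map.
  by apply: eq_bigr => f _; rewrite tlift_tpure.
rewrite !E; congr (tlift B _); apply/eqP; rewrite -subr_eq0 -sumrN; apply/eqP.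
have F (f : lhom V V * lhom V V) : - tpure f.1 f.2 = tpure (- f.1) f.2.
  by rewrite -scaleN1r -(linZ _ _ (tpure_linl f.2)) scaleN1r.
under [X in _ + X]eq_bigr => f _ do rewrite F.
have := @opsum_inj _ _ (s ++ [seq (- f.1, f.2) | f <- s']).
rewrite big_cat big_map; apply=> t; rewrite /opsum big_cat big_map /=.
rewrite -[X in X + _]/(opsum s t) h /opsum -big_split big1 // => f _ /=.
have := (bilin_stens_factors t).1 f.2 (-1) f.1 0; rewrite /= addr0 scaleN1r => ->.
have -> : stens (0 : lhom V V) f.2 t = 0.
  have := (bilin_stens_factors t).1 f.2 (-1) 0 0.
  by rewrite /= scaler0 addr0 scaleN1r addNr.
by rewrite addr0 scaleN1r subrr.
Qed.

End Adjoint.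

Section Factors.
Variables (K : numFieldType) (V : superType K) (vac : V) (T : lhom V V) (Y : lhom V (LF V)).
Variables (m : nat) (Phi Psi : 'I_m -> lhom (LF V) (LF V)).
Hypothesis HV : log_vertex_algebra Phi Psi vac T Y.
Local Notation S := (Sop Phi Psi vac Y).

Theorem Sop_derivations : exists m' (f g : 'I_m' -> lhom V V) p,
  homogeneous_sum S f g p /\ (forall i, Yder Y (f i) /\ Yder Y (g i)).
Proof.
have hs : exists p, homogeneous_sum S (fun i => state_op vac Y (Phi i))
    (fun i => state_op vac Y (Psi i)) p.
  pose p i := projT1 (cid (lva_parity HV i)).
  exists p; split=> [i|t]; last exact: Sop_sum HV t.
  rewrite /p; case: cid => r [h1 h2] /=.
  by split; apply: (state_op_parity HV).
have [p /(homogeneous_sum_indep (Sop_swap HV))[m' [f [g [p' [hfg jf jg]]]]]] := hs.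
exists m', f, g, p'; split=> // i; split.
  exact: (factor_Yder (Y_even HV) hfg jg (Sop_Yz_coef HV)).
(* The representation exchanged by P has the [g] as first factors. *)
apply: (factor_Yder (Y_even HV) (homogeneous_sum_swap (Sop_swap HV) hfg) _ (Sop_Yz_coef HV)).
by apply/lin_indep_sign.
Qed.

(** The given representation is traded for the one by derivations, for which ad f takes Y(a,z) to
    Y(f a,z). *)
Theorem Shat_ad s : (forall t, S t = opsum s t) ->
  forall t, Shat Phi Psi (tmap Y Y t) = opsum [seq (ad f.1, ad f.2) | f <- s] (tmap Y Y t).
Proof.
move=> hs t; have [m' [f [g [p [[par hfg] der]]]]] := Sop_derivations.
pose s' := [seq (f i, g i) | i <- enum 'I_m'].
have hs' x : opsum s x = opsum s' x.
  by rewrite -hs hfg /opsum big_map big_enum.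
rewrite (opsum_ad_eq hs') -(tmap_Y_Sop HV) hfg /opsum big_map /s' big_map big_enum.
rewrite (linsum _ _ _ (tmap_lin (lhomP Y) (lhomP Y))); apply: eq_bigr => i _ /=.
have [hf hg] := par i; have [df dg] := der i.
apply: (tmap_stens (lhomP Y) (Y_even HV) hg (ad_parity hg)) => a; apply/esym.
  exact: (ad_Yder (Y_even HV) a hf df).
exact: (ad_Yder (Y_even HV) a hg dg).
Qed.

End Factors.

Local Open Scope complex_scope.

(** The relation with Y(z) is expressed for each coefficient in z and zeta. The formula for Shat is
    asserted for every representation of S, so it includes the independence of (ad (x) ad)(S) from
    the choice. *)
Theorem proposition3p11 (R : realType) (V : superType R[i]) (vac : V)
    (T : lhom V V) (Y : lhom V (LF V)) (m : nat)
    (Phi Psi : 'I_m -> lhom (LF V) (LF V))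
    (HV : log_vertex_algebra Phi Psi vac T Y) :
  let S := Sop Phi Psi vac Y in
  braiding_map S
  /\ (forall t, exists r, iter r S t = 0)
  /\ ((forall n, derivation (mu_n Y n) T
                 /\ compatible_braiding vac T (mu_n Y n) S)
      /\ two_sided_unit vac (mu_n Y (-1)))
  /\ (forall n k (x : tens (tens V V) V),
        S (tmap (Yz_coef Y n k) id x)
        = tmap (Yz_coef Y n k) id (leg13 S x + leg23 S x))
  /\ (exists2 s : seq (lhom V V * lhom V V),
        (forall f, f \in s -> Yder Y f.1 /\ Yder Y f.2)
        & (forall t, S t = opsum s t))
  /\ (forall s : seq (lhom V V * lhom V V),
        (forall t, S t = opsum s t) ->
        forall t, Shat Phi Psi (tmap Y Y t)
                  = opsum [seq (ad f.1, ad f.2) | f <- s] (tmap Y Y t)).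
Proof.
move=> S; split; first exact: Sop_braiding HV.
split; first exact: Sop_nil HV.
split; first by split=> [n|]; [split; [exact: mu_derivation HV n|exact: mu_compatible HV n]|exact: mu_unit HV].
split; first exact: Sop_Yz_coef HV.
split; last exact: Shat_ad HV.
have [m' [f [g [p [[_ hfg] der]]]]] := Sop_derivations HV.
exists [seq (f i, g i) | i <- enum 'I_m'] => [h /mapP[i _ ->]|t]; first exact: der.
by rewrite /S hfg /opsum big_map big_enum.
Qed.
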